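(* Let $n\ge2$, let $\Omega\subset\mathbb{R}^n$ be a domain, and let $F\in C^1(\Omega\times\mathbb{R}\times\mathbb{R}^n\times\mathcal{S}^{n\times n})$ be such that the matrix $\left(-\frac{\partial F}{\partial M_{ij}}(x,s,p,M)\right)$ is positive definite for all $(x,s,p,M)\in\Omega\times\mathbb{R}\times\mathbb{R}^n\times\mathcal{S}^{n\times n}$. Let $E\subset\Omega$ be a closed (hence compact) subset of $\mathbb{R}^n$ of zero (Newtonian) capacity. Assume that $u\in LSC(\Omega\setminus E)$ and $v\in C^2(\Omega)$ satisfy, for some constant $C$, $$\Delta u\le C\qquad\text{in }\Omega\setminus E\ \text{ in the viscosity sense},$$ $$u>v\qquad\text{in }\Omega\setminus E,$$ $$F(x,u,\nabla u,\nabla^2u)\ge F(x,v,\nabla v,\nabla^2v)\qquad\text{in }\Omega\setminus E\ \text{ in the viscosity sense}.$$ Then $$\liminf_{x\in\Omega\setminus E,\ \mathrm{dist}(x,E)\to0}(u-v)(x)>0.$$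
   Context: A domain is a bounded connected open set. $\mathcal{S}^{n\times n}$ is the set of real symmetric $n\times n$ matrices. For an open set $D$, $LSC(D)$ is the set of lower semicontinuous functions $u:D\to\mathbb{R}\cup\{+\infty\}$, i.e. $\liminf_{x\to\bar x}u(x)\ge u(\bar x)$ for all $\bar x\in D$. Viscosity sense: whenever $\varphi\in C^2(\Omega\setminus E)$, $\varphi\le u$ in $\Omega\setminus E$ and $\varphi(\bar x)=u(\bar x)$ for some $\bar x\in\Omega\setminus E$, then $\Delta\varphi(\bar x)\le C$ (for the first inequality), respectively $F(\bar x,\varphi(\bar x),\nabla\varphi(\bar x),\nabla^2\varphi(\bar x))\ge F(\bar x,v(\bar x),\nabla v(\bar x),\nabla^2v(\bar x))$ (for the last inequality). For $n=2$, zero capacity means zero logarithmic capacity. *)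

(* Defs.v *)
From HB Require Import structures.
From mathcomp Require Import all_boot all_order all_algebra.
From mathcomp Require Import all_classical all_reals all_analysis.

Set Implicit Arguments.
Unset Strict Implicit.
Unset Printing Implicit Defensive.

Import Order.TTheory GRing.Theory Num.Theory.
Import numFieldNormedType.Exports.

Local Open Scope classical_set_scope.
Local Open Scope ring_scope.

Section Space.
Context {R : realType} {n : nat}.

(* The library norm on 'rV[R]_n is the sup norm. *)
Definition enorm (x : 'rV[R]_n) : R := Num.sqrt (\sum_i x ord0 i ^+ 2).

(* Extended-valued, so that the distance to the empty set is +oo. *)
Definition dist_to (E : set 'rV[R]_n) (x : 'rV[R]_n) : \bar R :=
  ereal_inf [set (enorm (x - y))%:E | y in E].

(* The filter of [x in D, dist(x, E) -> 0]. *)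
Definition near_set (E D : set 'rV[R]_n) : set (set 'rV[R]_n) :=
  filter_from [set d : R | 0 < d]
    (fun d => [set x | D x /\ (dist_to E x < d%:E)%E]).

Definition is_domain (Omega : set 'rV[R]_n) : Prop :=
  [/\ open Omega, connected Omega & bounded_set Omega].

End Space.

Section Capacity.
Context {R : realType} {n : nat}.
Local Open Scope ereal_scope.

Definition borelRn := g_sigma_algebraType (@open 'rV[R]_n).

(* On the diagonal the first kernel is 0^-1 = +oo, and so is the second, since
   lne 0 = -oo. *)
Definition newton_kernel (x y : 'rV[R]_n) : \bar R :=
  ((enorm (x - y) ^+ (n - 2))%:E)^-1.

Definition log_kernel (x y : 'rV[R]_n) : \bar R := - lne (enorm (x - y))%:E.

Definition energy (k : 'rV[R]_n -> 'rV[R]_n -> \bar R) (E : set 'rV[R]_n)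
    (mu : probability borelRn R) : \bar R :=
  \int[mu]_(x in E) \int[mu]_(y in E) k x y.

(* The infimum is over the Borel probability measures carried by E; it is +oo
   when E is empty. *)
Definition min_energy (k : 'rV[R]_n -> 'rV[R]_n -> \bar R)
    (E : set 'rV[R]_n) : \bar R :=
  ereal_inf [set energy k E mu
            | mu in [set mu : probability borelRn R | mu E = 1]].

Definition newtonian_capacity (E : set 'rV[R]_n) : \bar R :=
  (min_energy newton_kernel E)^-1.

Definition log_capacity (E : set 'rV[R]_n) : \bar R :=
  expeR (- min_energy log_kernel E).

(* Meant for compact E and 2 <= n. *)
Definition zero_capacity (E : set 'rV[R]_n) : Prop :=
  if n == 2%N then log_capacity E = 0 else newtonian_capacity E = 0.

End Capacity.

Section Calculus.
Context {R : realType}.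

(* f has continuous directional derivatives on D along all directions in B.
   This is the usual C^1 when B spans the directions tangent to D. *)
Definition C1_along (V : normedModType R) (B D : set V) (f : V -> R) : Prop :=
  forall w, B w ->
    (forall x, D x -> derivable f x w) /\
    {within D, continuous (fun x => 'D_w f x)}.

Context {n : nat}.

Definition basis_vec (i : 'I_n) : 'rV[R]_n := delta_mx ord0 i.

Definition partial (i : 'I_n) (f : 'rV[R]_n -> R) : 'rV[R]_n -> R :=
  fun x => 'D_(basis_vec i) f x.

Definition C1_on (D : set 'rV[R]_n) (f : 'rV[R]_n -> R) : Prop :=
  C1_along (range basis_vec) D f.

Definition C2_on (D : set 'rV[R]_n) (f : 'rV[R]_n -> R) : Prop :=
  C1_on D f /\ forall i, C1_on D (partial i f).

Definition gradient (f : 'rV[R]_n -> R) (x : 'rV[R]_n) : 'rV[R]_n :=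
  \row_i partial i f x.

Definition hessian (f : 'rV[R]_n -> R) (x : 'rV[R]_n) : 'M[R]_n :=
  \matrix_(i, j) partial i (partial j f) x.

Definition laplacian (f : 'rV[R]_n -> R) (x : 'rV[R]_n) : R :=
  \sum_i partial i (partial i f) x.

End Calculus.

Section Operator.
Context {R : realType} {n : nat}.

(* The variables (x, s, p, M) of the operator F. A function of a symmetric
   matrix is represented by a total function on 'M[R]_n whose values at
   non-symmetric M are never used. *)
Definition jet_space : Type := ('rV[R]_n * R * 'rV[R]_n * 'M[R]_n)%type.

Definition jet (f : 'rV[R]_n -> R) (x : 'rV[R]_n) : jet_space :=
  (x, f x, gradient f x, hessian f x).

Definition sym_jets : set ('rV[R]_n * R * 'rV[R]_n * 'M[R]_n) :=
  [set z | z.2^T = z.2].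

Definition sym_jets_over (Omega : set 'rV[R]_n) :
    set ('rV[R]_n * R * 'rV[R]_n * 'M[R]_n) :=
  [set z | Omega z.1.1.1 /\ sym_jets z].

Definition C1_operator (Omega : set 'rV[R]_n) (F : jet_space -> R) : Prop :=
  C1_along sym_jets (sym_jets_over Omega) F.

(* F_{M_ij}, normalized as the gradient for the Frobenius inner product on
   symmetric matrices: dF(N) = \sum_(i, j) F_{M_ij} N_ij for symmetric N. *)
Definition dF_dM (F : jet_space -> R) (z : jet_space) : 'M[R]_n :=
  \matrix_(i, j)
    'D_((0, 0, 0, 2^-1 *: (delta_mx i j + delta_mx j i)) :
         'rV[R]_n * R * 'rV[R]_n * 'M[R]_n) F z.

Definition posdefmx (A : 'M[R]_n) : Prop :=
  A^T = A /\
  forall xi : 'rV[R]_n, xi != 0 -> 0 < (xi *m A *m xi^T) ord0 ord0.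

End Operator.

Section Viscosity.
Context {R : realType} {n : nat}.

(* u : D -> R \cup {+oo}, lower semicontinuous; u is junk outside D. *)
Definition LSC (D : set 'rV[R]_n) (u : 'rV[R]_n -> \bar R) : Prop :=
  forall x, D x ->
    u x != -oo%E /\ (u x <= limf_einf u (within D (nbhs x)))%E.

(* P phi x holds whenever phi in C^2(D) touches u from below at x in D. *)
Definition touching_below (D : set 'rV[R]_n) (u : 'rV[R]_n -> \bar R)
    (P : ('rV[R]_n -> R) -> 'rV[R]_n -> Prop) : Prop :=
  forall phi : 'rV[R]_n -> R, C2_on D phi ->
    (forall x, D x -> ((phi x)%:E <= u x)%E) ->
    forall x, D x -> (phi x)%:E = u x -> P phi x.

Definition visc_laplacian_le (D : set 'rV[R]_n) (u : 'rV[R]_n -> \bar R)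
    (C : R) : Prop :=
  touching_below D u (fun phi x => laplacian phi x <= C).

Definition visc_F_ge (D : set 'rV[R]_n) (F : @jet_space R n -> R)
    (u : 'rV[R]_n -> \bar R) (v : 'rV[R]_n -> R) : Prop :=
  touching_below D u (fun phi x => F (jet v x) <= F (jet phi x)).

End Viscosity.

(* Main.v *)
(* Suppose the liminf of u - v is 0.  Lower u - v by an exponential barrier and
   a small linear function of slope p: by ellipticity and the viscosity
   inequality for F the resulting contact cannot take place off E, so every
   small slope p is attained at a contact point of E.  Since Delta u <= C and E
   has zero capacity, finite sums of fundamental solutions that are large on E
   (Leja points) allow comparison across E; applied with a quadratic barrier,
   comparison shows that the contact slope is a Lipschitz function of the contact
   point.  A grid of slopes therefore produces arbitrarily many points of E that
   are as separated as a grid in R^n, hence of bounded discrete energy.  But zero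
   capacity makes the discrete energies on E diverge: otherwise, coding points of
   E by reals, Helly's selection theorem gives a limit of the normalised counting
   measures, and Fatou's lemma shows that it has finite energy. *)

Require Import Defs.
From mathcomp Require Import all_boot all_order all_algebra.
From mathcomp Require Import all_classical all_reals all_analysis.
From mathcomp Require Import measurable_realfun ring lra.
Import Order.TTheory GRing.Theory Num.Theory.
Import numFieldNormedType.Exports.

Set Implicit Arguments.
Unset Strict Implicit.
Unset Printing Implicit Defensive.

Local Open Scope classical_set_scope.
Local Open Scope ring_scope.

(** * Second-order calculus *)

Section DirectionalDerivatives.
Context {R : realType} {V : normedModType R}.
Implicit Types (f : V -> R) (x v : V).

(** The scheme is that of Alexandrov, Bakelman and Pucci: a slope map that is Lipschitz on the
    contact set and covers a cube forces that set to be large. A count of discrete energies over a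
    grid of slopes takes the place of Lebesgue measure. The obstacle is that the values of [u] on
    [E] carry no information. Contact at a point of [E] only means that points off [E] come
    arbitrarily close to equality, and no test function can be placed there. The two viscosity
    inequalities therefore have separate duties. The one for [F] is used off [E], to push contact
    onto [E]. The one for the Laplacian, being linear, survives the subtraction of a small multiple
    of a harmonic potential that is large near [E]. Since [u] lies above [v], this potential only
    has to exceed a given bound, and a finite sum can do that. *)

Lemma is_derive_line f x v (t d : R) :
  is_derive (x + t *: v) v f d <-> is_derive t 1 (fun s => f (x + s *: v)) d.
Proof.
have E : (fun h : R => h^-1 *: ((f \o shift (x + t *: v)) (h *: v)
                          - f (x + t *: v))) =
         (fun h : R => h^-1 *: (((fun s : R => f (x + s *: v)) \o shift t)
                          (h *: 1) - f (x + t *: v))).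
  by apply/funext => h /=; rewrite [_ *: 1]mulr1 addrCA -scalerDl.
by split=> -[dx dv]; split; move: dx dv; rewrite /derivable /derive E.
Qed.

Lemma is_derive_comp f (g : R -> R) x v (df dg : R) :
  is_derive x v f df -> is_derive (f x) 1 g dg ->
  is_derive x v (g \o f) (dg * df).
Proof.
have xE : x = x + 0 *: v by rewrite scale0r addr0.
rewrite {1 3}xE => /is_derive_line hf hg; apply/is_derive_line.
apply: (@is_derive1_comp _ g (fun s : R => f (x + s *: v))) => //.
by rewrite -xE.
Qed.

Lemma MVT_line f x v :
  (forall t : R, 0 <= t <= 1 -> derivable f (x + t *: v) v) ->
  exists2 t : R, 0 <= t <= 1 & f (x + v) - f x = 'D_v f (x + t *: v).
Proof.
move=> df.
have dl (t : R) : 0 <= t <= 1 ->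
    is_derive t 1 (fun s => f (x + s *: v)) ('D_v f (x + t *: v)).
  by move=> t01; apply/is_derive_line; exact/derivableP/df.
have [t|t|t t01 ] := @MVT_segment R (fun s => f (x + s *: v))
  (fun t => 'D_v f (x + t *: v)) 0 1 ler01.
- by rewrite in_itv /= => /andP[t0 t1]; apply: dl; rewrite !ltW.
- apply: derivable_within_continuous => {}t; rewrite in_itv /= => t01.
  by have [] := dl _ t01.
rewrite scale0r scale1r addr0 subr0 mulr1 => ->; exists t => //.
Qed.

Lemma derivable_scale_dir f x v (a : R) :
  derivable f x v -> is_derive x (a *: v) f (a * 'D_v f x).
Proof.
have xE : x = x + 0 *: v by rewrite scale0r addr0.
have xE' : x = x + 0 *: (a *: v) by rewrite scale0r addr0.
move=> /derivableP; rewrite {1}xE => /is_derive_line hf.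
rewrite {1}xE'; apply/is_derive_line.
have -> : (fun s : R => f (x + s *: (a *: v))) =
          (fun s : R => f (x + s *: v)) \o ( *%R^~ a).
  by apply/funext => s /=; rewrite scalerA.
rewrite mulrC; apply: is_derive1_comp; first by rewrite mul0r.
have := @is_deriveM R R id (cst a) 0 1 1 0 (is_derive_id _ _) (is_derive_cst _ _ _).
rewrite /GRing.scale /= mulr0 mulr1 add0r; apply.
Qed.

End DirectionalDerivatives.

Section Jets.
Context {R : realType} {n : nat}.
Implicit Types (D : set 'rV[R]_n) (f : 'rV[R]_n -> R) (x : 'rV[R]_n).

(** Carrying the derivatives [g] and [H] as explicit witnesses lets gradients and Hessians of sums
    and compositions be computed by closure lemmas. Continuity is taken in the whole space, not
    within [D]; for open [D] this amounts to [C2_on]. *)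
Record jet_on D f (g : 'I_n -> 'rV[R]_n -> R)
    (H : 'I_n -> 'I_n -> 'rV[R]_n -> R) : Prop := JetOn {
  jet_cont : forall x, D x -> {for x, continuous f};
  jet_cont1 : forall i x, D x -> {for x, continuous (g i)};
  jet_cont2 : forall i j x, D x -> {for x, continuous (H i j)};
  jet_der1 : forall i x, D x -> is_derive x (basis_vec i) f (g i x);
  jet_der2 : forall i j x, D x -> is_derive x (basis_vec i) (g j) (H i j x) }.

Lemma jet_on_sub D D' f g H : D' `<=` D -> jet_on D f g H -> jet_on D' f g H.
Proof. by move=> D'D [c c1 c2 d1 d2]; split=> *; auto. Qed.

Lemma jet_on_cst D (c : R) : jet_on D (cst c) (fun=> cst 0) (fun _ _ => cst 0).
Proof.
by split=> *; [exact: cst_continuous|exact: cst_continuous|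
  exact: cst_continuous|exact: is_derive_cst|exact: is_derive_cst].
Qed.

Lemma is_derive_coord x (i j : 'I_n) :
  is_derive x (basis_vec i) (fun y : 'rV[R]_n => y ord0 j) (i == j)%:R.
Proof.
have xE : x = x + 0 *: basis_vec i by rewrite scale0r addr0.
rewrite xE; apply/is_derive_line.
have -> : (fun s : R => (x + s *: basis_vec i) ord0 j) =
    cst (x ord0 j) + (i == j)%:R \*: (id : R -> R).
  by apply/funext => s; rewrite !mxE eqxx /= eq_sym mulrC.
apply: is_derive_eq.
by rewrite add0r [LHS]mulr1.
Qed.

Lemma jet_on_coord D (j : 'I_n) :
  jet_on D (fun x => x ord0 j) (fun i => cst (i == j)%:R) (fun _ _ => cst 0).
Proof.
split=> *; [exact: coord_continuous|exact: cst_continuous|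
  exact: cst_continuous|exact: is_derive_coord|exact: is_derive_cst].
Qed.

Lemma jet_on_add D f1 g1 H1 f2 g2 H2 :
  jet_on D f1 g1 H1 -> jet_on D f2 g2 H2 ->
  jet_on D (fun x => f1 x + f2 x) (fun i x => g1 i x + g2 i x)
    (fun i j x => H1 i j x + H2 i j x).
Proof.
move=> [c c1 c2 d1 d2] [c' c1' c2' d1' d2'].
split=> *; [apply: continuousD|apply: continuousD|apply: continuousD|
  apply: is_deriveD|apply: is_deriveD]; auto.
Qed.

Lemma jet_on_scale D (a : R) f g H : jet_on D f g H ->
  jet_on D (fun x => a * f x) (fun i x => a * g i x)
    (fun i j x => a * H i j x).
Proof.
move=> [c c1 c2 d1 d2].
split=> *; [apply: continuousM|apply: continuousM|apply: continuousM|
  apply: (is_deriveZ a)|apply: (is_deriveZ a)];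
  by [auto|exact: cst_continuous].
Qed.

Lemma jet_on_sum D (I : Type) (r : seq I) (f : I -> 'rV[R]_n -> R) g H :
  (forall k, jet_on D (f k) (g k) (H k)) ->
  jet_on D (fun x => \sum_(k <- r) f k x) (fun i x => \sum_(k <- r) g k i x)
    (fun i j x => \sum_(k <- r) H k i j x).
Proof.
move=> jf; elim: r => [|k r IH].
  have -> : (fun x => \sum_(k <- [::]) f k x) = cst 0.
    by apply/funext => x; rewrite big_nil.
  have -> : (fun i x => \sum_(k <- [::]) g k i x) = fun=> cst 0.
    by apply/funext => i; apply/funext => x; rewrite big_nil.
  have -> : (fun i j x => \sum_(k <- [::]) H k i j x) = fun _ _ => cst 0.
    by apply/funext => i; apply/funext => j; apply/funext => x; rewrite big_nil.
  exact: jet_on_cst.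
have -> : (fun x => \sum_(l <- k :: r) f l x) =
    fun x => f k x + \sum_(l <- r) f l x.
  by apply/funext => x; rewrite big_cons.
have -> : (fun i x => \sum_(l <- k :: r) g l i x) =
    fun i x => g k i x + \sum_(l <- r) g l i x.
  by apply/funext => i; apply/funext => x; rewrite big_cons.
have -> : (fun i j x => \sum_(l <- k :: r) H l i j x) =
    fun i j x => H k i j x + \sum_(l <- r) H l i j x.
  by apply/funext => i; apply/funext => j; apply/funext => x; rewrite big_cons.
exact: jet_on_add.
Qed.

Lemma jet_on_comp D (k k1 k2 : R -> R) f g H :
  (forall x, D x -> is_derive (f x) 1 k (k1 (f x))) ->
  (forall x, D x -> is_derive (f x) 1 k1 (k2 (f x))) ->
  (forall x, D x -> {for f x, continuous k2}) ->
  jet_on D f g H ->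
  jet_on D (fun x => k (f x)) (fun i x => k1 (f x) * g i x)
    (fun i j x => k1 (f x) * H i j x + k2 (f x) * g i x * g j x).
Proof.
move=> dk dk1 ck2 [c c1 c2 d1 d2].
have ck x : D x -> {for x, continuous (k \o f)}.
  move=> Dx; apply: continuous_comp; first exact: c.
  apply/differentiable_continuous/derivable1_diffP.
  by have [] := dk _ Dx.
have ck1 x : D x -> {for x, continuous (k1 \o f)}.
  move=> Dx; apply: continuous_comp; first exact: c.
  apply/differentiable_continuous/derivable1_diffP.
  by have [] := dk1 _ Dx.
have ck2' x : D x -> {for x, continuous (k2 \o f)}.
  by move=> Dx; apply: continuous_comp; [exact: c|exact: ck2].
split=> //.
- by move=> i x Dx; apply: continuousM; [exact: ck1|exact: c1].
- move=> i j x Dx; apply: continuousD; first apply: continuousM.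
  + exact: ck1.
  + exact: c2.
  by apply: continuousM; [apply: continuousM|]; auto.
- by move=> i x Dx; apply: is_derive_comp; auto.
- move=> i j x Dx.
  have := is_deriveM (is_derive_comp (d1 i x Dx) (dk1 x Dx)) (d2 i j x Dx).
  by move/is_derive_eq; apply; rewrite /GRing.scale /=; ring.
Qed.

End Jets.

Section Lipschitz.
Context {R : realType} {n : nat}.
Implicit Types (f : 'rV[R]_n -> R) (x y : 'rV[R]_n).

Lemma rV_norm_le x (e : R) : 0 <= e ->
  (`|x| <= e) <-> forall i, `|x ord0 i| <= e.
Proof.
move=> e0; rewrite [`|x|]mx_normrE; split=> [/bigmax_leP[_ h] i|h].
  exact: (h (ord0, i)).
by apply/bigmax_leP; split=> // -[i j] _; rewrite ord1 /=.
Qed.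

Lemma rV_norm_lt x (e : R) : 0 < e ->
  (`|x| < e) <-> forall i, `|x ord0 i| < e.
Proof.
move=> e0; rewrite [`|x|]mx_normrE; split=> [/bigmax_ltP[_ h] i|h].
  exact: (h (ord0, i)).
by apply/bigmax_ltP; split=> // -[i j] _; rewrite ord1 /=.
Qed.

Lemma ler_coord_norm x i : `|x ord0 i| <= `|x|.
Proof. by move: i; apply/rV_norm_le. Qed.

(** Coordinates are changed one at a time, [z k] having switched the first [k]. These intermediate
    points remain in the ball because a ball of the sup norm is a cube. *)
Lemma lipschitz_of_partials f x (r L : R) :
  (forall y, `|y - x| < r -> forall i,
     derivable f y (basis_vec i) /\ `|partial i f y| <= L) ->
  forall y, `|y - x| < r ->
    `|f y - f x| <= L * \sum_i `|y ord0 i - x ord0 i|.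
Proof.
move=> df y yr; have r0 : 0 < r by apply: le_lt_trans yr.
pose z (k : nat) : 'rV[R]_n :=
  \row_i (if (i < k)%N then y ord0 i else x ord0 i).
have -> : f y - f x = \sum_(0 <= k < n) (f (z k.+1) - f (z k)).
  rewrite (@telescope_sumr _ 0 n (f \o z)) //=; congr (f _ - f _).
    by apply/rowP => i; rewrite mxE ltn_ord.
  by apply/rowP => i; rewrite mxE ltn0.
rewrite big_mkord (le_trans (ler_norm_sum _ _ _)) // mulr_sumr.
apply: ler_sum => k _.
pose a := y ord0 k - x ord0 k.
have zE : z k.+1 = z k + a *: basis_vec k.
  apply/rowP => i; rewrite !mxE eqxx /= ltnS leq_eqVlt -val_eqE /=.
  have [/val_inj->|_] := eqVneq (i : nat) k; last by rewrite mulr0 addr0.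
  by rewrite ltnn mulr1 /a; ring.
have zr (t : R) : 0 <= t <= 1 -> `|z k + t *: (a *: basis_vec k) - x| < r.
  move=> /andP[t0 t1]; apply/rV_norm_lt => // i; rewrite !mxE eqxx /=.
  have yir : `|y ord0 i - x ord0 i| < r.
    by have /rV_norm_lt := yr; move=> /(_ r0 i); rewrite !mxE.
  have [ik|ik] := eqVneq i k.
    rewrite ik in yir *; rewrite ltnn mulr1 addrAC subrr add0r normrM ger0_norm //.
    by apply: le_lt_trans yir; rewrite /a ler_piMl.
  by rewrite !mulr0 addr0; case: ifP => // _; rewrite subrr normr0.
have [|t t01] := @MVT_line R _ f (z k) (a *: basis_vec k).
  move=> t t01; have [d _] := df _ (zr t t01) k.
  by have [] := derivable_scale_dir a d.
rewrite -zE => ->; have [d dL] := df _ (zr t t01) k.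
have [_ ->] := derivable_scale_dir a d.
by rewrite normrM mulrC ler_wpM2r.
Qed.

End Lipschitz.

Section C2.
Context {R : realType} {n : nat}.
Implicit Types (D : set 'rV[R]_n) (f : 'rV[R]_n -> R) (x : 'rV[R]_n).

Lemma jet_partial D f g H : open D -> jet_on D f g H ->
  (forall i x, D x -> partial i f x = g i x) /\
  (forall i j x, D x -> partial i (partial j f) x = H i j x).
Proof.
move=> oD jf.
have p1 i x : D x -> partial i f x = g i x.
  by move=> Dx; have [_] := jet_der1 jf i Dx.
split=> // i j x Dx; have [_ <-] := jet_der2 jf i j Dx.
rewrite /partial; apply: near_eq_derive.
have nD : nbhs x D by exact: open_nbhs_nbhs.
by apply: filterS nD => y Dy; rewrite -[LHS]/(partial j f y) p1.
Qed.

Lemma C2_on_jet D f g H : open D -> jet_on D f g H -> C2_on D f.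
Proof.
move=> oD jf; have [p1 p2] := jet_partial oD jf.
have cont (h k : 'rV[R]_n -> R) : (forall x, D x -> h x = k x) ->
    (forall x, D x -> {for x, continuous k}) -> {within D, continuous h}.
  move=> hk ck; rewrite continuous_open_subspace // => x /set_mem Dx.
  have nD : nbhs x D by exact: open_nbhs_nbhs.
  have e : \forall y \near x, k y = h y by apply: filterS nD => y Dy; rewrite hk.
  by rewrite /continuous_at hk //; apply: cvg_trans (near_eq_cvg e) (ck x Dx).
split=> [w [i _ <-]|i w [j _ <-]]; split.
- by move=> x Dx; have [] := jet_der1 jf i Dx.
- by apply: (cont _ (g i) (p1 i)) => x; exact: jet_cont1 jf _ _.
- move=> x Dx.
  have nD : nbhs x D by exact: open_nbhs_nbhs.
  have e : \near x, g i x = partial i f x by apply: filterS nD => y Dy; rewrite p1.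
  by have [] := near_eq_is_derive e (jet_der2 jf j i Dx).
- by apply: (cont _ (H j i) (p2 j i)) => x; exact: jet_cont2 jf _ _ _.
Qed.

(** [C1_on] speaks of partial derivatives only. Their continuity bounds them locally, which makes
    [f] locally Lipschitz. *)
Lemma C1_on_continuous D f : open D -> C1_on D f ->
  forall x, D x -> {for x, continuous f}.
Proof.
move=> oD C1f x Dx.
have cp i : {for x, continuous (partial i f)}.
  have [|_] := C1f (basis_vec i); first by exists i.
  rewrite continuous_open_subspace // => /(_ x); rewrite inE; exact.
have [L [r [r0 L0 hr]]] : exists L r : R, [/\ 0 < r, 0 <= L &
    forall y, `|y - x| < r -> forall i,
     derivable f y (basis_vec i) /\ `|partial i f y| <= L].
  pose L := \sum_i (`|partial i f x| + 1).
  have : \forall y \near x, forall i,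
      derivable f y (basis_vec i) /\ `|partial i f y| <= L.
    suff h i : \forall y \near x,
        derivable f y (basis_vec i) /\ `|partial i f y| <= L.
      exact: (filter_forall (nbhs_filter x) h).
    have nD : nbhs x D by exact: open_nbhs_nbhs.
    have : \forall y \near x, `|partial i f y| < `|partial i f x| + 1.
      have /cvgr_norm_lt := cp i; apply; first by rewrite ltrDl.
    apply: filterS2 nD => y Dy yL; split.
      by have [|dp _] := C1f (basis_vec i); [exists i|exact: dp].
    apply: le_trans (ltW yL) _; rewrite /L (bigD1 i) //= lerDl.
    by apply: sumr_ge0 => j _; rewrite addr_ge0.
  move=> /nbhs_ballP[r /= r0 hr]; exists L, r; split=> //.
    by apply: sumr_ge0 => j _; rewrite addr_ge0.
  by move=> y yx; apply: hr; rewrite -ball_normE /= distrC.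
apply/(@cvgrPdist_lt _ _ _ (nbhs x)) => e e0.
have nr : \forall y \near x, `|y - x| < r.
  by apply/nbhs_ballP; exists r => //= y; rewrite -ball_normE /= distrC.
have ne : \forall y \near x, L * n%:R * `|y - x| < e.
  have K0 : 0 <= L * n%:R by rewrite mulr_ge0.
  apply/nbhs_ballP; exists (e / (L * n%:R + 1)); first by rewrite /= divr_gt0 // ltr_wpDl.
  move=> y; rewrite -ball_normE /= distrC ltr_pdivlMr ?ltr_wpDl // => h.
  by apply: le_lt_trans h; rewrite mulrDr mulr1 mulrC lerDl.
apply: filterS2 nr ne => y yr /(le_lt_trans _); apply.
rewrite distrC; apply: le_trans (lipschitz_of_partials hr yr) _.
rewrite -mulrA ler_wpM2l // mulr_natl.
have -> : `|y - x| *+ n = \sum_(i < n) `|y - x| by rewrite sumr_const card_ord.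
by apply: ler_sum => i _; have := ler_coord_norm (y - x) i; rewrite !mxE.
Qed.

End C2.

Section Schwarz.
Context {R : realType} {n : nat}.
Implicit Types (D : set 'rV[R]_n) (f : 'rV[R]_n -> R) (x : 'rV[R]_n).

Lemma is_derive_translate f (a x v : 'rV[R]_n) (d : R) :
  is_derive (x + a) v f d -> is_derive x v (fun z => f (z + a)) d.
Proof.
have xE y : y = y + 0 *: v :> 'rV[R]_n by rewrite scale0r addr0.
rewrite (xE (x + a)) => /is_derive_line h; rewrite (xE x).
apply/is_derive_line.
have -> // : (fun s => f (x + s *: v + a)) = (fun s => f (x + a + s *: v)).
by apply/funext => s; rewrite addrAC.
Qed.

Lemma norm_basis_vec (i : 'I_n) (a : R) : `|a *: basis_vec i| <= `|a|.
Proof.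
apply/rV_norm_le => // k; rewrite !mxE eqxx /=; case: eqP => _.
  by rewrite mulr1.
by rewrite mulr0 normr0.
Qed.

Lemma second_difference D f g H x (h : R) i j : jet_on D f g H -> 0 <= h ->
  (forall y, `|y - x| <= h + h -> D y) ->
  exists2 y, `|y - x| <= h + h &
    f (x + h *: basis_vec j + h *: basis_vec i) - f (x + h *: basis_vec j) -
    (f (x + h *: basis_vec i) - f x) = h ^+ 2 * H i j y.
Proof.
move=> jf h0 hD; pose k z := f (z + h *: basis_vec i) - f z.
have near_x (t s : R) : 0 <= t <= 1 -> 0 <= s <= 1 ->
    `|x + t *: (h *: basis_vec j) + s *: (h *: basis_vec i) - x| <= h + h.
  move=> /andP[t0 t1] /andP[s0 s1].
  rewrite -[x + _ + _]addrA [x + _]addrC addrK !scalerA (le_trans (ler_normD _ _)) //.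
  by apply: lerD; apply: le_trans (norm_basis_vec _ _) _;
    rewrite ger0_norm ?mulr_ge0 // ler_piMl.
have zero01 : 0 <= (0 : R) <= 1 by rewrite lexx ler01.
have one01 : 0 <= (1 : R) <= 1 by rewrite lexx ler01.
have dk (t : R) : 0 <= t <= 1 ->
    is_derive (x + t *: (h *: basis_vec j)) (h *: basis_vec j) k
      (h * (g j (x + t *: (h *: basis_vec j) + h *: basis_vec i) -
            g j (x + t *: (h *: basis_vec j)))).
  move=> t01; rewrite mulrBr; apply: is_deriveB.
    apply: is_derive_translate.
    have := jet_der1 jf j (hD _ (near_x _ _ t01 one01)).
    by rewrite scale1r => -[d <-]; apply: derivable_scale_dir.
  have := jet_der1 jf j (hD _ (near_x _ _ t01 zero01)).
  by rewrite scale0r addr0 => -[d <-]; apply: derivable_scale_dir.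
have [|t t01 E] := @MVT_line _ _ k x (h *: basis_vec j).
  by move=> t /dk[].
rewrite -/(k (x + h *: basis_vec j)) -/(k x) {}E.
have [_ ->] := dk _ t01.
have dg (s : R) : 0 <= s <= 1 ->
    is_derive (x + t *: (h *: basis_vec j) + s *: (h *: basis_vec i))
      (h *: basis_vec i) (g j)
      (h * H i j (x + t *: (h *: basis_vec j) + s *: (h *: basis_vec i))).
  move=> s01; have [d <-] := jet_der2 jf i j (hD _ (near_x _ _ t01 s01)).
  exact: derivable_scale_dir.
have [|s s01 E] := @MVT_line _ _ (g j) (x + t *: (h *: basis_vec j))
  (h *: basis_vec i).
  by move=> s /dg[].
exists (x + t *: (h *: basis_vec j) + s *: (h *: basis_vec i)).
  exact: near_x.
by rewrite E; have [_ ->] := dg _ s01; rewrite mulrA.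
Qed.

(** Schwarz's theorem: the second difference is symmetric in [i] and [j], and equals [h ^+ 2] times
    either mixed derivative at points near [x]. This symmetry is what puts the jets of test
    functions into [sym_jets]. *)
Lemma jet_hess_sym D f g H x i j :
  open D -> jet_on D f g H -> D x -> H i j x = H j i x.
Proof.
move=> oD jf Dx; apply/eqP; rewrite -subr_eq0 -normr_le0.
apply/ler_addgt0Pr => e e0; rewrite add0r.
have e20 : 0 < e / 2 by rewrite divr_gt0.
have nD : nbhs x D by exact: open_nbhs_nbhs.
have near_H i' j' : \forall y \near x, `|H i' j' x - H i' j' y| < e / 2.
  by have /(@cvgrPdist_lt _ _ _ (nbhs x)) := jet_cont2 jf (i := i') (j := j') Dx; apply.
have /nbhs_ballP[r /= r0 hr] : \forall y \near x, D y /\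
    (`|H i j x - H i j y| < e / 2 /\ `|H j i x - H j i y| < e / 2).
  by apply: filterI => //; apply: filterI; exact: near_H.
have hr' y : `|y - x| <= r / 3 + r / 3 ->
    D y /\ (`|H i j x - H i j y| < e / 2 /\ `|H j i x - H j i y| < e / 2).
  move=> yx; apply: hr; rewrite -ball_normE /= distrC.
  by apply: le_lt_trans yx _; lra.
have r30 : 0 <= r / 3 by rewrite divr_ge0 // ltW.
have [y yx Ey] := @second_difference D f g H x (r / 3) i j jf r30
  (fun y hy => (hr' y hy).1).
have [z zx Ez] := @second_difference D f g H x (r / 3) j i jf r30
  (fun y hy => (hr' y hy).1).
have HE : H i j y = H j i z.
  have /mulfI : (r / 3) ^+ 2 != 0 by rewrite sqrf_eq0 gt_eqF // divr_gt0.
  apply; rewrite -Ey -Ez [x + _ + _]addrAC; ring.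
have [_ [y1 _]] := hr' _ yx; have [_ [_ z1]] := hr' _ zx.
rewrite (_ : H i j x - H j i x = (H i j x - H i j y) - (H j i x - H j i z)).
  by apply: le_trans (ler_normB _ _) _; rewrite [leRHS]splitr lerD // ltW.
by rewrite HE; ring.
Qed.

Lemma C2_on_jet_on D f : open D -> C2_on D f ->
  jet_on D f (fun i => partial i f) (fun i j => partial i (partial j f)).
Proof.
move=> oD [C1f C1p].
have der h i x : C1_on D h -> D x -> is_derive x (basis_vec i) h (partial i h x).
  move=> C1h Dx; apply: derivableP.
  by have [|d _] := C1h (basis_vec i); [exists i|exact: d].
have cont h i x : C1_on D h -> D x -> {for x, continuous (partial i h)}.
  move=> C1h Dx; have [|_] := C1h (basis_vec i); first by exists i.
  by rewrite continuous_open_subspace // => /(_ x); rewrite inE; apply.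
by split=> *; [exact: (C1_on_continuous oD)|exact: cont|exact: cont|
  exact: der|exact: der].
Qed.

End Schwarz.

(** * Linear, quadratic and exponential test functions *)

Section TestFunctions.
Context {R : realType} {n : nat}.
Implicit Types (D : set 'rV[R]_n) (x a p : 'rV[R]_n).

Definition dot p x : R := \sum_i p ord0 i * x ord0 i.

Definition sqdist a x : R := \sum_i (x ord0 i - a ord0 i) ^+ 2.

Lemma jet_on_eq D f g H f' g' H' :
  (forall x, f x = f' x) -> (forall i x, g i x = g' i x) ->
  (forall i j x, H i j x = H' i j x) ->
  @jet_on R n D f g H -> jet_on D f' g' H'.
Proof.
move=> ff gg HH; have -> : f' = f by apply/funext => x; rewrite ff.
have -> : g' = g by apply/funext => i; apply/funext => x; rewrite gg.
have -> // : H' = H.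
by apply/funext => i; apply/funext => j; apply/funext => x; rewrite HH.
Qed.

Lemma sum_deltal (F : 'I_n -> R) i : \sum_j (i == j)%:R * F j = F i.
Proof.
rewrite (bigD1 i) //= eqxx mul1r big1 ?addr0 // => j ji.
by rewrite eq_sym (negbTE ji) mul0r.
Qed.

Lemma jet_on_dot D p :
  jet_on D (dot p) (fun i => cst (p ord0 i)) (fun _ _ => cst 0).
Proof.
apply: (jet_on_eq (f := dot p) _ _ _ (jet_on_sum (index_enum 'I_n)
  (fun i => jet_on_scale (p ord0 i) (jet_on_coord D i)))) => //=.
- move=> i x; rewrite -[RHS](sum_deltal (fun j => p ord0 j)).
  by apply: eq_bigr => j _; rewrite mulrC.
- by move=> i j x; rewrite big1 // => k _; rewrite mulr0.
Qed.

Lemma is_derive1_sqr (t : R) : is_derive t (1 : R) (fun s : R => s ^+ 2) (2 * t).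
Proof.
have := is_deriveX 2 (is_derive_id t (1 : R)); move/is_derive_eq; apply.
by rewrite /GRing.scale /= mulr1 expr1.
Qed.

Lemma is_derive1_mull (c t : R) : is_derive t (1 : R) (fun s : R => c * s) c.
Proof.
have := is_deriveZ c (is_derive_id t (1 : R)); move/is_derive_eq; apply.
by rewrite /GRing.scale /= mulr1.
Qed.

Lemma jet_on_sqr D f g H : jet_on D f g H ->
  jet_on D (fun x => f x ^+ 2) (fun i x => 2 * f x * g i x)
    (fun i j x => 2 * f x * H i j x + 2 * g i x * g j x).
Proof.
apply: (@jet_on_comp R n D (fun s => s ^+ 2) (fun s => 2 * s) (cst 2)).
- by move=> x _; exact: is_derive1_sqr.
- by move=> x _; exact: is_derive1_mull.
- by move=> x _; exact: cst_continuous.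
Qed.

Lemma jet_on_sqdist D a :
  jet_on D (sqdist a) (fun i x => 2 * (x ord0 i - a ord0 i))
    (fun i j => cst (2 * (i == j)%:R)).
Proof.
apply: (jet_on_eq (f := sqdist a) _ _ _ (jet_on_sum (index_enum 'I_n)
  (fun k => jet_on_sqr (jet_on_add (jet_on_coord D k)
     (jet_on_cst D (- a ord0 k)))))) => //=.
- move=> i x; rewrite -(sum_deltal (fun k => 2 * (x ord0 k - a ord0 k))).
  by apply: eq_bigr => k _; rewrite addr0 mulrC.
- move=> i j x.
  rewrite [RHS]mulrC eq_sym -(sum_deltal (fun k => (j == k)%:R * 2)).
  by apply: eq_bigr => k _ /=; ring.
Qed.

Lemma jet_on_expR D (al : R) i0 :
  jet_on D (fun x => expR (al * x ord0 i0))
    (fun i x => al * expR (al * x ord0 i0) * (i == i0)%:R)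
    (fun i j x => al ^+ 2 * expR (al * x ord0 i0) *
                  ((i == i0)%:R * (j == i0)%:R)).
Proof.
have d t : is_derive t (1 : R) expR (expR t) by exact: is_derive_expR.
have c : continuous (@expR R) by exact: continuous_expR.
have := @jet_on_comp R n D expR expR expR _ _ _ (fun x _ => d _) (fun x _ => d _)
  (fun x _ => c _) (jet_on_scale al (jet_on_coord D i0)).
by apply: jet_on_eq => //= *; ring.
Qed.

Lemma sqdist_ge0 a x : 0 <= sqdist a x.
Proof. by apply: sumr_ge0 => i _; exact: sqr_ge0. Qed.

Lemma ler_norm_sqdist a x : `|x - a| ^+ 2 <= sqdist a x.
Proof.
have h : `|x - a| <= Num.sqrt (sqdist a x).
  apply/rV_norm_le; first exact: sqrtr_ge0.
  move=> i; rewrite !mxE -sqrtr_sqr ler_sqrt ?sqdist_ge0 //.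
  by rewrite /sqdist (bigD1 i) //= lerDl sumr_ge0 // => j _; exact: sqr_ge0.
rewrite -[leRHS]sqr_sqrtr ?sqdist_ge0 //.
by rewrite ler_pXn2r // nnegrE // sqrtr_ge0.
Qed.

Lemma sqdist_le a x : sqdist a x <= n%:R * `|x - a| ^+ 2.
Proof.
rewrite mulr_natl; have -> : `|x - a| ^+ 2 *+ n = \sum_(i < n) `|x - a| ^+ 2.
  by rewrite sumr_const card_ord.
apply: ler_sum => i _; rewrite -real_normK ?num_real //.
rewrite ler_pXn2r ?nnegrE //.
by have := ler_coord_norm (x - a) i; rewrite !mxE.
Qed.

Lemma sqdist_gt0 a x : x != a -> 0 < sqdist a x.
Proof.
move=> xa; apply: lt_le_trans (ler_norm_sqdist a x).
by rewrite exprn_gt0 // normr_gt0 subr_eq0.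
Qed.

Lemma enormE a x : enorm (x - a) = Num.sqrt (sqdist a x).
Proof. by congr Num.sqrt; apply: eq_bigr => i _; rewrite !mxE. Qed.

End TestFunctions.

(** * Fundamental solutions and Evans potentials *)

Section Kernel.
Context {R : realType}.
Variable n : nat.
Implicit Types (b r s t : R).

(** The radial fundamental solution up to a positive factor, shifted by [b]. The logarithm changes
    sign, and a suitable [b] makes the kernel nonnegative on a bounded range of distances. *)
Definition kap b r : R :=
  (if n == 2%N then - ln r else (r ^+ (n - 2))^-1) + b.

(** The real power of [t] with exponent [- s]. Half-integer exponents arise because the kernel is
    differentiated as a function of the squared distance. *)
Definition pw s t : R := expR (- s * ln t).

Lemma is_derive_pw s t : 0 < t -> is_derive t (1 : R) (pw s) (- s * pw (s + 1) t).
Proof.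
move=> t0.
have := @is_derive1_comp R expR ((- s) \*: @ln R) t _ _
  (is_derive_expR (- s * ln t)) (is_deriveZ (- s) (is_derive1_ln t0)).
move/is_derive_eq; apply; rewrite /GRing.scale /= mulrCA; congr (_ * _).
rewrite /pw opprD mulrDl mulN1r expRD; congr (_ * _).
by rewrite expRN lnK.
Qed.

Lemma pw_cont s t : 0 < t -> {for t, continuous (pw s)}.
Proof.
move=> t0; apply/differentiable_continuous/derivable1_diffP.
by have [] := is_derive_pw s t0.
Qed.

Lemma pw_mul s t : 0 < t -> pw (s + 1) t * t = pw s t.
Proof.
move=> t0; rewrite /pw opprD mulrDl mulN1r expRD -mulrA expRN lnK //.
by rewrite mulVf ?mulr1 // gt_eqF.
Qed.

(** In terms of the squared distance t, the kernel is t^(-a) up to the shift, or -(1/2) ln t in the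
    plane, where [a] is 0. In both cases its derivative is -c t^(-(a+1)). *)
Let a : R := (n%:R - 2) / 2.
Let c : R := if n == 2%N then 2^-1 else a.

Lemma sqrt_expR t : 0 < t -> Num.sqrt t = expR (2^-1 * ln t).
Proof.
move=> t0; apply/eqP; rewrite -(@eqrXn2 _ 2) ?sqrtr_ge0 ?expR_ge0 //.
by rewrite sqr_sqrtr ?ltW // -expRM_natl mulrA divff ?mul1r ?lnK //.
Qed.

Lemma is_derive_kap_sqrt b t : (2 <= n)%N -> 0 < t ->
  is_derive t (1 : R) (fun s => kap b (Num.sqrt s)) (- c * pw (a + 1) t).
Proof.
move=> n2 t0.
have nt : \forall s \near t, 0 < s by exact: lt_nbhsr.
have [n2E|n2N] := eqVneq n 2%N.
  have e : \forall s \near t, b - 2^-1 * ln s = kap b (Num.sqrt s).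
    apply: filterS nt => s s0; rewrite /kap n2E eqxx sqrt_expR // expRK.
    by rewrite addrC.
  apply: (near_eq_is_derive e).
  have := is_deriveB (is_derive_cst b t (1 : R)) (is_deriveZ 2^-1 (is_derive1_ln t0)).
  move/is_derive_eq; apply; rewrite /c n2E eqxx sub0r mulNr; congr (- (_ * _)).
  by rewrite /a /pw n2E subrr mul0r add0r mulN1r expRN lnK.
have e : \forall s \near t, pw a s + b = kap b (Num.sqrt s).
  apply: filterS nt => s s0; rewrite /kap (negbTE n2N) sqrt_expR //.
  congr (_ + _); rewrite -expRM_natl -expRN /pw; congr expR.
  by rewrite /a natrB //; field.
apply: (near_eq_is_derive e).
have := is_deriveD (is_derive_pw a t0) (is_derive_cst b t (1 : R)).
by move/is_derive_eq; apply; rewrite /c (negbTE n2N) addr0.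
Qed.

(** For a function k of the squared distance t, the Laplacian is 2 n k' + 4 t k''. With k' = -c
    t^(-(a+1)) it vanishes because 2 (a + 1) = n. *)
Lemma jet_on_kap D (y : 'rV[R]_n) b : (2 <= n)%N -> ~ D y ->
  exists2 gH : ('I_n -> 'rV[R]_n -> R) * ('I_n -> 'I_n -> 'rV[R]_n -> R),
    jet_on D (fun x => kap b (enorm (x - y))) gH.1 gH.2 &
    forall x, D x -> \sum_i gH.2 i i x = 0.
Proof.
move=> n2 Dy.
have S0 x : D x -> 0 < sqdist y x.
  by move=> Dx; apply: sqdist_gt0; apply/eqP => xy; apply: Dy; rewrite -xy.
pose k2 t := c * (a + 1) * pw (a + 1 + 1) t.
have dk2 t : 0 < t -> is_derive t (1 : R) (fun t => - c * pw (a + 1) t) (k2 t).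
  move=> t0; have := is_deriveZ (- c) (is_derive_pw (a + 1) t0).
  by move/is_derive_eq; apply; rewrite /k2 [LHS]mulrA mulrNN.
have := @jet_on_comp R n D (fun s => kap b (Num.sqrt s))
  (fun t => - c * pw (a + 1) t) k2 _ _ _
  (fun x Dx => is_derive_kap_sqrt b n2 (S0 x Dx))
  (fun x Dx => dk2 _ (S0 x Dx)) _ (jet_on_sqdist D y).
move=> [|c0 c1 c2 d1 d2].
  move=> x Dx; apply: continuousM; first exact: cst_continuous.
  by apply: pw_cont; exact: S0.
have -> : (fun x => kap b (enorm (x - y))) =
    (fun x => kap b (Num.sqrt (sqdist y x))).
  by apply/funext => z; rewrite enormE.
eexists (_, _); first exact: (JetOn c0 c1 c2 d1 d2).
move=> x Dx; rewrite big_split /=.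
under eq_bigr => i _ do rewrite eqxx mulr1.
rewrite sumr_const card_ord -[X in X + _]mulr_natr.
have -> : \sum_(i < n) k2 (sqdist y x) * (2 * (x ord0 i - y ord0 i)) *
    (2 * (x ord0 i - y ord0 i)) = 4 * (k2 (sqdist y x) * sqdist y x).
  by rewrite /sqdist mulrA mulr_sumr; apply: eq_bigr => i _; ring.
rewrite /k2 -[in X in _ + X]mulrA -mulrA pw_mul ?S0 // /a.
by field.
Qed.

End Kernel.

Section KernelBounds.
Context {R : realType}.
Variables (n : nat) (n2 : (2 <= n)%N).
Implicit Types (b r s : R).

Lemma kap_le b r s : 0 < r -> r <= s -> kap n b s <= kap n b r.
Proof.
move=> r0 rs; have s0 : 0 < s by apply: lt_le_trans rs.
rewrite /kap lerD2r; case: ifP => _; first by rewrite lerN2 ler_ln.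
by rewrite lef_pV2 ?posrE ?exprn_gt0 // lerXn2r // nnegrE ltW.
Qed.

Lemma kap_continuous b r : 0 < r -> {for r, continuous (kap n b)}.
Proof.
move=> r0; rewrite /kap; have [n2E|n2N] := eqVneq n 2%N.
  apply: (@continuousD _ R R (fun s => - ln s) (cst b)).
    by apply: continuousN; exact: continuous_ln.
  exact: cst_continuous.
apply: (@continuousD _ R R (fun s => (s ^+ (n - 2))^-1) (cst b)).
  apply: continuousV; first by rewrite gt_eqF // exprn_gt0.
  exact: exprn_continuous.
exact: cst_continuous.
Qed.

Lemma kap_ge0 (r0 : R) : 0 < r0 -> exists b, forall r, 0 < r -> r <= r0 ->
  0 <= kap n b r.
Proof.
move=> r00; exists (- kap n 0 r0) => r r_gt0 rr0.
have : kap n 0 r0 <= kap n 0 r by exact: kap_le.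
by rewrite /kap !addr0 => h; rewrite subr_ge0.
Qed.

Lemma kap_large b M : exists2 d : R, 0 < d & forall r, 0 < r -> r <= d ->
  M <= kap n b r.
Proof.
have [n2E|n2N] := eqVneq n 2%N.
  exists (expR (b - M)); first exact: expR_gt0.
  move=> r r0; rewrite -ler_ln ?posrE ?expR_gt0 // expRK => h.
  by rewrite /kap n2E eqxx; lra.
exists (`|M - b| + 1)^-1; first by rewrite invr_gt0 ltr_wpDl.
move=> r r0 h; rewrite /kap (negbTE n2N) -lerBlDr.
have m0 : 0 < `|M - b| + 1 by rewrite ltr_wpDl.
apply: (@le_trans _ _ (`|M - b| + 1)).
  by apply: le_trans (ler_norm _) _; rewrite lerDl.
rewrite -[leLHS]invrK lef_pV2 ?posrE ?exprn_gt0 ?invr_gt0 //.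
apply: (le_trans _ h); rewrite -[leRHS]expr1.
have n3 : (1 <= n - 2)%N by rewrite subn_gt0 ltn_neqAle eq_sym n2N.
apply: ler_wiXn2l => //; first exact: ltW.
by apply: le_trans h _; rewrite invf_le1 // lerDr.
Qed.

(** For [n] above 2 the exponent is one more than the true growth, but it also covers the logarithm,
    and r^(-(n-1)) is still integrable near 0 in R^n, which is what the grid estimate relies on. *)
Lemma kap_upper b (r0 : R) : exists2 C : R, 0 <= C &
  forall r, 0 < r -> r <= r0 -> kap n b r <= C / r ^+ (n - 1).
Proof.
have E : (n - 1 = (n - 2).+1)%N by rewrite -subSn.
exists (`|r0| + 1 + `|b| * `|r0| ^+ (n - 1)).
  by rewrite !addr_ge0 // mulr_ge0 // exprn_ge0.
move=> r r_gt0 rr0; have rp : 0 < r ^+ (n - 1) by rewrite exprn_gt0.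
have rr0' : r <= `|r0| by rewrite (le_trans rr0) // ler_norm.
rewrite /kap mulrDl lerD //; last first.
  apply: le_trans (ler_norm _) _; rewrite ler_pdivlMr // ler_wpM2l //.
  by rewrite lerXn2r // nnegrE // ltW.
case: eqP => [n2E|_].
  rewrite n2E expr1 -lnV ?posrE //.
  have ri0 : 0 < r^-1 by rewrite invr_gt0.
  have h : ln r^-1 <= r^-1 - 1.
    have := @le_ln1Dx _ (r^-1 - 1); rewrite addrCA subrr addr0; apply.
    by rewrite ltrBDr addrC subrr.
  apply: le_trans h _; rewrite mulrDl mul1r.
  have : 0 <= `|r0| * r^-1 by rewrite mulr_ge0 // ltW.
  lra.
rewrite ler_pdivlMr // E exprS mulrCA mulVf ?mulr1.
  by rewrite (le_trans rr0') // lerDl.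
by rewrite gt_eqF // exprn_gt0.
Qed.

End KernelBounds.

(** * Uniform constants and minimising sequences on compact sets *)

Section Compactness.
Context {R : realType} {V : normedModType R}.
Implicit Types (K S : set V) (x y : V).

Lemma nbhs_norm_lt x (A : set V) :
  nbhs x A <-> exists2 r : R, 0 < r & forall y, `|y - x| < r -> A y.
Proof.
split=> [/nbhs_ballP[r r0 h]|[r r0 h]].
  by exists r => // y yx; apply: h; rewrite -ball_normE /= distrC.
by apply/nbhs_ballP; exists r => // y; rewrite -ball_normE /= distrC => /h.
Qed.

(** [Q e] gets weaker as [e] decreases, so the local constants of a finite cover can be replaced by
    their minimum. Upper bounds are fitted into this form by writing them as [e^-1]. *)
Lemma compact_uniform K (Q : R -> V -> Prop) : compact K ->
  (forall e d y, 0 < d -> d <= e -> Q e y -> Q d y) ->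
  (forall x, K x -> exists2 e, 0 < e & exists2 r, 0 < r &
     forall y, `|y - x| < r -> K y -> Q e y) ->
  exists2 e, 0 < e & forall y, K y -> Q e y.
Proof.
move=> /compact_near_coveringP cK antiQ locQ.
have /cK h : forall x, K x -> \forall x' \near x & e \near 0^'+, K x' -> Q e x'.
  move=> x Kx; have [e e0 [r r0 h]] := locQ x Kx.
  exists ([set y | `|y - x| < r], [set d | 0 < d <= e]).
    split=> /=; first by apply/nbhs_norm_lt; exists r.
    near=> d; apply/andP; split; first by near: d; exact: nbhs_right_gt.
    by near: d; exact: nbhs_right_le.
  move=> [y d] /= [yx /andP[d0 de]] Ky.
  exact: antiQ (h _ yx Ky).
have {}h : \forall e \near 0^'+, K `<=` (fun x' => K x' -> Q e x') by exact: h.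
have pos : \forall e \near (0 : R)^'+, 0 < e by exact: nbhs_right_gt.
have [e [e0 he]] := filter_ex (filterI pos h).
by exists e => // y Ky; apply: he.
Unshelve. all: by end_near.
Qed.

(** The filter of sublevel sets of [f] on [S] plays the part of a minimising sequence. Its cluster
    point may lie outside [S], as happens when [E] is removed from a compact set. *)
Lemma inf_cluster K S (f : V -> \bar R) : compact K -> S `<=` K ->
  (ereal_inf (f @` S) < +oo)%E ->
  exists2 x, K x & forall r a, 0 < r -> (ereal_inf (f @` S) < a)%E ->
    exists y, [/\ S y, `|y - x| < r & (f y < a)%E].
Proof.
set m := ereal_inf _ => cK SK moo.
pose F := filter_from [set a : \bar R | (m < a)%E]
  (fun a => [set y | S y /\ (f y < a)%E]).
have FF : ProperFilter F.
  apply: filter_from_proper; last first.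
    by move=> a /= /ereal_inf_lt[_ [y Sy <-] fya]; exists y.
  apply: filter_from_filter; first by exists +oo%E.
  move=> a b /= ma mb; exists (Order.min a b); first by rewrite /= lt_min ma.
  by move=> y [Sy]; rewrite lt_min => /andP[].
have FK : F K by exists +oo%E => // y [/SK].
have [x [Kx clx]] := cK F FF FK; exists x => // r a r0 ma.
have Fa : F [set y | S y /\ (f y < a)%E] by exists a.
have nr : nbhs x [set y | `|y - x| < r] by apply/nbhs_norm_lt; exists r.
by have [y [[Sy fya] yx]] := clx _ _ Fa nr; exists y.
Qed.

End Compactness.

Section CompactNeighbourhood.
Context {R : realType} {n : nat}.
Implicit Types (E Om : set 'rV[R]_n).

Lemma compact_thickening E (d : R) : compact E -> 0 < d ->
  compact [set y | exists2 x, E x & `|y - x| <= d].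
Proof.
move=> cE d0; pose B : set 'rV[R]_n := closed_ball_ (fun x => `|x|) 0 d.
have cB : compact B.
  apply: bounded_closed_compact; last exact: closed_closed_ball_.
  exists d; split; first exact: num_real.
  move=> M dM y; rewrite /B /closed_ball_ /= sub0r normrN => /le_trans; apply.
  exact: ltW.
have := continuous_compact (f := fun p : 'rV[R]_n * 'rV[R]_n => p.1 + p.2) _
  (compact_setX cE cB).
rewrite (_ : _ @` _ = [set y | exists2 x, E x & `|y - x| <= d]).
  by apply; apply: continuous_subspaceT => p; exact: add_continuous.
apply/seteqP; split=> [_ [[x z] [/= Ex +] <-]|y [x Ex yx]].
  rewrite /B /closed_ball_ /= sub0r normrN => zd; exists x => //.
  by rewrite addrAC subrr add0r.
exists (x, y - x); last by rewrite /= addrCA subrr addr0.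
by split=> //=; rewrite /B /closed_ball_ /= sub0r normrN.
Qed.

Lemma thickening_sub E Om : compact E -> open Om -> E `<=` Om ->
  exists2 d : R, 0 < d & forall x y, E x -> `|y - x| <= d -> Om y.
Proof.
move=> cE oOm EOm.
have [||d d0 h] := @compact_uniform R _ E
    (fun d x => forall y, `|y - x| <= d -> Om y) cE.
- by move=> e d y d0 de h z /le_trans => /(_ _ de); exact: h.
- move=> x Ex; have : nbhs x Om by apply: open_nbhs_nbhs; split=> //; exact: EOm.
  move=> /nbhs_norm_lt[r r0 h]; exists (r / 2); first by rewrite divr_gt0.
  exists (r / 2); first by rewrite divr_gt0.
  move=> y yx _ z zy; apply: h; rewrite (_ : z - x = (z - y) + (y - x)).
    by apply: le_lt_trans (ler_normD _ _) _; lra.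
  by rewrite addrA subrK.
by exists d => // x y Ex; exact: h.
Qed.

End CompactNeighbourhood.

(** * Discrete energies and potentials *)

Section Potential.
Context {R : realType} {n : nat}.
Implicit Types (E D : set 'rV[R]_n) (x y : 'rV[R]_n) (s : seq 'rV[R]_n).

Definition trunc_kernel (b d : R) x y : R :=
  kap n b (Num.max (enorm (x - y)) d).

(* The diagonal is included; it is finite because the kernel is truncated. *)
Definition discrete_energy (b d : R) s : R :=
  \sum_(x <- s) \sum_(y <- s) trunc_kernel b d x y.

(** A quantitative, discrete form of zero capacity: the truncation [d] depends on [T] alone, while
    the size of [s] is free and its points may repeat. *)
Definition energies_diverge E (b : R) : Prop :=
  forall T : R, exists2 d, 0 < d & forall s, s != [::] ->
    (forall x, x \in s -> E x) ->
    T * (size s)%:R ^+ 2 <= discrete_energy b d s.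

Lemma enormC x y : enorm (x - y) = enorm (y - x).
Proof.
by congr Num.sqrt; apply: eq_bigr => i _; rewrite !mxE -sqrrN opprB.
Qed.

Lemma enorm0 : enorm (0 : 'rV[R]_n) = 0.
Proof.
by rewrite /enorm big1 ?sqrtr0 // => i _; rewrite mxE expr0n.
Qed.

Lemma enorm_ge0 x : 0 <= enorm x.
Proof. exact: sqrtr_ge0. Qed.

Lemma trunc_kernelC b d x y : trunc_kernel b d x y = trunc_kernel b d y x.
Proof. by rewrite /trunc_kernel enormC. Qed.

Lemma trunc_kernel_diag b d x : 0 <= d -> trunc_kernel b d x x = kap n b d.
Proof. by move=> d0; rewrite /trunc_kernel subrr enorm0 max_r. Qed.

Lemma discrete_energy_cons b d x s : 0 <= d ->
  discrete_energy b d (x :: s) =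
  discrete_energy b d s + 2 * \sum_(y <- s) trunc_kernel b d x y + kap n b d.
Proof.
move=> d0; rewrite /discrete_energy big_cons big_cons trunc_kernel_diag //.
under [X in _ + X = _]eq_bigr => y _ do rewrite big_cons trunc_kernelC.
by rewrite [X in _ + X = _]big_split /=; ring.
Qed.

(* Leja points: if no configuration had a large potential on E, adding one
   point of small potential at a time would keep the energy bounded. *)
Lemma large_discrete_potential E b (T : R) : energies_diverge E b ->
  E !=set0 -> 0 <= T ->
  exists2 d, 0 < d & exists s, [/\ s != [::], forall x, x \in s -> E x &
    forall x, E x -> T * (size s)%:R <= \sum_(y <- s) trunc_kernel b d x y].
Proof.
(* The surplus 1 adds the square of the number of points to the energy. This beats the diagonal
   terms, which are only linear in that number, once it exceeds [K0]. *)
move=> divE [x0 Ex0] T0; have [d d0 hd] := divE (T + 1); exists d => //.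
apply: contrapT => nex.
have step s : s != [::] -> (forall x, x \in s -> E x) ->
    exists2 x, E x & \sum_(y <- s) trunc_kernel b d x y < T * (size s)%:R.
  move=> s0 sE; apply: contrapT => nx; apply: nex; exists s; split=> // x Ex.
  by rewrite leNgt; apply/negP => lt; apply: nx; exists x.
pose K0 := kap n b d.
have build (N : nat) : exists s, [/\ size s = N.+1, forall x, x \in s -> E x &
    discrete_energy b d s <= N.+1%:R * K0 + N.+1%:R ^+ 2 * T].
  elim: N => [|N [s [sN sE sW]]].
    exists [:: x0]; split=> //; first by move=> x; rewrite inE => /eqP->.
    rewrite /discrete_energy !big_seq1 (trunc_kernel_diag _ _ (ltW d0)).
    by rewrite mul1r expr1n mul1r lerDl.
  have [|x Ex Ux] := step s _ sE; first by rewrite -size_eq0 sN.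
  exists (x :: s); split; first by rewrite /= sN.
    by move=> y; rewrite inE => /orP[/eqP->//|/sE].
  rewrite (discrete_energy_cons _ _ _ (ltW d0)) -/K0 -[N.+2%:R]natr1.
  rewrite sN in Ux; set U := \sum_(y <- s) _ in Ux *.
  have -> : (N.+1%:R + 1) * K0 + (N.+1%:R + 1) ^+ 2 * T =
     N.+1%:R * K0 + N.+1%:R ^+ 2 * T + (2 * (T * N.+1%:R) + T) + K0 by ring.
  rewrite lerD2r lerD //; apply: (@le_trans _ _ (2 * (T * N.+1%:R))).
    by rewrite ler_pM2l // ltW.
  by rewrite lerDl.
pose N := Num.truncn `|K0|.
have [s [sN sE sW]] := build N.
have s0 : s != [::] by rewrite -size_eq0 sN.
have := le_trans (hd s s0 sE) sW; rewrite sN => h.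
have K0N : K0 < N.+1%:R.
  by apply: le_lt_trans (ler_norm _) _; exact: truncnS_gt.
have N0 : 0 < N.+1%:R :> R by rewrite ltr0n.
have : N.+1%:R * (N.+1%:R - K0) <= 0 by lra.
by rewrite pmulr_rle0 // subr_le0 leNgt K0N.
Qed.

Lemma enorm_continuous y : continuous (fun x => enorm (x - y)).
Proof.
move=> x; rewrite (_ : (fun x => _) = Num.sqrt \o sqdist y).
  apply: continuous_comp; last exact: sqrt_continuous.
  exact: (jet_cont (jet_on_sqdist setT y) I).
by apply/funext => z; rewrite enormE.
Qed.

Lemma trunc_kernel_continuous b d y : 0 < d ->
  continuous (trunc_kernel b d ^~ y).
Proof.
move=> d0 x; apply: (@continuous_comp _ _ _
  (fun x => Num.max (enorm (x - y)) d) (kap n b)).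
  apply: (@continuous_max _ _ (fun x => enorm (x - y)) (cst d)).
    exact: enorm_continuous.
  exact: cst_continuous.
by apply: kap_continuous; rewrite lt_max d0 orbT.
Qed.

End Potential.

Section EvansPotential.
Context {R : realType} {n : nat}.
Implicit Types (E D : set 'rV[R]_n) (x y : 'rV[R]_n).

(* A finite sum of fundamental solutions replaces Evans' potential. *)
Lemma evans_potential E D b (T : R) : (2 <= n)%N -> energies_diverge E b ->
  E !=set0 -> 0 <= T -> (forall x, E x -> ~ D x) ->
  (forall x y, E x -> D y -> 0 <= kap n b (enorm (y - x))) ->
  exists psi : 'rV[R]_n -> R,
  exists2 gH : ('I_n -> 'rV[R]_n -> R) * ('I_n -> 'I_n -> 'rV[R]_n -> R),
    jet_on D psi gH.1 gH.2 /\ (forall x, D x -> \sum_i gH.2 i i x = 0) &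
    [/\ forall y, D y -> 0 <= psi y,
        forall y r, D y -> 0 < r -> (forall x, E x -> r <= enorm (y - x)) ->
          psi y <= kap n b r &
        forall x, E x -> exists2 r, 0 < r &
          forall y, D y -> `|y - x| < r -> T <= psi y].
Proof.
move=> n2 divE E0 T0 ED k0.
have T10 : 0 <= T + 1 by rewrite addr_ge0.
have [d d0 [s [s0 sE hs]]] := large_discrete_potential divE E0 T10.
have N0 : 0 < (size s)%:R :> R by rewrite ltr0n lt0n size_eq0.
have DE y x : D y -> E x -> 0 < enorm (y - x).
  move=> Dy Ex; rewrite enormE sqrtr_gt0 sqdist_gt0 //.
  by apply/eqP => yx; apply: (ED _ Ex); rewrite -yx.
have seqE x : x \in s -> E x by exact: sE.
pose psi x := (size s)%:R^-1 * \sum_(y <- s) kap n b (enorm (x - y)).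
exists psi.
(* Jets are provided for every [y], with junk outside [s], so that [choice] applies. *)
have jets y : exists gH : ('I_n -> 'rV[R]_n -> R) *
    ('I_n -> 'I_n -> 'rV[R]_n -> R), y \in s ->
    jet_on D (fun x => kap n b (enorm (x - y))) gH.1 gH.2 /\
    forall x, D x -> \sum_i gH.2 i i x = 0.
  have [ys|ys] := boolP (y \in s); last by exists (fun=> cst 0, fun _ _ => cst 0).
  have [gH jy ly] := @jet_on_kap R n D y b n2 (ED _ (seqE _ ys)).
  by exists gH.
have [gH jgH] := choice jets.
have jsum t : {subset t <= s} ->
    jet_on D (fun x => \sum_(y <- t) kap n b (enorm (x - y)))
      (fun i x => \sum_(y <- t) (gH y).1 i x)
      (fun i j x => \sum_(y <- t) (gH y).2 i j x).
  elim: t => [|y t IH] ts.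
    by apply: jet_on_eq (jet_on_cst D 0) => *; rewrite big_nil.
  have ys : y \in s by apply: ts; rewrite inE eqxx.
  apply: jet_on_eq (jet_on_add (jgH y ys).1 (IH _)) => *; rewrite ?big_cons //.
  by move=> z zt; apply: ts; rewrite inE zt orbT.
exists (fun i x => (size s)%:R^-1 * \sum_(y <- s) (gH y).1 i x,
  fun i j x => (size s)%:R^-1 * \sum_(y <- s) (gH y).2 i j x).
  split; first exact: jet_on_scale (jsum s _).
  move=> x Dx /=; rewrite -mulr_sumr exchange_big /= big_seq big1 ?mulr0 //.
  by move=> y ys; exact: (jgH y ys).2.
have avg_le (c : R) (f : 'rV[R]_n -> R) : (forall y, y \in s -> f y <= c) ->
    (size s)%:R^-1 * \sum_(y <- s) f y <= c.
  move=> fc; rewrite mulrC ler_pdivrMr // big_seq (@le_trans _ _ (\sum_(y <- s) c)) //.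
    by rewrite [leRHS]big_seq; apply: ler_sum.
  by rewrite big_const_seq count_predT iter_addr_0 mulr_natr.
split.
- move=> y Dy; rewrite mulr_ge0 ?invr_ge0 // big_seq; apply: sumr_ge0 => x xs.
  by apply: k0 => //; exact: seqE.
- move=> y r Dy r0 hr; apply: avg_le => x xs.
  by apply: kap_le => //; apply: hr; exact: seqE.
move=> x Ex.
(* The truncated average [tr] is continuous even at points of [E] and lies below [psi]. Being at
   least [T + 1] on [E], it still exceeds [T] near [x]. *)
pose tr y := (size s)%:R^-1 * \sum_(z <- s) trunc_kernel b d y z.
have ctr : {for x, continuous tr}.
  apply: continuousM; first exact: cst_continuous.
  elim: (s) => [|z t IH].
    rewrite (_ : (fun y => _) = cst 0); first exact: cst_continuous.
    by apply/funext => y; rewrite big_nil.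
  rewrite (_ : (fun y => _) = (fun y => trunc_kernel b d y z +
     \sum_(z <- t) trunc_kernel b d y z)).
    by apply: continuousD => //; exact: trunc_kernel_continuous.
  by apply/funext => y; rewrite big_cons.
have trx : T < tr x.
  apply: (@lt_le_trans _ _ (T + 1)); first by rewrite ltrDl.
  by rewrite /tr mulrC ler_pdivlMr //; exact: hs.
have /(@cvgrPdist_lt _ _ _ (nbhs x)) := ctr.
move=> /(_ (tr x - T)); rewrite subr_gt0 => /(_ trx).
move=> /nbhs_norm_lt[r r0 hr]; exists r => // y Dy yx.
apply: (@le_trans _ _ (tr y)).
  have := hr y yx; rewrite ltr_norml => /andP[_]; lra.
rewrite /tr /psi ler_pM2l ?invr_gt0 // big_seq [leRHS]big_seq.
apply: ler_sum => z zs; apply: kap_le => //; last by rewrite le_max lexx.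
by apply: DE => //; exact: seqE.
Qed.

End EvansPotential.
(** * Divergence of discrete energies *)

Section TernaryCode.
Context {R : realType} {T : Type}.
Variable b : nat -> T -> bool.

(** Digits 0 and 1 in base 3: all digits after a given one are together worth at most half of it, so
    distinct bit sequences stay apart. This fails in base 2. *)
Definition ternary_sum (N : nat) (x : T) : R :=
  \sum_(i < N) (b i x)%:R * 3^-1 ^+ i.

Definition ternary_code (x : T) : R := limn (ternary_sum ^~ x).

Let q : R := 3^-1.
Let q_gt0 N : 0 < q ^+ N. Proof. by rewrite exprn_gt0 // invr_gt0. Qed.

Let ternary_sumS N x :
  ternary_sum N.+1 x = ternary_sum N x + (b N x)%:R * q ^+ N.
Proof. by rewrite /ternary_sum big_ord_recr. Qed.

Lemma ternary_sum_ub N x : ternary_sum N x <= 3 / 2 * (1 - q ^+ N).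
Proof.
elim: N => [|N IH]; first by rewrite /ternary_sum big_ord0 expr0 subrr mulr0.
rewrite /ternary_sum big_ord_recr /= exprSr.
have h : (b N x)%:R * 3^-1 ^+ N <= q ^+ N.
  by rewrite -[leRHS]mul1r ler_pM2r //; case: (b N x).
have {}h := lerD IH h; apply: le_trans h _.
by rewrite /q; lra.
Qed.

Lemma ternary_sum_cvg x : cvgn (ternary_sum ^~ x).
Proof.
apply: nondecreasing_is_cvgn.
  apply/nondecreasing_seqP => N; rewrite /ternary_sum big_ord_recr /= lerDl.
  by rewrite mulr_ge0 // ltW.
exists 2 => _ [N _ <-]; apply: le_trans (ternary_sum_ub N x) _.
by have := q_gt0 N; lra.
Qed.

Lemma ternary_code_ge0 x : 0 <= ternary_code x.
Proof.
apply: limr_ge; first exact: ternary_sum_cvg.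
by near=> N; apply: sumr_ge0 => i _; rewrite mulr_ge0 // ltW.
Unshelve. all: by end_near. Qed.

Lemma ternary_code_le2 x : ternary_code x <= 2.
Proof.
apply: limr_le; first exact: ternary_sum_cvg.
near=> N; apply: le_trans (ternary_sum_ub N x) _.
by have := q_gt0 N; lra.
Unshelve. all: by end_near. Qed.

Lemma ternary_code_gap J x y : (forall i, (i < J)%N -> b i x = b i y) ->
  b J x -> ~~ b J y -> q ^+ J / 2 <= ternary_code x - ternary_code y.
Proof.
move=> agree bx by_.
(* The term [3 / 2 * q ^+ (J.+1 + N)] is the largest total of the digits still to come; carrying it
   closes the induction. *)
have gap N : q ^+ J / 2 + 3 / 2 * q ^+ (J.+1 + N) <=
    ternary_sum (J.+1 + N) x - ternary_sum (J.+1 + N) y.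
  elim: N => [|N IH].
    rewrite addn0 /ternary_sum !big_ord_recr /= bx (negbTE by_) mul0r mul1r addr0.
    under [X in X + _ - _]eq_bigr => i _ do rewrite agree //.
    by rewrite addrAC subrr add0r exprSr /q; lra.
  rewrite addnS; move: (J.+1 + N)%N IH => K IH; rewrite !ternary_sumS exprSr.
  have h1 : 0 <= (b K x)%:R * q ^+ K by rewrite mulr_ge0 // ltW.
  have h2 : (b K y)%:R * q ^+ K <= q ^+ K.
    by rewrite -[leRHS]mul1r ler_pM2r //; case: (b _ y).
  move: IH h1 h2; rewrite -/q; set A := ternary_sum _ x; set B := ternary_sum _ y.
  by set P := q ^+ K; rewrite /q; lra.
rewrite /ternary_code -limB; [|exact: ternary_sum_cvg|exact: ternary_sum_cvg].
apply: limr_ge; first by apply: is_cvgB; exact: ternary_sum_cvg.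
exists J.+1 => // N /= JN; rewrite -(subnKC JN).
by apply: le_trans (gap _); rewrite lerDl mulr_ge0 // ltW.
Qed.

Lemma ternary_code_close J x y :
  `|ternary_code x - ternary_code y| < q ^+ J / 2 ->
  forall i, (i <= J)%N -> b i x = b i y.
Proof.
move=> close; elim/ltn_ind => i IH iJ.
have agree k : (k < i)%N -> b k x = b k y.
  by move=> ki; apply: IH => //; rewrite (leq_trans (ltnW ki)).
have qiJ : q ^+ J / 2 <= q ^+ i / 2.
  by rewrite ler_pM2r // ler_wiXn2l // ?invr_ge0 // invf_le1 // ler1n.
case bx: (b i x); case by_: (b i y) => //; exfalso.
- have := ternary_code_gap agree bx (negbT by_).
  by have := le_lt_trans (ler_norm _) close; lra.
- have agree' k : (k < i)%N -> b k y = b k x by move=> ki; rewrite agree.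
  have := ternary_code_gap agree' by_ (negbT bx); rewrite distrC in close.
  by have := le_lt_trans (ler_norm _) close; lra.
Qed.

End TernaryCode.

Section CompactCode.
Context {R : realType} {n : nat}.

Lemma rat_approx (x : 'rV[R]_n) (e : R) : 0 < e ->
  exists c : 'rV[rat]_n, `|x - map_mx ratr c| < e.
Proof.
move=> e0.
have ap i : exists q : rat, `|x ord0 i - ratr q| < e.
  have [|q] := @rat_in_itvoo R (x ord0 i - e) (x ord0 i + e).
    by lra.
  rewrite in_itv /= => /andP[h1 h2]; exists q; rewrite ltr_norml; lra.
have [c hc] := choice ap; exists (\row_i c i).
by apply/rV_norm_lt => // i; rewrite !mxE.
Qed.

(* The bits of the code tell which rational balls contain the point. *)
Lemma compact_code (E : set 'rV[R]_n) : compact E ->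
  exists code : 'rV[R]_n -> R, (forall x, 0 <= code x <= 2) /\
  forall e, 0 < e -> exists2 d, 0 < d & forall x y, E x -> E y ->
    `|code x - code y| < d -> `|x - y| < e.
Proof.
move=> cE.
pose b (i : nat) (x : 'rV[R]_n) : bool :=
  if unpickle i is Some (c, m) then `|x - map_mx ratr (c : 'rV[rat]_n)| < m.+1%:R^-1
  else false.
exists (ternary_code b); split=> [x|e e0].
  by rewrite ternary_code_ge0 ternary_code_le2.
pose m := Num.truncn (2 / e).
have me : 2 * m.+1%:R^-1 < e.
  have := truncnS_gt (2 / e); rewrite -/m ltr_pdivrMr // mulrC => h.
  by rewrite ltr_pdivrMr.
have m0 : 0 < (m.+1%:R^-1 : R) by rewrite invr_gt0.
(* Compactness bounds the index of some rational ball of radius [m.+1%:R^-1] around each point of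
   [E]. If two codes agree up to that bound, both points lie in one such ball. *)
have [||d d0 hd] := @compact_uniform R _ E (fun d x => exists c : 'rV[rat]_n,
    (pickle (c, m))%:R < d^-1 /\ `|x - map_mx ratr c| < m.+1%:R^-1) cE.
- move=> d d' y d'0 d'd [c [h1 h2]]; exists c; split=> //.
  by apply: lt_le_trans h1 _; rewrite lef_pV2 ?posrE // (lt_le_trans d'0).
- move=> x Ex.
  have [c hc] := rat_approx x m0.
  exists ((pickle (c, m)).+1%:R^-1); first by rewrite invr_gt0.
  exists (m.+1%:R^-1 - `|x - map_mx ratr c|); first by rewrite subr_gt0.
  move=> y yx _; exists c; split; first by rewrite invrK ltr_nat.
  rewrite (_ : y - _ = (y - x) + (x - map_mx ratr c)); last by rewrite addrA subrK.
  by apply: le_lt_trans (ler_normD _ _) _; rewrite -ltrBrDr.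
pose J := Num.truncn d^-1.
exists (3^-1 ^+ J / 2); first by rewrite divr_gt0 // exprn_gt0 // invr_gt0.
move=> x y Ex Ey xy; have close := ternary_code_close xy.
have [c [cJ xc]] := hd x Ex.
have : b (pickle (c, m)) x by rewrite /b pickleK.
rewrite close; first rewrite /b pickleK => yc.
  rewrite (_ : x - y = (x - map_mx ratr c) - (y - map_mx ratr c)).
    apply: le_lt_trans (ler_normB _ _) _.
    by apply: lt_trans (ltrD xc yc) _; rewrite -mulr2n -[X in X < _]mulr_natl.
  by apply/rowP => i; rewrite !mxE; ring.
rewrite /J -ltnS -(@ltr_nat R); apply: lt_trans cJ _; exact: truncnS_gt.
Qed.

End CompactCode.

(** * Helly's selection theorem *)

Section Helly.
Context {R : realType}.

(** The value intervals of the jumps of a monotone function are disjoint, so a rational chosen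
    inside each jump determines it. *)
Lemma countable_gaps (L : R -> R) : {homo L : s t / s <= t} ->
  countable [set t | exists2 e, 0 < e &
    forall r s, r < t -> t < s -> L r + e <= L s].
Proof.
move=> mono; pose gap t := exists2 e, 0 < e &
  forall r s, r < t -> t < s -> L r + e <= L s.
have qex t : exists q : rat, gap t ->
    (forall r, r < t -> L r < ratr q) /\ (forall s, t < s -> ratr q < L s).
  have [[e e0 he]|] := pselect (gap t); last by exists 0.
  pose S := [set L r | r in [set r | r < t]].
  have S0 : S !=set0 by exists (L (t - 1)), (t - 1) => //=; rewrite ltrBlDr ltrDl.
  have Sub s : t < s -> ubound S (L s - e).
    by move=> ts _ [r rt <-]; rewrite lerBrDr; exact: he.
  have hS : has_sup S.
    by split=> //; exists (L (t + 1) - e); apply: Sub; rewrite ltrDl.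
  have [|q] := @rat_in_itvoo R (sup S) (sup S + e); first by rewrite ltrDl.
  rewrite in_itv /= => /andP[q1 q2]; exists q => _; split=> [r rt|s ts].
    by apply: le_lt_trans q1; apply: ub_le_sup; [case: hS|exists r].
  apply: lt_le_trans q2 _; rewrite -lerBrDr.
  by apply: ge_sup => //; exact: Sub.
have [q hq] := choice qex.
apply/countable_injP; exists (fun t => pickle (q t)) => s t; rewrite !inE.
move=> gs gt /(pcan_inj pickleK) qst.
wlog st : s t gs gt qst / s <= t.
  by move=> W; case: (leP s t) => [|/ltW] st; [|apply/esym]; apply: W.
apply/eqP; rewrite eq_le st leNgt; apply/negP => lt_st.
have [_ hs] := hq s gs; have [ht _] := hq t gt.
have mid1 : s < (s + t) / 2 by lra.
have mid2 : (s + t) / 2 < t by lra.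
by have := lt_trans (hs _ mid1) (ht _ mid2); rewrite qst ltxx.
Qed.

Lemma ultra_fmap (S T : Type) (f : S -> T) (U : set_system S) :
  UltraFilter U -> UltraFilter (f @ U).
Proof.
move=> UU; have PU : ProperFilter U := @ultra_proper _ _ UU.
split; first exact: fmap_proper_filter.
move=> G PG UG; apply/seteqP; split=> [A GA|]; last exact: UG.
have [//|UnA] := in_ultra_setVsetC (f @^-1` A) UU.
have GnA : G (~` A) by exact: UG.
by have [x []] := filter_ex (filterI GA GnA).
Qed.

(** Limits along an ultrafilter give a candidate [L] at all points at once. A sequence of indices
    must still be extracted, because Fatou's lemma will be applied along it. *)
Lemma helly_selection (Q : nat -> R -> R) :
  (forall k, {homo Q k : s t / s <= t}) -> (forall k t, 0 <= Q k t <= 2) ->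
  exists2 phi : nat -> nat, (forall k, (k <= phi k)%N) &
    forall t, cvgn (fun k => Q (phi k) t).
Proof.
move=> mono bnd.
have [U [UU Ueventually]] := @ultraFilterLemma nat (@nbhs _ _ \oo) _.
have PU : ProperFilter U := @ultra_proper _ _ UU.
have limU t : exists l : R, Q ^~ t @ U --> l.
  have := @segment_compact R 0 2; rewrite compact_ultra => cU.
  have mem : (Q ^~ t @ U) `[0, 2]%classic.
    by apply: (@filterS nat U _ setT _ _ filterT) => k _; rewrite /= in_itv /= bnd.
  by have [l [_ Ul]] := cU (Q ^~ t @ U) (ultra_fmap _ UU) mem; exists l.
have [L hL] := choice limU.
have Lmono : {homo L : s t / s <= t}.
  move=> s t st; apply: (ler_cvg_to (hL s) (hL t)).
  by near=> k; exact: mono.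
(* The subsequence converges on the rationals and on the countably many jumps
   of L; monotonicity gives the other points. *)
pose B := [set t | exists2 e, 0 < e &
  forall r s, r < t -> t < s -> L r + e <= L s] `|` range (@ratr R).
have /countable_injP[f finj] : countable B.
  rewrite /B -bigcup2E; apply: bigcup_countable => // -[|[|i]] _ /=.
  - exact: countable_gaps.
  - exact: card_le_trans (card_image_le _ _) (countableP _).
  - exact: countable0.
(* Stage [i] treats only the points of [B] numbered at most [i]: finitely many conditions, each
   holding on a set of the ultrafilter. *)
have phi_ex i : exists k, (i <= k)%N /\ forall t, B t -> (f t <= i)%N ->
    `|L t - Q k t| < i.+1%:R^-1.
  pose P (l : 'I_i.+1) (k : nat) := forall t, B t -> f t = l ->
    `|L t - Q k t| < i.+1%:R^-1.
  have hP l : \forall k \near U, P l k.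
    have [[t Bt ft]|nt] := pselect (exists2 t, B t & f t = l); last first.
      by apply: (@filterS nat U _ setT _ _ filterT) => k _ t Bt ft; case: nt; exists t.
    have /(@cvgrPdist_lt _ _ _ U) := hL t.
    have i0 : 0 < (i.+1%:R^-1 : R) by rewrite invr_gt0.
    move=> /(_ _ i0); apply: filterS => k h t' Bt' ft'.
    by rewrite (finj t' t) ?inE // ft' ft.
  have Ui : U [set k | (i <= k)%N] by apply: Ueventually; exists i.
  have [k [ik hk]] := filter_ex (filterI Ui (filter_forall PU hP)).
  exists k; split=> // t Bt ti; have li : (f t < i.+1)%N by [].
  exact: (hk (Ordinal li)).
have [phi hphi] := choice phi_ex.
exists phi => [k|t]; first by have [] := hphi k.
have cvB s : B s -> Q (phi k) s @[k --> \oo] --> L s.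
  move=> Bs; apply/cvgrPdist_lt => e e0.
  exists (maxn (f s) (Num.truncn e^-1)) => // k /=.
  rewrite geq_max => /andP[qk ek].
  have [_ /(_ _ Bs qk)/lt_trans] := hphi k; apply.
  rewrite -[ltRHS]invrK ltf_pV2 ?posrE ?invr_gt0 //.
  by apply: lt_le_trans (truncnS_gt _) _; rewrite ler_nat.
suff : Q (phi k) t @[k --> \oo] --> L t by move/cvgP.
have [Bt|ngap] := pselect (B t); first exact: cvB.
have cvq q : Q (phi k) (ratr q) @[k --> \oo] --> L (ratr q).
  by apply: cvB; right; exists q.
apply/cvgrPdist_lt => e e0.
have e30 : 0 < e / 3 by rewrite divr_gt0.
have [r [s [rt ts Lrs]]] : exists r s, [/\ r < t, t < s & L s < L r + e / 3].
  apply: contrapT => nrs; apply: ngap; left; exists (e / 3) => // r s rt ts.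
  by rewrite leNgt; apply/negP => lt; apply: nrs; exists r, s.
have [q] := rat_in_itvoo rt; rewrite in_itv /= => /andP[rq qt].
have [q'] := rat_in_itvoo ts; rewrite in_itv /= => /andP[tq' q's].
have /cvgrPdist_lt/(_ _ e30) c1 := cvq q.
have /cvgrPdist_lt/(_ _ e30) c2 := cvq q'.
near=> k.
have d1 : `|L (ratr q) - Q (phi k) (ratr q)| < e / 3 by near: k.
have d2 : `|L (ratr q') - Q (phi k) (ratr q')| < e / 3 by near: k.
have m1 := mono (phi k) _ _ (ltW qt); have m2 := mono (phi k) _ _ (ltW tq').
have m3 := Lmono _ _ (ltW qt); have m4 := Lmono _ _ (ltW tq').
have m5 := Lmono _ _ (ltW rq); have m6 := Lmono _ _ (ltW q's).
move: d1 d2; rewrite !ltr_norml => /andP[? ?] /andP[? ?].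
apply/andP; split; lra.
Unshelve. all: by end_near.
Qed.

End Helly.

(** * Step functions under the uniform law *)

Section UniformStep.
Context {R : realType}.
Local Notation P := (uniform_prob (@ltr01 R)).

(* Truncated at N.-1 so that it is monotone on the whole line. *)
Definition step_index (N : nat) (t : R) : nat :=
  minn (Num.truncn (N%:R * t)) N.-1.

Lemma step_index_homo N s t : s <= t -> (step_index N s <= step_index N t)%N.
Proof.
move=> st; rewrite leq_min geq_minr andbT (leq_trans (geq_minl _ _)) //.
by apply: le_truncn; rewrite ler_wpM2l.
Qed.

Lemma step_index_lt N t : (0 < N)%N -> (step_index N t < N)%N.
Proof. by move=> N0; rewrite -[X in (_ < X)%N]prednK // ltnS geq_minr. Qed.

Lemma measurable_step_index N (A : set nat) :
  measurable (step_index N @^-1` A : set R).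
Proof.
have -> : step_index N @^-1` A =
    \bigcup_(i in A) (step_index N @^-1` [set i] : set R).
  apply/seteqP; split=> [t At|t [i Ai ti]].
    by exists (step_index N t).
  by move: ti; rewrite /preimage /= => ->.
apply: bigcup_measurable => i Ai; apply: is_interval_measurable.
move=> s t /= si ti r /andP[sr rt]; apply/eqP; rewrite eqn_leq.
by apply/andP; split; [rewrite -ti|rewrite -si]; exact: step_index_homo.
Qed.

(** On the unit interval the cell of [i] lies between [i / N] and [(i + 1) / N]. For the last index,
    where [step_index] is capped, the upper end comes from [t <= 1]. *)
Lemma uniform_step_index N i : (0 < N)%N ->
  (P (step_index N @^-1` [set i]) <= (N%:R^-1)%:E)%E.
Proof.
move=> N0; have NR : 0 < N%:R :> R by rewrite ltr0n.
rewrite /uniform_prob integral_uniform_pdf.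
rewrite (eq_integral (cst 1%:E)); last first.
  move=> t; rewrite inE => -[_ /=]; rewrite in_itv /= /uniform_pdf => ->.
  by rewrite subr0 invr1.
rewrite integral_cst; last by apply: measurableI => //; exact: measurable_step_index.
rewrite mul1e; apply: (@le_trans _ _
    (lebesgue_measure (`[i%:R / N%:R, i.+1%:R / N%:R]%classic : set R))); last first.
  rewrite lebesgue_measure_itv /= lte_fin ltr_pM2r ?invr_gt0 // ltr_nat ltnSn.
  by rewrite -EFinB lee_fin -mulrBl -natrB // subSnn mul1r.
apply: le_measure; rewrite ?inE.
- by apply: measurableI => //; exact: measurable_step_index.
- exact: measurable_itv.
move=> t [/= ti]; rewrite !in_itv /= => /andP[t0 t1].
have Nt0 : 0 <= N%:R * t by rewrite mulr_ge0.
rewrite ler_pdivrMr // ler_pdivlMr // ![t * _]mulrC; apply/andP; split.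
  apply: le_trans (_ : (Num.truncn (N%:R * t))%:R <= _); last by rewrite truncn_le.
  by rewrite ler_nat -ti geq_minl.
move: ti; rewrite /step_index /minn; case: ltnP => _ <-.
  by apply/ltW; exact: truncnS_gt.
by rewrite prednK // ler_piMr.
Qed.

Lemma measurable_step d (T : measurableType d) N (g : nat -> T) :
  measurable_fun setT (g \o step_index N : R -> T).
Proof.
by move=> _ Y mY; rewrite setTI comp_preimage; exact: measurable_step_index.
Qed.

Lemma integral_step_le N (g : nat -> R) : (0 < N)%N -> (forall i, 0 <= g i) ->
  (\int[P]_t (g (step_index N t))%:E <= (N%:R^-1 * \sum_(i < N) g i)%:E)%E.
Proof.
move=> N0 g0.
pose A (i : nat) : set R := step_index N @^-1` [set i].
have AT : [set: R] = \big[setU/set0]_(i <- index_iota 0 N) A i.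
  rewrite -bigcup_seq; apply/seteqP; split=> // t _.
  by exists (step_index N t) => //=; rewrite mem_index_iota /= step_index_lt.
rewrite AT ge0_integral_bigsetU //=.
- rewrite big_mkord mulr_sumr -sumEFin; apply: lee_sum => i _.
  rewrite (eq_integral (cst (g i)%:E)); last by move=> t; rewrite inE /A /= => ->.
  rewrite integral_cst; last exact: measurable_step_index.
  rewrite [leRHS]EFinM muleC lee_wpmul2r ?lee_fin //.
  exact: uniform_step_index.
- by move=> i; exact: measurable_step_index.
- exact: iota_uniq.
- by move=> i j _ _ [t [/= <- <-]].
- apply: measurable_funTS.
  exact: (@measurable_step _ _ N (fun i => (g i)%:E)).
- by move=> t _; rewrite lee_fin.
Qed.

End UniformStep.

Section Pushforward.
Context d d' (T : measurableType d) (T' : measurableType d') {R : realType}.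
Variables (P : probability T R) (X : {mfun T >-> T'}).
Import HBNNSimple.

(* The integrand need not be measurable: an integral is a supremum over simple
   functions. *)
Lemma integral_distribution_le (f : T' -> \bar R) (A : set T') (G : T -> \bar R) :
  measurable_fun setT G -> (forall t, 0 <= G t)%E ->
  (forall t, f (X t) <= G t)%E ->
  (\int[distribution P X]_(x in A) f x <= \int[P]_t G t)%E.
Proof.
move=> mG G0 fG; rewrite integralE.
apply: (@le_trans _ _ (\int[distribution P X]_(x in A) (f ^\+)%E x)%E).
  by rewrite -[leRHS]sube0; apply: leeB => //; exact: integral_ge0.
rewrite ge0_integralE //; apply: ge_ereal_sup => _ [h /= hf <-].
have mh : measurable_fun setT (fun y => (h y)%:E) by apply/measurable_EFinP.
rewrite -integralT_nnsfun ge0_integral_distribution //; last first.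
  by move=> y; rewrite lee_fin.
apply: ge0_le_integral => //.
- by move=> t _; rewrite /= lee_fin.
- by apply/measurable_EFinP; apply: measurableT_comp.
move=> t _ /=; apply: le_trans (hf _) _; rewrite patchE.
by case: ifP => _ //; rewrite funeposE ge_max fG G0.
Qed.

End Pushforward.

(** * From zero capacity to diverging discrete energies *)

Section CapacityKernel.
Context {R : realType} {n : nat}.
Implicit Types (E : set 'rV[R]_n) (x y : 'rV[R]_n).

Definition cap_kernel : 'rV[R]_n -> 'rV[R]_n -> \bar R :=
  if n == 2%N then log_kernel else newton_kernel.

Lemma zero_capacity_energy E :
  zero_capacity E -> min_energy cap_kernel E = +oo%E.
Proof.
rewrite /zero_capacity /cap_kernel; case: ifP => _.
  rewrite /log_capacity => /eqP; rewrite expeR_eq0 => /eqP h.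
  by rewrite -[LHS]oppeK h.
rewrite /newtonian_capacity => /eqP; rewrite inve_eq0.
by move=> /eqP ->.
Qed.

(** Lower semicontinuity of the kernel along positive distances, including the diagonal, where the
    right-hand side is infinite. The kernel of the capacity has no shift, and adding the absolute
    value of [b] compensates a negative [b]. *)
Lemma cap_kernel_le x y b (r : nat -> R) : (2 <= n)%N ->
  (forall k, 0 < r k) -> r @ \oo --> enorm (x - y) ->
  (cap_kernel x y <= limn_einf (fun k => (kap n b (r k) + `|b|)%:E))%E.
Proof.
move=> n2 r0 cr; have := enorm_ge0 (x - y); rewrite le_eqVlt => /orP[/eqP e0|e0].
  rewrite (cvg_limn_einf_sup (_ : _ --> +oo%E)).1 ?leey //.
  apply/cvgeryP/cvgryPge => M.
  have [d d0 hd] := kap_large n2 b (M - `|b|).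
  have /cvgrPdist_lt/(_ _ d0) : r @ \oo --> (0 : R) by rewrite e0.
  apply: filterS => k; rewrite sub0r normrN gtr0_norm // => rd.
  by rewrite -lerBlDr; apply: hd => //; exact: ltW.
have -> : cap_kernel x y = (kap n 0 (enorm (x - y)))%:E.
  rewrite /cap_kernel /kap addr0; case: ifP => _.
    by rewrite /log_kernel lne_EFin.
  by rewrite /newton_kernel inver gt_eqF // exprn_gt0.
have ck : (kap n b (r k) + `|b|)%:E @[k --> \oo] -->
    (kap n b (enorm (x - y)) + `|b|)%:E.
  apply: cvg_EFin; first by near=> k.
  apply: cvgD; last exact: cvg_cst.
  exact: cvg_comp cr (kap_continuous e0).
rewrite (cvg_limn_einf_sup ck).1 lee_fin /kap addr0 -addrA lerDl.
by have := ler_norm (- b); rewrite normrN; lra.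
Unshelve. all: by end_near.
Qed.

End CapacityKernel.

Section CapacityDiverges.
Context {R : realType} {n : nat}.
Implicit Types (E : set 'rV[R]_n) (x y : 'rV[R]_n).
Local Notation P := (uniform_prob (@ltr01 R)).

Lemma limn_einf_ge (u : nat -> \bar R) (a : \bar R) :
  (forall k, a <= u k)%E -> (a <= limn_einf u)%E.
Proof.
move=> au; rewrite [limn_einf u]limf_einfE.
apply: ereal_sup_ge; exists (ereal_inf (u @` setT)).
  by exists setT => //; exact: filterT.
by apply: le_ereal_inf_tmp => _ [k _ <-].
Qed.

Lemma limn_einf_le (u : nat -> \bar R) (a : \bar R) :
  (forall k, u k <= a)%E -> (limn_einf u <= a)%E.
Proof.
move=> ua; rewrite [limn_einf u]limf_einfE; apply: ge_ereal_sup => _ [V ooV <-].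
have [k Vk] := filter_ex ooV.
by apply: le_trans (ua k); apply: ereal_inf_lbound; exists k.
Qed.

Lemma measurable_limn_einf (f : nat -> R -> \bar R) :
  (forall k, measurable_fun setT (f k)) ->
  measurable_fun setT (fun t => limn_einf (f ^~ t)).
Proof.
move=> mf; have -> : (fun t => limn_einf (f ^~ t)) =
    (fun t => (- limn_esup (fun k => - f k t))%E).
  by apply/funext => t; rewrite -limn_einfN; congr limn_einf;
    apply/funext => k /=; rewrite oppeK.
apply: measurableT_comp => //; apply: measurable_fun_limn_esup => k.
exact: measurableT_comp.
Qed.

Lemma measurable_limit (X : nat -> R -> 'rV[R]_n) (Y : R -> 'rV[R]_n) :
  (forall k A, measurable (X k @^-1` A : set (measurableTypeR R))) ->
  (forall t, X ^~ t @ \oo --> Y t) ->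
  measurable_fun setT (Y : measurableTypeR R -> @borelRn R n).
Proof.
move=> mX XY; apply: (@measurability _ _ _ (@borelRn R n) setT _ open) => //.
move=> _ [U oU <-]; rewrite setTI.
(* [C m] is the set of points at depth [m.+1%:R^-1] inside [U]. The limit [Y t] lies in [U] exactly
   when some [C m] contains [X k t] for all large [k]. *)
pose C (m : nat) : set 'rV[R]_n := [set x | forall y, `|y - x| < m.+1%:R^-1 -> U y].
have -> : Y @^-1` U =
    \bigcup_m \bigcup_K \bigcap_(k in [set k | (K <= k)%N]) (X k @^-1` C m).
  apply/seteqP; split=> [t Ut|t [m _ [K _ hK]]].
    have /nbhs_norm_lt[r r0 hr] : nbhs (Y t) U by exact: open_nbhs_nbhs.
    have r20 : 0 < r / 2 by rewrite divr_gt0.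
    exists (Num.truncn (r / 2)^-1) => //.
    have /cvgrPdist_lt/(_ _ r20)[K _ hK] := XY t.
    exists K => // k /= /hK; rewrite /= distrC => kt y ym; apply: hr.
    rewrite (_ : y - Y t = (y - X k t) + (X k t - Y t)); last by rewrite addrA subrK.
    apply: le_lt_trans (ler_normD _ _) _; rewrite [ltRHS]splitr; apply: ltrD => //.
    apply: lt_trans ym _; rewrite -[ltRHS]invrK ltf_pV2 ?posrE ?invr_gt0 //.
    exact: truncnS_gt.
  have m0 : 0 < (m.+1%:R^-1 : R) by rewrite invr_gt0.
  have /cvgrPdist_lt/(_ _ m0)[K' _ hK'] := XY t.
  have := hK (maxn K K'); rewrite /= leq_maxl => /(_ isT); apply.
  exact: (hK' (maxn K K') (leq_maxr _ _)).
apply: bigcupT_measurable => m; apply: bigcupT_measurable => K.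
by apply: bigcap_measurable => [|k _]; [exists K => /=|exact: mX].
Qed.

(** Sorted by their codes, the points of a configuration form a step function [Z k], a quantile
    function of the counting measure whose code is monotone. Helly's theorem thus yields pointwise
    convergence instead of weak convergence, and Fatou's lemma applies directly to the two iterated
    integrals. *)
Lemma zero_capacity_diverge E b (r0 : R) : (2 <= n)%N -> compact E ->
  zero_capacity E -> 0 < r0 ->
  (forall r, 0 < r -> r <= r0 -> 0 <= kap n b r) ->
  (forall x y, E x -> E y -> enorm (x - y) <= r0) ->
  energies_diverge E b.
Proof.
move=> n2 cE zE r00 k0 diam T; apply: contrapT => ndiv.
(* The truncations tend to 0, so that the truncated kernels recover the kernel in the limit, and
   never exceed [r0], up to which the kernel is nonnegative. *)
pose d k : R := r0 / k.+1%:R.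
have d0 k : 0 < d k by rewrite divr_gt0.
have ex_s k : exists s : seq 'rV[R]_n, [/\ s != [::], forall x, x \in s -> E x &
    discrete_energy b (d k) s < T * (size s)%:R ^+ 2].
  apply: contrapT => ns; apply: ndiv; exists (d k) => // s s0 sE.
  by rewrite leNgt; apply/negP => lt; apply: ns; exists s.
have [s hs] := choice ex_s.
have [x0 Ex0] : E !=set0.
  by have [] := hs 0%N; case: (s 0%N) => // x t _ h _; exists x; apply: h; rewrite inE eqxx.
have [code [code02 codeE]] := compact_code cE.
pose le_code x y := code x <= code y.
pose srt k := sort le_code (s k).
pose N k := size (s k).
have N0 k : (0 < N k)%N by have [] := hs k; rewrite -size_eq0 lt0n.
pose Z k (t : R) := nth x0 (srt k) (step_index (N k) t).
have EZ k t : E (Z k t).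
  have [_ sE _] := hs k; apply: sE; rewrite -(mem_sort le_code) mem_nth //.
  by rewrite size_sort step_index_lt.
have [phi phi_ge cvg_code] : exists2 phi : nat -> nat, (forall k, (k <= phi k)%N) &
    forall t, cvgn (fun k => code (Z (phi k) t)).
  apply: (@helly_selection R (fun k t => code (Z k t))) => [k t u tu|k t]; last exact: code02.
  apply: (@sorted_leq_nth _ le_code _ _ x0 (srt k)).
  - by move=> y x z; exact: le_trans.
  - by move=> x; exact: lexx.
  - by apply: sort_sorted => x y; exact: le_total.
  - by rewrite inE size_sort step_index_lt.
  - by rewrite inE size_sort step_index_lt.
  - exact: step_index_homo.
pose X k := Z (phi k).
(* The codes converge, so the points of [E] form a Cauchy sequence; a cluster point supplied by
   compactness is then its limit. *)
have lim_ex t : exists y, E y /\ X ^~ t @ \oo --> y.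
  have FE : (X ^~ t @ \oo) E by exists 0%N => // k _; exact: EZ.
  have [y [Ey cly]] := cE (X ^~ t @ \oo) _ FE.
  exists y; split=> //; apply/cvgrPdist_lt => e e0.
  have e20 : 0 < e / 2 by rewrite divr_gt0.
  have [c c0 hc] := codeE _ e20.
  have c20 : 0 < c / 2 by rewrite divr_gt0.
  have /cvgrPdist_lt/(_ _ c20)[K _ hK] := cvg_code t.
  have FK : (X ^~ t @ \oo) [set x | exists2 m, (K <= m)%N & x = X m t].
    by exists K => // m /= Km; exists m.
  have yball : nbhs y [set x | `|x - y| < e / 2] by apply/nbhs_norm_lt; exists (e / 2).
  have [_ [[m Km ->] my]] := cly _ _ FK yball.
  exists K => // k /= Kk.
  rewrite (_ : y - X k t = (y - X m t) + (X m t - X k t)); last by rewrite addrA subrK.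
  apply: le_lt_trans (ler_normD _ _) _; rewrite [ltRHS]splitr; apply: ltrD.
    by rewrite distrC.
  apply: hc; [exact: EZ|exact: EZ|].
  have h1 := hK m Km; have h2 := hK k Kk; rewrite /= in h1 h2.
  rewrite -(subrKA (limn (fun k => code (Z (phi k) t)))).
  apply: le_lt_trans (ler_normD _ _) _; rewrite [ltRHS]splitr; apply: ltrD => //.
  by rewrite distrC.
have [Y hY] := choice lim_ex.
have mX k A : measurable (X k @^-1` A : set (measurableTypeR R)).
  by rewrite /X /Z -[_ @^-1` _]/(step_index (N (phi k)) @^-1`
    (nth x0 (srt (phi k)) @^-1` A)); exact: measurable_step_index.
have mY : measurable_fun setT (Y : measurableTypeR R -> @borelRn R n).
  by apply: (measurable_limit mX) => t; have [] := hY t.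
pose fY := mfun_Sub (mem_set mY).
pose mu : probability (@borelRn R n) R := distribution P fY.
have muE : mu E = 1%E.
  rewrite /mu /= /distribution /pushforward.
  rewrite (_ : _ @^-1` _ = setT); first exact: probability_setT.
  by apply/seteqP; split=> // t _; have [] := hY t.
pose G k u t := trunc_kernel b (d (phi k)) (X k u) (X k t) + `|b|.
have d_le k : d k <= r0 by rewrite ler_pdivrMr // ler_peMr ?ler1n // ltW.
have tr0 k x y : E x -> E y -> 0 <= trunc_kernel b (d (phi k)) x y + `|b|.
  move=> Ex Ey; rewrite addr_ge0 //; apply: k0; first by rewrite lt_max d0 orbT.
  by rewrite ge_max diam // d_le.
have G0 k u t : (0 <= (G k u t)%:E)%E by rewrite lee_fin; apply: tr0; exact: EZ.
have mG k u : measurable_fun setT (fun t : measurableTypeR R => (G k u t)%:E).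
  exact: (@measurable_step _ _ _ (N (phi k)) (fun i =>
    (trunc_kernel b (d (phi k)) (X k u) (nth x0 (srt (phi k)) i) + `|b|)%:E)).
pose h k u := (\int[P]_t (G k u t)%:E)%E.
have h0 k u : (0 <= h k u)%E by apply: integral_ge0 => t _; exact: G0.
have mh k : measurable_fun setT (h k : measurableTypeR R -> \bar R).
  exact: (@measurable_step _ _ _ (N (phi k)) (fun i => (\int[P]_t
    (trunc_kernel b (d (phi k)) (nth x0 (srt (phi k)) i) (X k t) + `|b|)%:E)%E)).
have kernel_le u t :
    (cap_kernel (Y u) (Y t) <= limn_einf (fun k => (G k u t)%:E))%E.
  apply: cap_kernel_le => // [k|]; first by rewrite lt_max d0 orbT.
  have [_ cu] := hY u; have [_ ct] := hY t.
  have ce : enorm (X k u - X k t) @[k --> \oo] --> enorm (Y u - Y t).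
    have c : {for Y u - Y t, continuous (fun z : 'rV[R]_n => enorm (z - 0))}.
      exact: enorm_continuous.
    have cs : X k u - X k t @[k --> \oo] --> Y u - Y t by exact: cvgB.
    have cc : enorm (X k u - X k t - 0) @[k --> \oo] --> enorm (Y u - Y t - 0).
      by move=> A /c /cs.
    move: cc; rewrite subr0; apply: cvg_trans.
    by apply: near_eq_cvg; near=> k; rewrite /= subr0.
  suff ch : enorm (X k u - X k t) + d (phi k) @[k --> \oo] --> enorm (Y u - Y t).
    apply: squeeze_cvgr ce ch; near=> k.
    by rewrite le_max lexx /= ge_max lerDl ltW //= lerDr enorm_ge0.
  rewrite -[X in _ --> X]addr0; apply: cvgD => //.
  apply/cvgrPdist_lt => e e0; exists (Num.truncn (r0 / e)) => // k /= ek.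
  rewrite sub0r normrN gtr0_norm // ltr_pdivrMr // mulrC -ltr_pdivrMr //.
  apply: lt_le_trans (truncnS_gt _) _.
  by rewrite ler_nat ltnS (leq_trans ek).
have seqsum k (f : 'rV[R]_n -> R) :
    \sum_(i < N k) f (nth x0 (srt k) i) = \sum_(x <- s k) f x.
  rewrite -(perm_big _ (permEl (perm_sort le_code (s k)))) /= (big_nth x0).
  by rewrite size_sort big_mkord.
have h_le k : (\int[P]_u h k u <= (T + `|b|)%:E)%E.
  have NR : 0 < (N (phi k))%:R :> R by rewrite ltr0n.
  have srtE i : (i < N (phi k))%N -> E (nth x0 (srt (phi k)) i).
    move=> iN; have [_ sE _] := hs (phi k).
    by apply: sE; rewrite -(mem_sort le_code) mem_nth // size_sort.
  (* Setting the function to 0 outside the index range gives the nonnegativity at all indices that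
     [integral_step_le] asks for. *)
  pose g1 j i := if (i < N (phi k))%N then trunc_kernel b (d (phi k))
    (nth x0 (srt (phi k)) j) (nth x0 (srt (phi k)) i) + `|b| else 0.
  have g10 j i : (j < N (phi k))%N -> 0 <= g1 j i.
    by move=> jN; rewrite /g1; case: ifP => // iN; apply: tr0; exact: srtE.
  pose g3 j := if (j < N (phi k))%N then
    (N (phi k))%:R^-1 * \sum_(i < N (phi k)) g1 j i else 0.
  have g30 j : 0 <= g3 j.
    rewrite /g3; case: ifP => // jN; rewrite mulr_ge0 ?invr_ge0 //.
    by apply: sumr_ge0 => i _; exact: g10.
  have h_step u : (h k u <= (g3 (step_index (N (phi k)) u))%:E)%E.
    have uN := step_index_lt u (N0 (phi k)).
    have := @integral_step_le R _ (g1 (step_index (N (phi k)) u)) (N0 (phi k))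
      (fun i => g10 _ i uN).
    rewrite /g3 uN; apply: le_trans; rewrite /h le_eqVlt; apply/orP; left.
    by apply/eqP; apply: eq_integral => t _; rewrite /g1 step_index_lt.
  apply: (@le_trans _ _ (\int[P]_u (g3 (step_index (N (phi k)) u))%:E)%E).
    apply: ge0_le_integral => //.
    - exact: (@measurable_step _ _ _ (N (phi k)) (fun j => (g3 j)%:E)).
  apply: le_trans (integral_step_le (N0 _) g30) _; rewrite lee_fin.
  rewrite (eq_bigr (fun j : 'I_(N (phi k)) => (N (phi k))%:R^-1 *
    (\sum_(x <- s (phi k)) trunc_kernel b (d (phi k)) (nth x0 (srt (phi k)) j) x +
     (N (phi k))%:R * `|b|))); last first.
    move=> j _; rewrite /g3 ltn_ord; congr (_ * _).
    rewrite -seqsum mulr_natl -[X in _ = _ + _ *+ X](card_ord (N (phi k))).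
    rewrite -sumr_const -big_split /=; apply: eq_bigr => i _.
    by rewrite /g1 ltn_ord.
  rewrite -mulr_sumr big_split /= sumr_const card_ord.
  rewrite (seqsum (phi k) (fun y => \sum_(x <- s (phi k)) trunc_kernel b (d (phi k)) y x)).
  rewrite -/(discrete_energy b (d (phi k)) (s (phi k))) -[X in _ + X]mulr_natl.
  rewrite !mulrDr mulrA lerD //.
    have [_ _ /ltW hW] := hs (phi k).
    by rewrite -invfM ler_pdivrMl ?mulr_gt0 // mulrC -expr2.
  by rewrite [leLHS](_ : _ = `|b|) //; field; rewrite gt_eqF.
have inner u : (\int[mu]_(y in E) cap_kernel (Y u) y <= limn_einf (h ^~ u))%E.
  apply: (@le_trans _ _ (\int[P]_t limn_einf (fun k => (G k u t)%:E))%E).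
    apply: integral_distribution_le => [|t|t].
    - by apply: (@measurable_limn_einf (fun k t => (G k u t)%:E)) => k; exact: mG.
    - by apply: limn_einf_ge => k; exact: G0.
    - exact: kernel_le.
  by apply: fatou => // k t _; exact: G0.
have : (energy cap_kernel E mu <= (T + `|b|)%:E)%E.
  apply: (@le_trans _ _ (\int[P]_u limn_einf (h ^~ u))%E).
    apply: integral_distribution_le => [|u|u].
    - exact: measurable_limn_einf.
    - by apply: limn_einf_ge => k.
    - exact: inner.
  apply: le_trans (limn_einf_le h_le).
  by apply: fatou => // k u _; exact: h0.
have : (min_energy cap_kernel E <= energy cap_kernel E mu)%E.
  by apply: ereal_inf_lbound; exists mu.
rewrite zero_capacity_energy // => /le_trans h1 /h1.
by rewrite leNgt ltry.
Unshelve. all: by end_near.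
Qed.

End CapacityDiverges.

(** * Comparison across sets of zero capacity *)

Section LowerSemicontinuous.
Context {R : realType} {n : nat}.
Implicit Types (D K E Om : set 'rV[R]_n) (x y : 'rV[R]_n).

Lemma LSC_lt D u x (a : R) : open D -> LSC D u -> D x -> (a%:E < u x)%E ->
  exists2 r : R, 0 < r & forall y, `|y - x| < r -> D y /\ (a%:E < u y)%E.
Proof.
move=> oD lsc Dx au; have [_ ulim] := lsc x Dx.
have := lt_le_trans au ulim; rewrite limf_einfE => /ereal_sup_gt[_ [V nV <-]] aV.
have nD : nbhs x D by exact: open_nbhs_nbhs.
have /nbhs_norm_lt[r r0 hr] : nbhs x (D `&` [set y | D y -> V y]).
  exact: filterI.
exists r => // y /hr[Dy /(_ Dy) Vy]; split=> //.
by apply: lt_le_trans aV _; apply: ereal_inf_lbound; exists y.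
Qed.

Lemma LSC_sub_lt D u (f : 'rV[R]_n -> R) x (a : R) : open D -> LSC D u ->
  {for x, continuous f} -> D x -> ((f x + a)%:E < u x)%E ->
  exists2 r : R, 0 < r & exists2 e, 0 < e & forall y, `|y - x| < r ->
     ((f y + a + e)%:E < u y)%E.
Proof.
move=> oD lsc cf Dx au.
have [e e0 aeu] : exists2 e, 0 < e & ((f x + a + e)%:E < u x)%E.
  move: au; case: (u x) => [s|_|//]; last by exists 1 => //; rewrite ltry.
  rewrite lte_fin => h; exists ((s - (f x + a)) / 2); first lra.
  by rewrite lte_fin; lra.
have [r r0 hr] := LSC_lt oD lsc Dx aeu.
have e20 : 0 < e / 2 by rewrite divr_gt0.
have /(@cvgrPdist_lt _ _ _ (nbhs x))/(_ _ e20)/nbhs_norm_lt[r' r'0 hr'] := cf.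
exists (Num.min r r'); first by rewrite lt_min r0.
exists (e / 2) => // y; rewrite lt_min => /andP[/hr[_ uy] /hr' fy].
apply: lt_trans uy; rewrite lte_fin.
by move: fy; rewrite ltr_norml => /andP[]; lra.
Qed.

(** Removing [E] from [K] destroys compactness: the negative infimum [m] of [u - f] is attained if
    the minimising points cluster off [E], by lower semicontinuity, and otherwise is only approached
    at a point of [E]. The bound [c] keeps [m] finite. *)
Lemma inf_dichotomy Om E K u (f : 'rV[R]_n -> R) (c : R) :
  open (Om `\` E) -> LSC (Om `\` E) u -> compact K -> K `<=` Om ->
  (forall x, (Om `\` E) x -> {for x, continuous f}) ->
  (forall y, (K `\` E) y -> ((f y + c)%:E <= u y)%E) ->
  (exists2 y, (K `\` E) y & (u y < (f y)%:E)%E) ->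
  exists m : R, [/\ m < 0, forall y, (K `\` E) y -> ((f y + m)%:E <= u y)%E &
    (exists2 x, (K `\` E) x & u x = (f x + m)%:E) \/
    (exists2 x, E x & forall r e, 0 < r -> 0 < e -> exists y,
       [/\ (K `\` E) y, `|y - x| < r & (u y < (f y + m + e)%:E)%E])].
Proof.
move=> oD lsc cK KOm cf hc [y0 Ky0 uy0].
have KD y : (K `\` E) y -> (Om `\` E) y by move=> [Ky Ey]; split=> //; exact: KOm.
pose g y := (u y - (f y)%:E)%E.
have gE y (a : R) : (g y < a%:E)%E = (u y < (f y + a)%:E)%E.
  by rewrite /g lteBlDr // -EFinD addrC.
have gEle y (a : R) : (a%:E <= g y)%E = ((f y + a)%:E <= u y)%E.
  by rewrite leNgt gE -leNgt.
have infg_lb : (c%:E <= ereal_inf (g @` (K `\` E)))%E.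
  by apply: le_ereal_inf_tmp => _ [y Ky <-]; rewrite gEle; exact: hc.
have infg_neg : (ereal_inf (g @` (K `\` E)) < 0)%E.
  apply: (@le_lt_trans _ _ (g y0)); first by apply: ereal_inf_lbound; exists y0.
  by rewrite gE addr0.
have [|x Kx clx] := inf_cluster cK (@subDsetl _ K E) (f := g).
  by apply: lt_trans infg_neg _; exact: ltry.
move: clx infg_neg infg_lb (@ereal_inf_lbound _ (g @` (K `\` E))).
case: ereal_inf => [m clx m0 cm lbm|//|//].
rewrite lte_fin in m0.
have le_m y : (K `\` E) y -> ((f y + m)%:E <= u y)%E.
  by move=> Ky; rewrite -gEle; apply: lbm; exists y.
exists m; split=> //; have [Ex|nEx] := pselect (E x).
  right; exists x => // r e r0 e0.
  have [|y [Ky yx]] := clx r (m + e)%:E r0; first by rewrite lte_fin ltrDl.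
  by rewrite gE addrA => h; exists y.
left; have Kx' : (K `\` E) x by split.
exists x => //; apply/eqP; rewrite eq_le le_m // andbT leNgt; apply/negP => lt.
have [r r0 [e e0 hr]] := LSC_sub_lt oD lsc (cf _ (KD _ Kx')) (KD _ Kx') lt.
have [|y [Ky yx]] := clx r (m + e)%:E r0; first by rewrite lte_fin ltrDl.
by rewrite gE addrA => /(lt_trans (hr _ yx)); rewrite ltxx.
Qed.

End LowerSemicontinuous.

(** * Localised test functions *)

Section Touching.
Context {R : realType} {n : nat}.
Implicit Types (D K E Om : set 'rV[R]_n) (x y : 'rV[R]_n).

Lemma jet_on_jet D f g H x : open D -> @jet_on R n D f g H -> D x ->
  jet f x = (x, f x, \row_i g i x, \matrix_(i, j) H i j x) /\
  laplacian f x = \sum_i H i i x.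
Proof.
move=> oD jf Dx; have [p1 p2] := jet_partial oD jf; split; last first.
  by rewrite /laplacian; apply: eq_bigr => i _; rewrite p2.
by rewrite /jet /gradient /hessian; congr (_, _, _, _);
  [apply/rowP => i; rewrite !mxE p1|apply/matrixP => i j; rewrite !mxE p2].
Qed.

(* A quartic penalty turns local touching into global touching without
   changing the jet at the contact point. *)
Lemma touching_local D u (v f : 'rV[R]_n -> R) g H x (r B : R) :
  open D -> jet_on D f g H -> (forall y, D y -> ((v y)%:E < u y)%E) ->
  (forall y, D y -> f y - v y <= B) -> D x -> 0 < r ->
  (forall y, D y -> `|y - x| < r -> ((f y)%:E <= u y)%E) -> (f x)%:E = u x ->
  exists phi, [/\ C2_on D phi, forall y, D y -> ((phi y)%:E <= u y)%E,
    (phi x)%:E = u x,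
    jet phi x = (x, f x, \row_i g i x, \matrix_(i, j) H i j x) &
    laplacian phi x = \sum_i H i i x].
Proof.
move=> oD jf vu fB Dx r0 fu fx.
(* With this [A] the penalty is at least [B] beyond distance [r], so the test function does not
   exceed [v] there, hence stays below [u]. *)
pose A := `|B| / r ^+ 4.
have A0 : 0 <= A by rewrite divr_ge0 // exprn_ge0 // ltW.
have jq := jet_on_add jf (jet_on_scale (- A) (jet_on_sqr (jet_on_sqdist D x))).
have Sx : sqdist x x = 0.
  by rewrite /sqdist big1 // => i _; rewrite subrr expr0n.
exists (fun y => f y + - A * sqdist x y ^+ 2); split.
- exact: C2_on_jet oD jq.
- move=> y Dy; have [yx|yx] := ltP `|y - x| r.
    apply: le_trans (fu y Dy yx); rewrite lee_fin gerDl mulNr oppr_le0.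
    by rewrite mulr_ge0 // sqr_ge0.
  apply: le_trans (ltW (vu y Dy)); rewrite lee_fin.
  have S4 : r ^+ 4 <= sqdist x y ^+ 2.
    rewrite (exprM r 2 2) lerXn2r ?nnegrE ?sqr_ge0 ?sqdist_ge0 //.
    apply: le_trans (ler_norm_sqdist x y); rewrite lerXn2r ?nnegrE //.
    exact: ltW.
  have : `|B| <= A * sqdist x y ^+ 2.
    rewrite /A mulrAC ler_pdivlMr ?exprn_gt0 // ler_wpM2l //.
  have := fB y Dy; have := ler_norm B; lra.
- by rewrite Sx expr0n mulr0 addr0.
- have [-> _] := jet_on_jet oD jq Dx.
  congr (_, _, _, _); first by rewrite Sx expr0n mulr0 addr0.
    by apply/rowP => i; rewrite !mxE Sx mulr0 mul0r mulr0 addr0.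
  by apply/matrixP => i j; rewrite !mxE Sx !subrr !mulr0 !mul0r !addr0 mulr0 addr0.
have [_ ->] := jet_on_jet oD jq Dx.
by apply: eq_bigr => i _; rewrite Sx !subrr !mulr0 !mul0r !addr0 mulr0 addr0.
Qed.

Lemma continuous_bounded_on Om (f : 'rV[R]_n -> R) : bounded_set Om ->
  continuous f -> exists2 B, 0 <= B & forall x, Om x -> `|f x| <= B.
Proof.
move=> [M [_ hM]] cf; pose r := `|M| + 1.
have r0 : 0 < r by rewrite ltr_wpDl.
have cB : compact [set y : 'rV[R]_n | exists2 x, [set 0] x & `|y - x| <= r].
  by apply: compact_thickening => //; exact: compact_set1.
have [||B _ hB] := @compact_uniform R _ _ (fun e x => `|f x| <= e^-1) cB.
- move=> e d y d0 de /le_trans; apply; rewrite lef_pV2 ?posrE //.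
  exact: lt_le_trans de.
- move=> x _; have /(@cvgrPdist_lt _ _ _ (nbhs x))/(_ _ ltr01) := cf x.
  move=> /nbhs_norm_lt[s s0 hs]; exists ((`|f x| + 1)^-1).
    by rewrite invr_gt0 ltr_wpDl.
  exists s => // y /hs fy _; rewrite invrK -lerBlDl.
  by apply: le_trans (ltW fy); rewrite distrC; exact: lerB_dist.
exists `|B^-1| => // x Ox; apply: le_trans (ler_norm _); apply: hB.
exists 0 => //; rewrite subr0; apply: hM => //.
by rewrite /r (le_lt_trans (ler_norm M)) // ltrDl.
Qed.

End Touching.

(** * Comparison principle and contact slopes *)

Section Comparison.
Context {R : realType} {n : nat}.
Implicit Types (D K E Om : set 'rV[R]_n) (x y : 'rV[R]_n).

Lemma ler_norm_enorm x y : `|x - y| <= enorm (x - y).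
Proof.
rewrite enormE -[leLHS]normr_id -sqrtr_sqr ler_sqrt ?sqdist_ge0 //.
exact: ler_norm_sqdist.
Qed.

Lemma enorm_le x y : enorm (x - y) <= Num.sqrt n%:R * `|x - y|.
Proof.
rewrite enormE -[X in _ * X]normr_id -sqrtr_sqr -sqrtrM // ler_sqrt.
  exact: sqdist_le.
by rewrite mulr_ge0 // sqr_ge0.
Qed.

Lemma dist_away Om E x : open (Om `\` E) -> (Om `\` E) x ->
  exists2 r : R, 0 < r & forall y, E y -> r <= enorm (x - y).
Proof.
move=> oD Dx; have /nbhs_norm_lt[r r0 hr] : nbhs x (Om `\` E) by exact: open_nbhs_nbhs.
exists r => // y Ey; rewrite leNgt; apply/negP => lt.
have [] // := hr y; apply: le_lt_trans lt; rewrite distrC.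
exact: ler_norm_enorm.
Qed.

Variables (Om E : set 'rV[R]_n) (u : 'rV[R]_n -> \bar R) (v : 'rV[R]_n -> R).
Variables (gv : 'I_n -> 'rV[R]_n -> R) (Hv : 'I_n -> 'I_n -> 'rV[R]_n -> R).
Variables (b C : R).
Hypotheses (n2 : (2 <= n)%N) (oOm : open Om) (bOm : bounded_set Om).
Hypotheses (oD : open (Om `\` E)) (E0 : E !=set0) (cE : compact E) (EOm : E `<=` Om).
Hypothesis divE : energies_diverge E b.
Hypothesis kap0 : forall x y, E x -> (Om `\` E) y -> 0 <= kap n b (enorm (y - x)).
Hypothesis lsc : LSC (Om `\` E) u.
Hypothesis jv : jet_on Om v gv Hv.
Hypothesis uC : visc_laplacian_le (Om `\` E) u C.
Hypothesis vu : forall x, (Om `\` E) x -> ((v x)%:E < u x)%E.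

(** A maximum principle that does not see [E]. If it failed at [y0], lower [v + th] by [eta * psi]
    with [psi] a discrete Evans potential. The minimum of the difference cannot be interior and off
    [E], since [psi] is harmonic and the Laplacian of [u] is at most [C]; nor can it be approached
    at [E], since there [eta * psi] exceeds the bound [B] of [th] while [u] stays above [v]. *)
Lemma comparison K (th : 'rV[R]_n -> R) g H : compact K -> K `<=` Om ->
  jet_on setT th g H ->
  (forall y, (K `\` E) y -> C < \sum_i (Hv i i y + H i i y)) ->
  (forall y, (K `\` E) y -> (exists2 r, 0 < r & forall z, `|z - y| < r -> K z) \/
     ((v y + th y)%:E <= u y)%E) ->
  forall y, (K `\` E) y -> ((v y + th y)%:E <= u y)%E.
Proof.
move=> cK KOm jth supersol bdry y0 Ky0; rewrite leNgt; apply/negP => uy0.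
have KD y : (K `\` E) y -> (Om `\` E) y by move=> [Ky Ey]; split=> //; exact: KOm.
have cth : continuous th by move=> x; exact: (jet_cont jth I).
have [B B0 hB] := continuous_bounded_on bOm cth.
have [a a0 uy0a] : exists2 a, 0 < a & (u y0 < (v y0 + th y0 - a)%:E)%E.
  move: uy0 (vu (KD _ Ky0)); case: (u y0) => [s| |] //.
  rewrite lte_fin => h _; exists ((v y0 + th y0 - s) / 2); first lra.
  by rewrite lte_fin; lra.
(* [psi] depends on [T], which depends on [eta]. So [eta] is fixed first, from a bound of [psi y0]
   valid for every [T]: the kernel at a lower bound [r] of the distance from [y0] to [E]. *)
have [r r0 hr] := dist_away oD (KD _ Ky0).
pose k := `|kap n b r|.
pose eta := a / (k + 1).
have k10 : 0 < k + 1 by rewrite /k ltr_wpDl.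
have eta0 : 0 < eta by rewrite divr_gt0.
have T0 : 0 <= (B + 1) / eta by rewrite divr_ge0 ?addr_ge0 // ltW.
have ED x : E x -> ~ (Om `\` E) x by move=> Ex [_]; apply.
have [psi [gH [jpsi hpsi] [psi0 psi_le psi_ge]]] :=
  evans_potential n2 divE E0 T0 ED kap0.
pose f y := v y + (th y + - eta * psi y).
have DOm : Om `\` E `<=` Om by move=> y [].
have jf := jet_on_add (jet_on_sub DOm jv)
  (jet_on_add (jet_on_sub (@subsetT _ (Om `\` E)) jth) (jet_on_scale (- eta) jpsi)).
have f_le y : (Om `\` E) y -> f y <= v y + th y.
  by move=> Dy; rewrite /f lerD2l gerDl mulNr oppr_le0 mulr_ge0 ?psi0 // ltW.
have th_le y : Om y -> th y <= B by move=> /hB; exact/le_trans/ler_norm.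
have [|y Ky||m [m0 hm [[x Kx ux]|[x Ex clx]]]] :=
  @inf_dichotomy R n Om E K u f (- B) oD lsc cK KOm.
- by move=> x Dx; exact: (jet_cont jf Dx).
- apply: le_trans (ltW (vu (KD _ Ky))); rewrite lee_fin.
  by have := f_le y (KD _ Ky); have := th_le y (KOm _ Ky.1); lra.
- exists y0 => //; apply: lt_le_trans uy0a _; rewrite lee_fin /f -addrA lerD2l.
  rewrite lerD2l mulNr lerN2.
  apply: (@le_trans _ _ (eta * k)).
    rewrite ler_pM2l //; apply: le_trans (ler_norm _).
    exact: psi_le (KD _ Ky0) r0 hr.
  by rewrite /eta mulrAC ler_pdivrMr // ler_pM2l // lerDl.
- have [[s s0 hs]|] := bdry x Kx; last first.
    rewrite ux lee_fin => h; have := f_le x (KD _ Kx); lra.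
  have jfm := jet_on_add jf (jet_on_cst (Om `\` E) m).
  have [|y Dy yx||phi [C2phi phiu phix _ lapphi]] :=
    @touching_local R n _ u v _ _ _ x s B oD jfm vu _ (KD _ Kx) s0.
  + move=> y Dy /=; have := f_le y Dy; have := th_le y Dy.1; rewrite -/(f y); lra.
  + by apply: hm; split; [exact: hs|exact: Dy.2].
  + by rewrite ux.
  have := uC C2phi phiu (KD _ Kx) phix; rewrite lapphi leNgt => /negP; apply.
  apply: lt_le_trans (supersol x Kx) _; rewrite !big_split /= -!addrA lerD2l.
  rewrite big1_eq addr0 -mulr_sumr hpsi ?mulr0 ?addr0 //.
  exact: KD.
have [s s0 hs] := psi_ge x Ex.
(* The tolerance [- m] cancels the level [m] and leaves [u y < f y]. *)
have [|y [Ky yx uy]] := clx s (- m) s0; first by rewrite oppr_gt0.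
have := lt_trans (vu (KD _ Ky)) uy; rewrite lte_fin addrK.
apply/negP; rewrite -leNgt /f gerDl.
have := hs y (KD _ Ky) yx; rewrite ler_pdivrMr // mulrC => h.
by have := th_le y (KOm _ Ky.1); lra.
Qed.

Lemma closed_sublevel (h : 'rV[R]_n -> R) (c : R) :
  continuous h -> closed [set z | h z <= c].
Proof.
by move=> ch; apply: (@closed_comp _ _ h [set t | t <= c]);
  [move=> z _; exact: ch|exact: closed_le].
Qed.

Lemma near_lt (h : 'rV[R]_n -> R) (c : R) z : {for z, continuous h} -> h z < c ->
  \forall w \near z, h w < c.
Proof. by move=> ch hz; have /cvgr_lt := ch; apply. Qed.

Lemma dotBr (a x y : 'rV[R]_n) : dot a (x - y) = dot a x - dot a y.
Proof.
by rewrite /dot -sumrB; apply: eq_bigr => i _; rewrite !mxE mulrBr.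
Qed.

Lemma dotZl (k : R) (a x : 'rV[R]_n) : dot (k *: a) x = k * dot a x.
Proof. by rewrite /dot mulr_sumr; apply: eq_bigr => i _; rewrite mxE mulrA. Qed.

Lemma enorm_sq (a : 'rV[R]_n) : enorm a ^+ 2 = dot a a.
Proof.
rewrite /enorm sqr_sqrtr; last by apply: sumr_ge0 => i _; exact: sqr_ge0.
by apply: eq_bigr => i _; rewrite expr2.
Qed.

Lemma sqdist_dot (a x : 'rV[R]_n) : sqdist a x = dot (x - a) (x - a).
Proof. by apply: eq_bigr => i _; rewrite !mxE expr2. Qed.

(** Cauchy-Schwarz for a unit vector, by expanding the squared distance from [x] to its projection
    on [nu]. *)
Lemma dot_unit_sq_le (nu x : 'rV[R]_n) : dot nu nu = 1 -> dot nu x ^+ 2 <= dot x x.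
Proof.
have key (s : R) : \sum_i (x ord0 i - s * nu ord0 i) ^+ 2 =
    dot x x - 2 * s * dot nu x + s ^+ 2 * dot nu nu.
  rewrite /dot !mulr_sumr -sumrB -big_split /=.
  by apply: eq_bigr => i _; ring.
move=> nu1; have : 0 <= \sum_i (x ord0 i - dot nu x * nu ord0 i) ^+ 2.
  by apply: sumr_ge0 => i _; exact: sqr_ge0.
by rewrite key nu1 => h; rewrite -subr_ge0; apply: le_trans h _; rewrite le_eqVlt; apply/orP; left; apply/eqP; ring.
Qed.

(* If the slope jumped by much more than r between two contact points at
   distance r, the graph of u would lie above a wedge near x; the quadratic
   barrier q below, which is positive at x, would then contradict contact. *)
Lemma contact_slope th g H (x y a : 'rV[R]_n) (c r d La : R) :
  let gam := n%:R + `|C| + `|La| + 1 in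
  jet_on setT th g H -> (forall z, `|z - x| <= d -> Om z) ->
  (forall z, (Om `\` E) z -> `|z - x| <= d -> ((v z + th z)%:E <= u z)%E) ->
  (forall z, (Om `\` E) z -> `|z - x| <= d ->
     ((v z + th z + (dot a z + c))%:E <= u z)%E) ->
  (forall z, (Om `\` E) z -> `|z - x| <= d ->
     - La <= \sum_i (Hv i i z + H i i z)) ->
  (forall s e, 0 < s -> 0 < e -> exists z,
     [/\ (Om `\` E) z, `|z - x| < s & (u z < (v z + th z + e)%:E)%E]) ->
  (forall s e, 0 < s -> 0 < e -> exists z,
     [/\ (Om `\` E) z, `|z - y| < s &
        (u z < (v z + th z + (dot a z + c) + e)%:E)%E]) ->
  0 < r -> enorm (y - x) <= r -> (2 * gam + 3) * (2 * r) <= d ->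
  enorm a <= 8 * (gam + 1) * r.
Proof.
move=> gam jth ball_d hf hg lap cx cy r0 yxr rd.
rewrite leNgt; apply/negP => Abig; pose A := enorm a.
have gam1 : 1 <= gam.
  by rewrite /gam lerDr !addr_ge0.
have A0 : 0 < A by apply: le_lt_trans Abig; rewrite !mulr_ge0 ?addr_ge0 //; lra.
pose nu := A^-1 *: a.
have nu1 : dot nu nu = 1.
  have dotC (p q : 'rV[R]_n) : dot p q = dot q p.
    by apply: eq_bigr => i _; rewrite mulrC.
  by rewrite /nu dotZl dotC dotZl -enorm_sq -/A expr2; field; rewrite gt_eqF.
(* Doubling [r] leaves room for the offset of [y]: where [t z = rho], the component of [z - y] along
   [nu] is still at least [r]. *)
pose rho := 2 * r.
have rho0 : 0 < rho by rewrite mulr_gt0.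
pose M := 2 * gam + 3.
have yd : `|y - x| < d.
  apply: lt_le_trans rd; apply: le_lt_trans (ler_norm_enorm _ _) _.
  apply: le_lt_trans yxr _; rewrite -/M mulrA -[ltLHS]mul1r ltr_pM2r // /M; lra.
(* Near [y], [u] comes arbitrarily close to the second touching function while staying above
   [v + th], so their affine difference cannot be negative at [y]. *)
have Ay : 0 <= dot a y + c.
  rewrite leNgt; apply/negP => neg.
  have neg2 : dot a y < - c / 2 + dot a y / 2 by lra.
  have cda : {for y, continuous (dot a)} := jet_cont (jet_on_dot setT a) I.
  have n1 := near_lt cda neg2.
  have n2' : \forall z \near y, `|z - x| < d.
    apply/nbhs_norm_lt; exists (d - `|y - x|); first by rewrite subr_gt0.
    move=> z zy; rewrite -(subrKA y); apply: le_lt_trans (ler_normD _ _) _.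
    by rewrite -ltrBrDr.
  have /nbhs_norm_lt[s s0 hs] : nbhs y ([set z | dot a z < - c / 2 + dot a y / 2] `&`
    [set z | `|z - x| < d]) by exact: filterI.
  have e0 : 0 < - (dot a y + c) / 2 by lra.
  have [z [Dz /hs[/= zda zd] uz]] := cy s _ s0 e0.
  have := le_lt_trans (hf z Dz (ltW zd)) uz; rewrite lte_fin; lra.
pose t z := dot nu z + - dot nu x.
have jt := jet_on_add (jet_on_dot setT nu) (jet_on_cst setT (- dot nu x)).
(* The barrier equals [rho ^+ 2] at [x], and its Laplacian [2 * (gam + 1) - 2 * n%:R] exceeds
   [C + La]. It is at most 0 where [t z = - rho], and at most [2 * (gam + 1) * rho ^+ 2] where
   [t z = rho]. There the affine difference is at least [A * r], which is larger because [A] exceeds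
   [8 * (gam + 1) * r]. *)
pose q z := rho ^+ 2 + ((gam + 1) * rho * t z + ((gam + 1) * t z ^+ 2 + -1 * sqdist x z)).
have jq := jet_on_add (jet_on_cst setT (rho ^+ 2)) (jet_on_add
  (jet_on_scale ((gam + 1) * rho) jt)
  (jet_on_add (jet_on_scale (gam + 1) (jet_on_sqr jt))
     (jet_on_scale (-1) (jet_on_sqdist setT x)))).
have tE z : t z = dot nu (z - x) by rewrite dotBr.
have t2S z : t z ^+ 2 <= sqdist x z by rewrite tE sqdist_dot; exact: dot_unit_sq_le.
have ct : continuous t by move=> z; exact: (jet_cont jt I).
have cq : continuous q by move=> z; exact: (jet_cont jq I).
have cS : continuous (sqdist x) by move=> z; exact: (jet_cont (jet_on_sqdist setT x) I).
have cnt : continuous (fun z => `|t z|).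
  by move=> z; apply: continuous_comp; [exact: ct|exact: norm_continuous].
(* On the curved side, at distance [M * rho] from [x], the term [-1 * sqdist x z] outweighs the rest
   of [q], which is at most [(2 * gam + 3) * rho ^+ 2]: this fixes [M]. *)
pose K := [set z | `|t z| <= rho] `&` [set z | sqdist x z <= (M * rho) ^+ 2].
have Kd z : K z -> `|z - x| <= d.
  move=> [_ /= Sz]; apply: (le_trans _ rd); rewrite -/rho -/M.
  have Mr0 : 0 <= M * rho by rewrite mulr_ge0 ?(ltW rho0) // /M; lra.
  rewrite -(@ler_pXn2r _ 2) ?nnegrE //.
  exact: le_trans (ler_norm_sqdist x z) Sz.
have KOm : K `<=` Om by move=> z /Kd; exact: ball_d.
have cK : compact K.
  apply: bounded_closed_compact; last first.
    by apply: closedI; exact: closed_sublevel.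
  exists (`|x| + d); split; first exact: num_real.
  move=> B dB z /Kd zd; apply/ltW; apply: le_lt_trans dB.
  by rewrite -[z](subrK x) addrC (le_trans (ler_normD _ _)) // lerD2l.
have KD z : (K `\` E) z -> (Om `\` E) z by move=> [Kz Ez]; split=> //; exact: KOm.
have interior_K z : `|t z| < rho -> sqdist x z < (M * rho) ^+ 2 ->
    exists2 s, 0 < s & forall w, `|w - z| < s -> K w.
  move=> tz Sz.
  have /nbhs_norm_lt[s s0 hs] : nbhs z ([set w | `|t w| < rho] `&`
      [set w | sqdist x w < (M * rho) ^+ 2]).
    by apply: filterI; [exact: near_lt (cnt z) tz|exact: near_lt (cS z) Sz].
  by exists s => // w /hs[/= tw Sw]; split; exact: ltW.
have Sx : sqdist x x = 0 by rewrite /sqdist big1 // => i _; rewrite subrr expr0n.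
have tx : t x = 0 by rewrite /t subrr.
have qx : q x = rho ^+ 2 by rewrite /q tx Sx expr0n !mulr0 !addr0.
have rho20 : 0 < rho ^+ 2 by rewrite exprn_gt0.
have lerD3 (p1 p2 p3 p4 : R) : p3 <= p4 -> p1 + (p2 + p3) <= p1 + p2 + p4 by lra.
have comp : forall z, (K `\` E) z -> ((v z + (th z + q z))%:E <= u z)%E.
  apply: (@comparison K _ _ _ cK KOm (jet_on_add jth jq)) => z Kz.
    rewrite /=.
    have -> : \sum_i (Hv i i z + (H i i z + (0 + ((gam + 1) * rho * (0 + 0) +
       ((gam + 1) * (2 * (dot nu z - dot nu x) * (0 + 0) +
           2 * (nu ord0 i + 0) * (nu ord0 i + 0)) + -1 * (2 * (i == i)%:R)))))) =
      \sum_i (Hv i i z + H i i z) + (2 * (gam + 1) * dot nu nu - 2 * n%:R).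
      have -> : 2 * n%:R = \sum_(i < n) (2 : R).
        by rewrite sumr_const card_ord mulr_natr.
      move: (dot nu z - dot nu x) => tz.
      rewrite /dot mulr_sumr -sumrB -big_split /=.
      by apply: eq_bigr => i _; rewrite eqxx mulr1n; ring.
    have := lap z (KD z Kz) (Kd z Kz.1); rewrite nu1 /gam.
    have := ler_norm C; have := ler_norm La.
    have := normr_ge0 C; have := normr_ge0 La; lra.
  have [[/= tz Sz] Ez] := Kz; have Dz := KD z Kz; have zd := Kd z Kz.1.
  have [tlt|tge] := ltP `|t z| rho; last first.
    right; have [tpos|tneg] := leP 0 (t z).
      have tr : t z = rho by apply/le_anti; rewrite -(ger0_norm tpos) tz tge.
      apply: le_trans (hg z Dz zd); rewrite lee_fin.
      apply: lerD3.
      have : q z <= 2 * (gam + 1) * rho ^+ 2.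
        by have := t2S z; rewrite /q tr; nra.
      have dz : dot a z + c >= dot a (z - y) by rewrite dotBr; lra.
      have ax : a = A *: nu by rewrite /nu scalerA divff ?scale1r // gt_eqF.
      have : A * r <= dot a (z - y).
        rewrite {1}ax dotZl ler_pM2l //.
        have -> : z - y = (z - x) - (y - x) by rewrite opprB addrA subrK.
        rewrite dotBr -(tE z) tr /rho.
        have : dot nu (y - x) <= r.
          apply: le_trans (ler_norm _) _; apply: (le_trans _ yxr).
          rewrite -(@ler_pXn2r _ 2) ?nnegrE ?enorm_ge0 // real_normK ?num_real //.
          by rewrite enorm_sq; exact: dot_unit_sq_le.
        lra.
      have : 2 * (gam + 1) * rho ^+ 2 <= A * r.
        by rewrite /rho; have := Abig; rewrite -/A; nra.
      move=> h1 h2 h3; apply: le_trans h3 _; apply: le_trans h1 _.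
      exact: le_trans h2 dz.
    have tr : t z = - rho.
      by apply/eqP; rewrite -eqr_oppLR; apply/eqP/le_anti; rewrite -(ltr0_norm tneg) tz tge.
    apply: le_trans (hf z Dz zd); rewrite lee_fin.
    rewrite -[leRHS]addr0; apply: lerD3.
    have qneg : q z <= 0 by have := t2S z; rewrite /q tr; nra.
    exact: qneg.
  have [Slt|Sge] := ltP (sqdist x z) ((M * rho) ^+ 2); first by left; exact: interior_K.
  right; apply: le_trans (hf z Dz zd); rewrite lee_fin.
  rewrite -[leRHS]addr0; apply: lerD3.
  have g10 : 0 < gam + 1 by lra.
  have tr : t z <= rho by apply: le_trans (ler_norm _) tz.
  have t2 : t z ^+ 2 <= rho ^+ 2.
    by rewrite -[t z ^+ 2]real_normK ?num_real // ler_pXn2r ?nnegrE // ltW.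
  have : (gam + 1) * rho * t z <= (gam + 1) * rho ^+ 2.
    by rewrite -mulrA ler_pM2l // expr2 ler_pM2l.
  have : (gam + 1) * t z ^+ 2 <= (gam + 1) * rho ^+ 2.
    by rewrite ler_pM2l.
  have : (2 * gam + 3) * rho ^+ 2 <= (M * rho) ^+ 2.
    by rewrite [leRHS]exprMn ler_pM2r // /M; nra.
  move=> h1 h2 h3; have qneg : q z <= 0 by rewrite /q; lra.
  exact: qneg.
have [s s0 hs] : exists2 s, 0 < s & forall w, `|w - x| < s -> K w.
  by apply: interior_K; rewrite ?tx ?normr0 // Sx exprn_gt0 // mulr_gt0 // /M; lra.
(* Comparison keeps [u] above [v + th] by at least [rho ^+ 2 / 2] near [x] and off [E], against
   contact at [x]. *)
have e0 : 0 < rho ^+ 2 / 2 by rewrite divr_gt0.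
have /(@cvgrPdist_lt _ _ _ (nbhs x))/(_ _ e0)/nbhs_norm_lt[s' s'0 hs'] := cq x.
have [|z [Dz]] := cx (Num.min s s') _ _ e0; first by rewrite lt_min s0.
rewrite lt_min => /andP[/hs Kz /hs' qz] uz.
have := le_lt_trans (comp z (conj Kz Dz.2)) uz; rewrite lte_fin.
by move: qz; rewrite qx ltr_norml => /andP[_]; lra.
Qed.

End Comparison.

(** * Contact points of tilted functions *)

Section Operator.
Context {R : realType} {n : nat}.
Implicit Types (Om N : set 'rV[R]_n) (x : 'rV[R]_n).
Local Notation J := ('rV[R]_n * R * 'rV[R]_n * 'M[R]_n)%type.

Lemma within_continuous_dist (V : normedModType R) (A : set V) (f : V -> R) z0 e :
  {within A, continuous f} -> A z0 -> 0 < e ->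
  exists2 r, 0 < r & forall z, A z -> `|z - z0| < r -> `|f z - f z0| < e.
Proof.
move=> /subspace_continuousP cf Az0 e0.
have /cvgrPdist_lt/(_ _ e0) := cf z0 Az0.
rewrite near_withinE => /nbhs_norm_lt[r r0 hr]; exists r => // z Az zz0.
by rewrite distrC; apply: hr.
Qed.

Definition dir_s : J := (0, 1, 0, 0).
Definition dir_p (i : 'I_n) : J := (0, 0, basis_vec i, 0).
Definition dir_M (i0 : 'I_n) : J := (0, 0, 0, delta_mx i0 i0).

Lemma norm_jet_lt (z : J) (e : R) : `|z.1.1.1| < e -> `|z.1.1.2| < e ->
  `|z.1.2| < e -> `|z.2| < e -> `|z| < e.
Proof. by move=> h1 h2 h3 h4; rewrite !prod_normE /= !gt_max h1 h2 h3 h4. Qed.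

Lemma mx_norm_lt m k (M : 'M[R]_(m, k)) (e : R) : 0 < e ->
  (forall i j, `|M i j| < e) -> `|M| < e.
Proof.
move=> e0 h; rewrite [`|M|]mx_normrE.
by apply/bigmax_ltP; split=> // -[i j] _.
Qed.

Lemma common_bound (I : finType) (a : R) (c : I -> R) :
  exists2 L, 0 < L & `|a| + 1 <= L /\ forall i, `|c i| + 1 <= L.
Proof.
have c0 i : 0 <= `|c i| + 1 by rewrite addr_ge0.
pose S := \sum_i (`|c i| + 1); have S0 : 0 <= S by apply: sumr_ge0.
exists (`|a| + 1 + S); first by rewrite ltr_wpDr // ltr_wpDl.
split=> [|i]; first by rewrite lerDl.
apply: (@le_trans _ _ S); last by rewrite lerDr addr_ge0.
by rewrite /S (bigD1 i) //= lerDl; apply: sumr_ge0.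
Qed.

(** A single [e] measures the neighbourhood of the jets of [v], bounds the derivatives in [s] and
    [p] through [e^-1], and is an ellipticity constant in direction [i0]. All three conditions relax
    as [e] decreases, as [compact_uniform] requires. *)
Lemma F_derivative_bounds Om N (F : @jet_space R n -> R) v gv Hv i0 :
  open Om -> C1_operator Om F ->
  (forall z : @jet_space R n, sym_jets_over Om z -> posdefmx (- dF_dM F z)) ->
  jet_on Om v gv Hv -> compact N -> N `<=` Om ->
  exists2 e, 0 < e & forall x, N x -> forall z : J, sym_jets z -> z.1.1.1 = x ->
    `|z.1.1.2 - v x| < e -> `|z.1.2 - \row_i gv i x| < e ->
    `|z.2 - \matrix_(i, j) Hv i j x| < e ->
    [/\ `|'D_dir_s F z| <= e^-1, forall i, `|'D_(dir_p i) F z| <= e^-1 &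
        'D_(dir_M i0) F z <= - e].
Proof.
move=> oOm C1F ell jv cN NOm.
have [||e e0 he] := @compact_uniform R _ N (fun e x => forall z : J, sym_jets z ->
    z.1.1.1 = x -> `|z.1.1.2 - v x| < e -> `|z.1.2 - \row_i gv i x| < e ->
    `|z.2 - \matrix_(i, j) Hv i j x| < e ->
    [/\ `|'D_dir_s F z| <= e^-1, forall i, `|'D_(dir_p i) F z| <= e^-1 &
        'D_(dir_M i0) F z <= - e]) cN.
- move=> e d x d0 de he z sz zx h1 h2 h3.
  have [k1 k2 k3] := he z sz zx (lt_le_trans h1 de) (lt_le_trans h2 de) (lt_le_trans h3 de).
  have ed : e^-1 <= d^-1 by rewrite lef_pV2 ?posrE // (lt_le_trans d0).
  by split=> [|i|]; [exact: le_trans k1 ed|exact: le_trans (k2 i) ed|lra].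
- move=> x0 Nx0.
  pose z0 : J := (x0, v x0, \row_i gv i x0, \matrix_(i, j) Hv i j x0).
  have Om0 : Om x0 by exact: NOm.
  have sz0 : sym_jets_over Om z0.
    split=> //=; rewrite /sym_jets /=; apply/matrixP => i j; rewrite !mxE.
    exact: jet_hess_sym oOm jv Om0.
  have near_dir (w : J) (c : R) : sym_jets w -> 0 < c -> exists2 r, 0 < r &
      forall z, sym_jets_over Om z -> `|z - z0| < r -> `|'D_w F z - 'D_w F z0| < c.
    move=> sw c0; have [_ cw] := C1F w sw.
    exact: (within_continuous_dist cw sz0 c0).
  have sym_s : sym_jets dir_s by rewrite /sym_jets /= trmx0.
  have sym_p i : sym_jets (dir_p i) by rewrite /sym_jets /= trmx0.
  have sym_M : sym_jets (dir_M i0) by rewrite /sym_jets /= trmx_delta.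
  pose lam := - 'D_(dir_M i0) F z0.
  have lam0 : 0 < lam.
    (* Testing positive definiteness on [basis_vec i0] isolates the diagonal entry at [i0]. *)
    have [_ /(_ (basis_vec i0))] := ell z0 sz0.
    rewrite trmx_delta -rowE -colE !mxE /= => h.
    have : 0 < - 'D_((0, 0, 0, 2^-1 *: (delta_mx i0 i0 + delta_mx i0 i0)) : J) F z0.
      apply: h; apply/eqP => /rowP/(_ i0); rewrite !mxE !eqxx /=.
      by apply/eqP; rewrite oner_eq0.
    suff -> : 2^-1 *: (delta_mx i0 i0 + delta_mx i0 i0) = delta_mx i0 i0 :> 'M[R]_n by [].
    by rewrite -mulr2n -[X in _ *: X]scaler_nat scalerA mulVf ?scale1r.
  have lam20 : 0 < lam / 2 by rewrite divr_gt0.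
  have [rs rs0 hs] := near_dir _ _ sym_s ltr01.
  have [rM rM0 hM] := near_dir _ _ sym_M lam20.
  have /choice[rp hp] : forall i, exists r, 0 < r /\ forall z, sym_jets_over Om z ->
      `|z - z0| < r -> `|'D_(dir_p i) F z - 'D_(dir_p i) F z0| < 1.
    by move=> i; have [r r0 hr] := near_dir _ _ (sym_p i) ltr01; exists r.
  have [r [r0 rrs rrM rrp]] : exists r, [/\ 0 < r, r <= rs, r <= rM & forall i, r <= rp i].
    exists (Num.min rs (Num.min rM (\big[Num.min/1]_i rp i))); split.
    + rewrite !lt_min rs0 rM0 /=; apply/bigmin_gtP; split=> [|i _].
        exact: ltr01.
      by have [] := hp i.
    + by rewrite ge_min lexx.
    + by rewrite !ge_min lexx orbT.
    + by move=> i; rewrite !ge_min; apply/orP; right; apply/orP; right; exact: bigmin_le.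
  have [L L0 [Ls Lp]] :=
    @common_bound _ ('D_dir_s F z0) (fun i => 'D_(dir_p i) F z0).
  have r20 : 0 < r / 2 by rewrite divr_gt0.
  have near_v : \forall y \near x0, `|v y - v x0| < r / 2.
    have /(@cvgrPdist_lt _ _ _ (nbhs x0))/(_ _ r20) := jet_cont jv Om0.
    by apply: filterS => y; rewrite distrC.
  have near_g : \forall y \near x0, `|(\row_i gv i y) - (\row_i gv i x0)| < r / 2.
    have near_gi i : \forall y \near x0, `|gv i y - gv i x0| < r / 2.
      have /(@cvgrPdist_lt _ _ _ (nbhs x0))/(_ _ r20) := jet_cont1 jv (i := i) Om0.
      by apply: filterS => y; rewrite distrC.
    have := filter_forall (nbhs_filter x0) near_gi; apply: filterS => y hy.
    by apply: mx_norm_lt => // k i; rewrite !mxE.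
  have near_H : \forall y \near x0,
      `|(\matrix_(i, j) Hv i j y) - (\matrix_(i, j) Hv i j x0)| < r / 2.
    have near_Hij (ij : 'I_n * 'I_n) :
        \forall y \near x0, `|Hv ij.1 ij.2 y - Hv ij.1 ij.2 x0| < r / 2.
      have /(@cvgrPdist_lt _ _ _ (nbhs x0))/(_ _ r20) :=
        jet_cont2 jv (i := ij.1) (j := ij.2) Om0.
      by apply: filterS => y; rewrite distrC.
    have := filter_forall (nbhs_filter x0) near_Hij; apply: filterS => y hy.
    by apply: mx_norm_lt => // i j; rewrite !mxE; exact: (hy (i, j)).
  have near_x : \forall y \near x0, `|y - x0| < r / 2.
    by apply/nbhs_norm_lt; exists (r / 2).
  have near_Om : nbhs x0 Om by exact: open_nbhs_nbhs.
  have /nbhs_norm_lt[rx rx0 hrx] : \forall y \near x0, Om y /\ (`|y - x0| < r / 2 /\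
      (`|v y - v x0| < r / 2 /\ (`|(\row_i gv i y) - (\row_i gv i x0)| < r / 2 /\
      `|(\matrix_(i, j) Hv i j y) - (\matrix_(i, j) Hv i j x0)| < r / 2))).
    by do 4 (apply: filterI => //).
  pose e := Num.min (r / 2) (Num.min L^-1 (lam / 2)).
  have e0 : 0 < e by rewrite !lt_min r20 invr_gt0 L0.
  have er : e <= r / 2 by rewrite ge_min lexx.
  have eL : e <= L^-1 by rewrite !ge_min lexx orbT.
  have elam : e <= lam / 2 by rewrite !ge_min lexx !orbT.
  exists e => //; exists rx => // y /hrx[Omy [yx [yv [yg yH]]]] Ny z sz zy h1 h2 h3.
  have zz0 : `|z - z0| < r.
    have tri (W : normedModType R) (p q o : W) : `|p - q| < e -> `|q - o| < r / 2 ->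
        `|p - o| < r.
      move=> pq qo; rewrite -(subrKA q); apply: le_lt_trans (ler_normD _ _) _.
      by rewrite [ltRHS]splitr ltrD // (lt_le_trans pq).
    apply: norm_jet_lt => /=.
    + by rewrite zy; apply: lt_trans yx _; lra.
    + exact: tri h1 yv.
    + exact: tri h2 yg.
    + exact: tri h3 yH.
  have sOz : sym_jets_over Om z by split; rewrite ?zy.
  have Le : L <= e^-1 by rewrite -[leLHS]invrK lef_pV2 ?posrE // invr_gt0.
  have bound (c c0 : R) : `|c - c0| < 1 -> `|c0| + 1 <= L -> `|c| <= e^-1.
    move=> cc0 c0L; apply: le_trans Le; apply: le_trans c0L.
    rewrite -[c](subrK c0) addrC; apply: le_trans (ler_normD _ _) _.
    by rewrite lerD2l ltW.
  split.
  + exact: bound (hs z sOz (lt_le_trans zz0 rrs)) Ls.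
  + by move=> i; have [_ h] := hp i; exact: bound (h z sOz (lt_le_trans zz0 (rrp i))) (Lp i).
  have := hM z sOz (lt_le_trans zz0 rrM); rewrite ltr_norml => /andP[_].
  by rewrite -[X in _ - X]opprK -/lam; lra.
exists e => // x Nx z; exact: he.
Qed.

Lemma jet_addE (z w : J) (t : R) : z + t *: w =
  (z.1.1.1 + t *: w.1.1.1, z.1.1.2 + t * w.1.1.2, z.1.2 + t *: w.1.2,
   z.2 + t *: w.2).
Proof. by case: z => -[[? ?] ?] ?; case: w => -[[? ?] ?] ?. Qed.

Lemma derivable_F Om (F : @jet_space R n -> R) (z w : J) : C1_operator Om F ->
  sym_jets w -> sym_jets z -> Om z.1.1.1 -> derivable (F : J -> R) z w.
Proof. by move=> C1F sw sz Omz; have [dF _] := C1F w sw; exact: dF. Qed.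

(** The jet is moved in [s], then in [p], then in [M], always inside the box where the derivative
    bounds hold. Ellipticity makes [F] decrease in the Hessian, whence the favourable term
    [- e * a]. *)
Lemma F_increment Om (F : @jet_space R n -> R) i0 x s (p : 'rV[R]_n) (M : 'M[R]_n)
    (e s' a : R) (p' : 'rV[R]_n) :
  C1_operator Om F -> Om x -> M^T = M -> 0 < e ->
  (forall z : J, sym_jets z -> z.1.1.1 = x -> `|z.1.1.2 - s| < e ->
     `|z.1.2 - p| < e -> `|z.2 - M| < e ->
     [/\ `|'D_dir_s F z| <= e^-1, forall i, `|'D_(dir_p i) F z| <= e^-1 &
         'D_(dir_M i0) F z <= - e]) ->
  `|s'| < e -> `|p'| < e -> 0 <= a < e ->
  F (x, s + s', p + p', M + a *: delta_mx i0 i0) - F (x, s, p, M) <=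
    e^-1 * (`|s'| + \sum_i `|p' ord0 i|) - e * a.
Proof.
move=> C1F Omx sM e0 bnd s'e p'e /andP[a0 ae].
have sym_s : sym_jets dir_s by rewrite /sym_jets /= trmx0.
have sym_p i : sym_jets (dir_p i) by rewrite /sym_jets /= trmx0.
have sym_M : sym_jets (dir_M i0) by rewrite /sym_jets /= trmx_delta.
have step_s : F (x, s + s', p, M) - F (x, s, p, M) <= e^-1 * `|s'|.
  have ptE (t : R) : ((x, s, p, M) : J) + t *: (s' *: dir_s) = (x, s + t * s', p, M).
    by rewrite scalerA jet_addE /= !scaler0 !addr0 mulr1.
  have dF (t : R) : derivable (F : J -> R) (x, s + t * s', p, M) dir_s.
    exact: derivable_F C1F _ _ _.
  have [t t01|t /andP[t0 t1]] := @MVT_line R _ (F : J -> R) (x, s, p, M) (s' *: dir_s).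
    by rewrite ptE; have [] := derivable_scale_dir s' (dF t).
  have := ptE 1; rewrite scale1r mul1r => -> ->.
  rewrite ptE; have [_ ->] := derivable_scale_dir s' (dF t).
  apply: le_trans (ler_norm _) _; rewrite normrM mulrC ler_wpM2r //.
  have [|||||//] := bnd (x, s + t * s', p, M); rewrite /= ?subrr ?normr0 //.
  rewrite addrAC subrr add0r normrM (ger0_norm t0); apply: le_lt_trans s'e.
  by rewrite ler_piMl.
have step_p : F (x, s + s', p + p', M) - F (x, s + s', p, M) <=
    e^-1 * \sum_i `|p' ord0 i|.
  pose G (q : 'rV[R]_n) : R := F (x, s + s', q, M).
  have dG q i : is_derive q (basis_vec i) G ('D_(dir_p i) (F : J -> R) (x, s + s', q, M)).
    have qE : q = q + 0 *: basis_vec i by rewrite scale0r addr0.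
    have zE : (x, s + s', q, M) = ((x, s + s', q, M) : J) + 0 *: dir_p i.
      by rewrite scale0r addr0.
    have : is_derive ((x, s + s', q, M) : J) (dir_p i) (F : J -> R)
        ('D_(dir_p i) (F : J -> R) (x, s + s', q, M)).
      by apply: derivableP; exact: derivable_F C1F _ _ _.
    rewrite [X in is_derive X (dir_p i)]zE [X in is_derive X (basis_vec i)]qE.
    move=> h; apply/is_derive_line; move/is_derive_line : h; congr is_derive; apply/funext => t; rewrite /G jet_addE /=.
    by rewrite !scaler0 mulr0 !addr0.
  have := @lipschitz_of_partials R n G p e e^-1 _ (p + p').
  rewrite [p + p' - p]addrAC subrr add0r => /(_ _ p'e) h.
  apply: le_trans (ler_norm _) _; apply: le_trans (h _) _.
    move=> q qp i; have [dq qE] := dG q i; split=> //.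
    rewrite /partial qE.
    have [|||||_ k _] := bnd (x, s + s', q, M); rewrite /= ?subrr ?normr0 //.
    by rewrite addrAC subrr add0r.
  rewrite ler_pM2l ?invr_gt0 //; apply: ler_sum => i _.
  by rewrite !mxE addrAC subrr add0r.
have step_M : F (x, s + s', p + p', M + a *: delta_mx i0 i0) -
    F (x, s + s', p + p', M) <= - (e * a).
  have ptE (t : R) : ((x, s + s', p + p', M) : J) + t *: (a *: dir_M i0) =
      (x, s + s', p + p', M + (t * a) *: delta_mx i0 i0).
    by rewrite scalerA jet_addE /= !scaler0 mulr0 !addr0.
  have symMt (c : R) : (M + c *: delta_mx i0 i0)^T = M + c *: delta_mx i0 i0.
    by rewrite linearD linearZ /= trmx_delta sM.
  have dF (t : R) : derivable (F : J -> R)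
      (x, s + s', p + p', M + (t * a) *: delta_mx i0 i0) (dir_M i0).
    exact: (@derivable_F Om F (x, s + s', p + p', M + (t * a) *: delta_mx i0 i0)
      (dir_M i0) C1F sym_M (symMt _) Omx).
  have [t t01|t /andP[t0 t1]] :=
      @MVT_line R _ (F : J -> R) (x, s + s', p + p', M) (a *: dir_M i0).
    by rewrite ptE; have [] := derivable_scale_dir a (dF t).
  have := ptE 1; rewrite scale1r mul1r => -> ->.
  rewrite ptE; have [_ ->] := derivable_scale_dir a (dF t).
  rewrite [e * a]mulrC -mulrN ler_wpM2l //.
  have [|||||//] := bnd (x, s + s', p + p', M + (t * a) *: delta_mx i0 i0);
    rewrite /= ?[_ + _ - _]addrAC ?subrr ?add0r //.
  exact: symMt.
  apply: mx_norm_lt => // i j; rewrite !mxE normrM.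
  apply: le_lt_trans ae; rewrite normrM (ger0_norm t0) (ger0_norm a0).
  rewrite -[leRHS]mulr1 ler_pM ?mulr_ge0 //; first by rewrite ler_piMl.
  by case: (_ && _); rewrite ?normr1 ?normr0.
lra.
Qed.

End Operator.

(** * Bounded energy of grid-like configurations *)

Section Grid.
Context {R : realType} {n : nat}.

Definition natdist (i j : nat) : nat := (i - j) + (j - i).

Lemma card_natdist_le (m j k : nat) :
  (#|[pred c : 'I_m | natdist c k <= j]| <= (2 * j).+1)%N.
Proof.
rewrite cardE -(size_map val) -(size_iota (k - j) (2 * j).+1).
apply: uniq_leq_size; first by rewrite map_inj_uniq ?enum_uniq //; exact: val_inj.
move=> _ /mapP[c + ->]; rewrite mem_enum inE mem_iota /natdist => h.
have kc : (k <= c + j)%N by rewrite -leq_subLR (leq_trans _ h) // leq_addl.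
have ck : (c <= k + j)%N by rewrite -leq_subLR (leq_trans _ h) // leq_addr.
rewrite leq_subLR addnC kc /= addnS ltnS (leq_trans ck) // mul2n -addnn addnA.
by rewrite leq_add2r addnC -leq_subLR.
Qed.

(** Used to count a shell of the sup distance: with the coordinate that realises the distance fixed
    at [c], only [n - 1] coordinates remain free. *)
Lemma card_box_le (m j : nat) (k : {ffun 'I_n -> 'I_m}) (i : 'I_n) (c : 'I_m) :
  (#|[pred l : {ffun 'I_n -> 'I_m} |
      (l i == c) && [forall i', natdist (l i') (k i') <= j]]|
     <= (2 * j).+1 ^ (n - 1))%N.
Proof.
pose B (i' : 'I_n) : {pred 'I_m} :=
  [pred a | if i' == i then a == c else natdist a (k i') <= j]%N.
apply: (@leq_trans #|family B|).
  apply: subset_leq_card; apply/fintype.subsetP => l; rewrite !inE => /andP[/eqP lic /forallP hl].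
  apply/familyP => i'; rewrite inE; case: eqP => [->|_]; first by rewrite lic.
  exact: hl.
rewrite card_family foldrE big_image /= (bigD1 i) //=.
have -> : #|B i| = 1%N.
  by rewrite -(card1 c); apply: eq_card => a; rewrite !inE eqxx.
rewrite mul1n; apply: (@leq_trans (\prod_(i' < n | i' != i) (2 * j).+1)).
  apply: leq_prod => i' ii'; apply: leq_trans (card_natdist_le m j (k i')).
  by apply: subset_leq_card; apply/fintype.subsetP => a; rewrite !inE (negbTE ii').
by rewrite prod_nat_const cardC1 card_ord subn1.
Qed.

(** Row sums are of the order of the number of points m^n: shell j has order j^(n-1) points with
    kernel values of order (m/j)^(n-1), so each of the at most [m] shells contributes order
    m^(n-1). *)
Lemma grid_energy_bounded (E : set 'rV[R]_n) (b r0 c : R) : (2 <= n)%N ->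
  energies_diverge E b -> 0 < c ->
  (forall x y, E x -> E y -> enorm (x - y) <= r0) ->
  (forall m, (0 < m)%N -> exists X : {ffun 'I_n -> 'I_m} -> 'rV[R]_n,
    (forall k, E (X k)) /\ forall (k l : {ffun 'I_n -> 'I_m}) (i : 'I_n),
      c * ((natdist (k i) (l i))%:R / m%:R) <= enorm (X k - X l)) -> False.
Proof.
move=> n2 divE c0 diam hX.
have [C C0 hC] := @kap_upper R n n2 b r0.
(* The 3 comes from [(2 * j).+1 <= 3 * j] for positive [j], and the factor [n%:R] from the choice of
   the coordinate realising the distance. *)
pose K2 := n%:R * (C * (3 / c) ^+ (n - 1)).
have [d d0 hd] := divE (K2 + 1).
(* [m] is chosen after [d], so that the number [N] of points exceeds the diagonal value [kap n b d].
   The surplus 1 in [K2 + 1] then gives the contradiction. *)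
pose m := (Num.truncn `|kap n b d|).+1.
have m0 : 0 < m%:R :> R by rewrite ltr0n.
have [X [EX dX]] := hX m isT.
pose G := {ffun 'I_n -> 'I_m}.
pose N : nat := #|{: G}|.
have NE : N = (m ^ n)%N by rewrite /N card_ffun !card_ord.
have mN : (m <= N)%N by rewrite NE -[X in (X <= _)%N]expn1 leq_pexp2l // ltnW.
(* The summand of one coordinate realising the sup distance already bounds the kernel. Summing over
   all coordinates avoids selecting one as a function of [l]. *)
have pair (k l : G) : l != k -> trunc_kernel b d (X k) (X l) <=
    \sum_i (if [forall i', natdist (l i') (k i') <= natdist (l i) (k i)]%N &&
              (0 < natdist (l i) (k i))%N
            then C / (c * ((natdist (l i) (k i))%:R / m%:R)) ^+ (n - 1) else 0).
  move=> lk.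
  have [i1 li1] : exists i, l i != k i.
    apply/existsP; rewrite -negb_forall; apply: contra lk => /forallP h.
    by apply/eqP/ffunP => i; exact/eqP.
  pose i := [arg max_(i > i1) natdist (l i) (k i)].
  have imax : [forall i', natdist (l i') (k i') <= natdist (l i) (k i)]%N.
    apply/forallP => i'; rewrite /i; case: arg_maxnP => // i2 _; exact.
  have ipos : (0 < natdist (l i) (k i))%N.
    apply: leq_trans (forallP imax i1); move: li1.
    by rewrite -val_eqE /natdist addn_gt0 !subn_gt0 /=; case: ltngtP.
  rewrite (bigD1 i) //= imax ipos /=; apply: (@le_trans _ _
      (C / (c * ((natdist (l i) (k i))%:R / m%:R)) ^+ (n - 1))); last first.
    rewrite lerDl; apply: sumr_ge0 => i' _; case: ifP => // _.
    by rewrite divr_ge0 // exprn_ge0 // mulr_ge0 ?(ltW c0) // divr_ge0.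
  have q0 : 0 < c * ((natdist (l i) (k i))%:R / m%:R).
    by rewrite mulr_gt0 // divr_gt0 // ltr0n.
  have qle := dX l k i.
  have e0 : 0 < enorm (X l - X k) by exact: lt_le_trans qle.
  rewrite /trunc_kernel enormC.
  apply: (@le_trans _ _ (kap n b (enorm (X l - X k)))).
    by apply: kap_le => //; rewrite le_max lexx.
  apply: le_trans (hC _ e0 (diam _ _ (EX l) (EX k))) _.
  by rewrite ler_wpM2l // lef_pV2 ?posrE ?exprn_gt0 // lerXn2r // nnegrE ltW.
have row k : \sum_(l : G) trunc_kernel b d (X k) (X l) <= kap n b d + K2 * N%:R.
  rewrite (bigD1 k) //= trunc_kernel_diag ?(ltW d0) // lerD2l.
  apply: le_trans (ler_sum _ (fun l lk => pair k l lk)) _.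
  rewrite exchange_big /=.
  have -> : K2 * N%:R = \sum_(i < n) \sum_(a < m) C * (3 / c * m%:R) ^+ (n - 1).
    rewrite !sumr_const !card_ord -mulrnA -[RHS]mulr_natl natrM /K2 NE natrX.
    have -> : (m%:R : R) ^+ n = m%:R * m%:R ^+ (n - 1).
      by rewrite -exprS -subSn ?subn1 // ltnW.
    by rewrite [in RHS]exprMn; ring.
  apply: ler_sum => i _.
  rewrite (partition_big (fun l : G => l i) xpredT) //=.
  apply: ler_sum => a _.
  pose j := natdist a (k i).
  have [j0|j0] := posnP j.
    rewrite big1 => [|l /andP[_ /eqP lia]].
      by rewrite mulr_ge0 // exprn_ge0 // mulr_ge0 ?divr_ge0 // ltW.
    by rewrite lia -/j j0 andbF.
  pose W := C / (c * (j%:R / m%:R)) ^+ (n - 1).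
  have W0 : 0 <= W.
    by rewrite divr_ge0 // exprn_ge0 // mulr_ge0 ?divr_ge0 // ltW.
  apply: (@le_trans _ _ (\sum_(l : G | (l i == a) &&
      [forall i', natdist (l i') (k i') <= j]%N) W)).
    rewrite [leRHS]big_mkcond [leLHS]big_mkcond /=; apply: ler_sum => l _.
    case: (eqVneq (l i) a) => [lia|_]; last by rewrite andbF.
    rewrite andbT lia -/j j0 andbT /=.
    by case: (l != k) => //; case: ifP.
  rewrite sumr_const -[leLHS]mulr_natl.
  apply: (@le_trans _ _ (((2 * j).+1 ^ (n - 1))%:R * W)).
    by rewrite ler_wpM2r // ler_nat; exact: card_box_le.
  rewrite /W mulrCA ler_wpM2l // natrX -expr_div_n lerXn2r ?nnegrE //.
  - by rewrite divr_ge0 // mulr_ge0 ?divr_ge0 // ltW.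
  - by rewrite mulr_ge0 ?divr_ge0 // ltW.
  have jR : 0 < j%:R :> R by rewrite ltr0n.
  have -> : 3 / c * m%:R = 3 * j%:R / (c * (j%:R / m%:R)).
    by field; rewrite !gt_eqF.
  rewrite ler_wpM2r ?invr_ge0 ?mulr_ge0 ?divr_ge0 ?(ltW c0) //.
  by rewrite -natrM ler_nat -[3%N]/(1 + 2)%N mulnDl mul1n -addn1 addnC leq_add2r.
pose s := [seq X k | k <- index_enum G].
have sizes : size s = N by rewrite size_map /N cardT enumT.
have N0 : (0 < N)%N by apply: leq_trans mN.
have NR : 0 < N%:R :> R by rewrite ltr0n.
have s0 : s != [::] by rewrite -size_eq0 sizes -lt0n.
have sE x : x \in s -> E x by move=> /mapP[k _ ->].
have := hd s s0 sE; rewrite sizes /discrete_energy big_map.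
under eq_bigr => k _ do rewrite big_map.
move=> h; have {}h := le_trans h (ler_sum _ (fun k _ => row k)).
rewrite sumr_const -/N -mulr_natl in h.
have kN : kap n b d < N%:R.
  apply: le_lt_trans (ler_norm _) _; apply: lt_le_trans (truncnS_gt _) _.
  by rewrite ler_nat.
have : N%:R * (N%:R - kap n b d) <= 0 by lra.
by rewrite pmulr_rle0 // subr_le0 leNgt kN.
Qed.

End Grid.

(** * Tilted barriers and contact on the exceptional set *)

Section Tilts.
Context {R : realType} {n : nat}.
Implicit Types (Om E N : set 'rV[R]_n) (x z p : 'rV[R]_n).

(** The exponential is the barrier that makes the operator inequality strict, [ta] keeps the linear
    part subordinate to it, and [ep] scales the sum so that the perturbed jet stays in the box of
    the derivative bounds. *)
Definition tilt (ep al ta : R) (i0 : 'I_n) p z : R :=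
  ep * (expR (al * z ord0 i0) + ta * dot p z).

Lemma jet_on_tilt (ep al ta : R) i0 p :
  jet_on setT (tilt ep al ta i0 p)
    (fun i z => ep * (al * expR (al * z ord0 i0) * (i == i0)%:R + ta * p ord0 i))
    (fun i j z => ep * al ^+ 2 * expR (al * z ord0 i0) *
                  ((i == i0)%:R * (j == i0)%:R)).
Proof.
have := jet_on_scale ep (jet_on_add (jet_on_expR setT al i0)
  (jet_on_scale ta (jet_on_dot setT p))).
apply: jet_on_eq => [z|i z|i j z].
- by rewrite /tilt.
- by [].
- by rewrite /cst mulr0 addr0 !mulrA.
Qed.

(** Near a point closer than [d] to [E] the implication is vacuous; elsewhere lower semicontinuity
    of [u - v] gives a local constant. The result confines contact to a neighbourhood of [E]. *)
Lemma uniform_gap Om E N u (v : 'rV[R]_n -> R) (d : R) :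
  open (Om `\` E) -> LSC (Om `\` E) u ->
  (forall x, (Om `\` E) x -> {for x, continuous v}) ->
  (forall x, (Om `\` E) x -> ((v x)%:E < u x)%E) ->
  compact N -> N `<=` Om -> 0 < d ->
  exists2 c, 0 < c & forall x, N x -> (forall y, E y -> d <= `|x - y|) ->
    ((v x + c)%:E <= u x)%E.
Proof.
move=> oD lsc cv vu cN NOm d0.
apply: (@compact_uniform R _ N (fun c x => (forall y, E y -> d <= `|x - y|) ->
    ((v x + c)%:E <= u x)%E) cN).
  move=> e c x c0 ce h /h; apply: le_trans; rewrite lee_fin; lra.
move=> x Nx; have [far|] := pselect (forall y, E y -> d <= `|x - y|).
  have Dx : (Om `\` E) x.
    by split; [exact: NOm|move=> Ex; have := far x Ex; rewrite subrr normr0 leNgt d0].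
  have [|r r0 [e e0 h]] := @LSC_sub_lt R n _ u v x 0 oD lsc (cv x Dx) Dx.
    by rewrite addr0; exact: vu.
  exists e => //; exists r => // y yx _ _.
  by apply/ltW; rewrite -[v y]addr0; exact: h.
move=> /existsNP[y /not_implyP[Ey /negP]]; rewrite -ltNge => xy.
exists 1 => //; exists (d - `|x - y|); first by rewrite subr_gt0.
move=> z zx _ /(_ y Ey); rewrite leNgt => /negP[].
rewrite -(subrKA x); apply: le_lt_trans (ler_normD _ _) _.
by rewrite -ltrBrDr.
Qed.

Lemma laplacian_bounded Om N (v : 'rV[R]_n -> R) gv Hv :
  jet_on Om v gv Hv -> compact N -> N `<=` Om ->
  exists2 L, 0 <= L & forall x, N x -> `|\sum_i Hv i i x| <= L.
Proof.
move=> jv cN NOm.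
have [||e e0 he] := @compact_uniform R _ N
    (fun e x => `|\sum_i Hv i i x| <= e^-1) cN.
- move=> e d x d0 de /le_trans; apply; rewrite lef_pV2 ?posrE //.
  exact: lt_le_trans de.
- move=> x Nx; have Omx := NOm x Nx.
  have nearH i : \forall y \near x, `|Hv i i y| <= `|Hv i i x| + 1.
    have /(@cvgrPdist_lt _ _ _ (nbhs x))/(_ _ ltr01) := jet_cont2 jv (i := i) (j := i) Omx.
    apply: filterS => y h; rewrite -lerBlDl; apply: le_trans (ltW h).
    by rewrite distrC; exact: lerB_dist.
  have /nbhs_norm_lt[r r0 hr] := filter_forall (nbhs_filter x) nearH.
  pose S := \sum_i (`|Hv i i x| + 1); have S0 : 0 <= S.
    by apply: sumr_ge0 => i _; rewrite addr_ge0.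
  exists (S + 1)^-1; first by rewrite invr_gt0 ltr_wpDl.
  exists r => // y yx _; rewrite invrK (le_trans (ler_norm_sum _ _ _)) //.
  apply: (@le_trans _ _ S); last by rewrite lerDl.
  by apply: ler_sum => i _; exact: hr.
by exists e^-1 => //; rewrite invr_ge0 ltW.
Qed.

End Tilts.

Section Contact.
Context {R : realType} {n : nat}.
Variables (Om E N : set 'rV[R]_n) (u : 'rV[R]_n -> \bar R) (v : 'rV[R]_n -> R).
Variables (gv : 'I_n -> 'rV[R]_n -> R) (Hv : 'I_n -> 'I_n -> 'rV[R]_n -> R).
Variables (F : @jet_space R n -> R) (i0 : 'I_n) (d e c0 ep al ta hmin hmax B : R).
Hypotheses (oOm : open Om) (oD : open (Om `\` E)).
Hypothesis lsc : LSC (Om `\` E) u.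
Hypothesis jv : jet_on Om v gv Hv.
Hypothesis vu : forall x, (Om `\` E) x -> ((v x)%:E < u x)%E.
Hypothesis C1F : C1_operator Om F.
Hypothesis Fuv : visc_F_ge (Om `\` E) F u v.
Hypotheses (cN : compact N) (NOm : N `<=` Om) (d0 : 0 < d).
Hypothesis EN : forall x y, E x -> `|y - x| <= d -> N y.
Hypothesis e0 : 0 < e.
Hypothesis bnd : forall x, N x ->
  forall z : 'rV[R]_n * R * 'rV[R]_n * 'M[R]_n, sym_jets z -> z.1.1.1 = x ->
    `|z.1.1.2 - v x| < e -> `|z.1.2 - \row_i gv i x| < e ->
    `|z.2 - \matrix_(i, j) Hv i j x| < e ->
    [/\ `|'D_dir_s F z| <= e^-1, forall i, `|'D_(dir_p i) F z| <= e^-1 &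
        'D_(dir_M i0) F z <= - e].
Hypothesis gap : forall x, N x -> (forall y, E y -> d / 2 <= `|x - y|) ->
  ((v x + c0)%:E <= u x)%E.
Hypotheses (ep0 : 0 < ep) (al0 : 0 < al) (ta0 : 0 < ta) (hmin0 : 0 < hmin).
Hypotheses (hB : 0 <= B).
Hypothesis hexp : forall z, Om z -> hmin <= expR (al * z ord0 i0) <= hmax.
Hypothesis ta_small : ta * (B + n%:R) <= hmin / 2.
Hypothesis ep_e : ep * ((1 + al + al ^+ 2) * hmax + hmin) < e.
Hypothesis ep_c0 : ep * ((1 + al + al ^+ 2) * hmax + hmin) < c0.
Hypothesis al_big : (2 + al) * e^-1 < e * al ^+ 2.
Hypothesis small_gap : forall c, 0 < c -> exists y x,
  [/\ (Om `\` E) y, E x, `|y - x| <= d & (u y < (v y + c)%:E)%E].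

(* A contact of the tilted function off E is excluded by the operator: the
   Hessian of exp(al x_0) dominates the lower order terms. Hence contact takes
   place on E. *)
Lemma contact_exists (p : 'rV[R]_n) : (forall i, `|p ord0 i| <= 1) ->
  (forall z, Om z -> `|dot p z| <= B) ->
  exists m, exists2 x, E x &
    (forall z, (N `\` E) z -> ((v z + (tilt ep al ta i0 p z + m))%:E <= u z)%E) /\
    (forall s c, 0 < s -> 0 < c -> exists z, [/\ (Om `\` E) z, `|z - x| < s &
       (u z < (v z + (tilt ep al ta i0 p z + m) + c)%:E)%E]).
Proof.
move=> p1 pB; pose th := tilt ep al ta i0 p; pose h (z : 'rV[R]_n) := expR (al * z ord0 i0).
have jth := jet_on_tilt ep al ta i0 p.
have DOm : Om `\` E `<=` Om by move=> z [].
have ND z : (N `\` E) z -> (Om `\` E) z by move=> [Nz Ez]; split=> //; exact: NOm.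
have taB : 0 <= ta * B by rewrite mulr_ge0 // ltW.
have tan : 0 <= ta * n%:R by rewrite mulr_ge0 // ltW.
have taB2 : ta * B <= hmin / 2 by move: ta_small; rewrite mulrDr; lra.
have th_bound z : Om z -> ep * (hmin / 2) <= th z <= ep * (h z + hmin / 2).
  move=> Oz; have /andP[h1 h2] := hexp Oz.
  have : `|ta * dot p z| <= ta * B by rewrite normrM gtr0_norm // ler_pM2l // pB.
  rewrite ler_norml => /andP[k1 k2]; rewrite /th /tilt -/(h z) !ler_pM2l //.
  by move: h1; rewrite -/(h z) => h1; apply/andP; split; lra.
have hmax0 z : Om z -> 0 < hmax.
  by move=> /hexp/andP[k1 k2]; apply: lt_le_trans k2; apply: lt_le_trans k1.
have th_small z : Om z -> th z < c0 /\ th z < e.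
  move=> Oz; have /andP[_ t2] := th_bound z Oz; have /andP[_ h2] := hexp Oz.
  have hz : h z <= hmax by exact: h2.
  have k : ep * (h z + hmin / 2) <= ep * ((1 + al + al ^+ 2) * hmax + hmin).
    rewrite ler_pM2l // !mulrDl mul1r.
    have := mulr_ge0 (ltW al0) (ltW (hmax0 z Oz)).
    have := mulr_ge0 (sqr_ge0 al) (ltW (hmax0 z Oz)).
    by have := hmin0; lra.
  by split; apply: le_lt_trans t2 _; apply: le_lt_trans k _.
have jf := jet_on_add (jet_on_sub DOm jv) (jet_on_sub (@subsetT _ (Om `\` E)) jth).
(* The tilt is below [c0], which makes [- c0] an admissible lower bound. It is also at least
   [ep * (hmin / 2)], so [small_gap] provides a point where the difference is negative. *)
have [||m [m0 le_m [[x [Nx Ex] ux]|[x Ex clx]]]] :=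
  @inf_dichotomy R n Om E N u (fun z => v z + th z) (- c0) oD lsc cN NOm
  (fun x Dx => jet_cont jf Dx).
- move=> z Nz; apply: le_trans (ltW (vu (ND _ Nz))); rewrite lee_fin.
  by have [] := th_small z (NOm Nz.1); lra.
- have [|y [x [Dy Ex yx uy]]] := small_gap (c := ep * (hmin / 2)).
    by rewrite mulr_gt0 // divr_gt0.
  exists y; first by split; [exact: EN Ex yx|exact: Dy.2].
  apply: lt_le_trans uy _; rewrite lee_fin lerD2l.
  by have /andP[] := th_bound y Dy.1.
- exfalso; have Ox := NOm Nx; have Dx : (Om `\` E) x by [].
  have th_m : 0 < th x + m.
    by have := vu Dx; rewrite ux lte_fin; lra.
  (* Contact at distance [d / 2] or more from [E] would contradict [gap]. Hence points off [E]
     within [d / 2] of [x] are in [N], and touching is local. *)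
  have [y Ey xy] : exists2 y, E y & `|x - y| < d / 2.
    apply: contrapT => far; have : ((v x + c0)%:E <= u x)%E.
      apply: gap => // y Ey; rewrite leNgt; apply/negP => lt; apply: far.
      by exists y.
    rewrite ux lee_fin; have [] := th_small x Ox; lra.
  have d20 : 0 < d / 2 by rewrite divr_gt0.
  have [|z Dz zx||phi [C2phi phiu phix jphi _]] :=
    @touching_local R n _ u v _ _ _ x (d / 2) c0 oD
      (jet_on_add jf (jet_on_cst (Om `\` E) m)) vu _ Dx d20.
  + by move=> z Dz; have [] := th_small z Dz.1; rewrite /cst -/(th z); lra.
  + apply: le_m; split; last exact: Dz.2.
    apply: (EN Ey); rewrite -(subrKA x); apply: le_trans (ler_normD _ _) _.
    by rewrite [leRHS]splitr ltW // ltrD.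
  + by rewrite ux.
  have := Fuv C2phi phiu Dx phix; rewrite jphi.
  have [-> _] := jet_on_jet oOm jv Ox; rewrite leNgt => /negP; apply.
  (* The jet of the test function is that of [v] moved by [th x + m], [p'] and
     [a *: delta_mx i0 i0]. *)
  pose p' : 'rV[R]_n := \row_i (ep * (al * h x * (i == i0)%:R + ta * p ord0 i)).
  pose a := ep * al ^+ 2 * h x.
  have sM : (\matrix_(i, j) Hv i j x)^T = \matrix_(i, j) Hv i j x.
    by apply/matrixP => i j; rewrite !mxE; exact: jet_hess_sym oOm jv Ox.
  have /andP[h1 h2] := hexp Ox.
  have hx0 : 0 < h x by exact: expR_gt0.
  have thx : th x + m <= ep * (h x + hmin / 2).
    by have /andP[_] := th_bound x Ox; lra.
  have alh0 : 0 <= al * h x by rewrite mulr_ge0 // ltW.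
  have tan1 i : ta * `|p ord0 i| <= ta by rewrite ler_piMr // ltW.
  have p'i i : `|p' ord0 i| <= ep * (al * h x * (i == i0)%:R + ta).
    rewrite mxE normrM gtr0_norm // ler_pM2l // (le_trans (ler_normD _ _)) //.
    rewrite (ger0_norm (mulr_ge0 alh0 (ler0n _ _))) lerD2l normrM gtr0_norm //.
  have ta_hmin : ta <= hmin / 2.
    apply: le_trans ta_small; rewrite ler_peMr ?(ltW ta0) //.
    rewrite -[leLHS]add0r lerD // ler1n; case: (i0) => k kn.
    exact: leq_ltn_trans kn.
  have s'e : `|th x + m| < e.
    by rewrite gtr0_norm //; have [_] := th_small x Ox; lra.
  have hxmax : h x <= hmax by [].
  have alhmax : al * h x <= al * hmax by rewrite ler_pM2l.
  have al2hmax : al ^+ 2 * h x <= al ^+ 2 * hmax.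
    by rewrite ler_pM2l // exprn_gt0.
  have alhx0 : 0 <= al * hmax by exact: le_trans alhmax.
  have al2hx0 : 0 <= al ^+ 2 * hmax by rewrite mulr_ge0 ?sqr_ge0 // (ltW (hmax0 _ Ox)).
  have p'e : `|p'| < e.
    apply/rV_norm_lt => // i; apply: le_lt_trans (p'i i) _.
    apply: le_lt_trans ep_e; rewrite ler_pM2l //.
    have : al * h x * (i == i0)%:R <= al * h x by rewrite ler_piMr //; case: (_ == _).
    by have := hmax0 _ Ox; lra.
  have a_bnd : 0 <= a < e.
    have -> /= : 0 <= a := mulr_ge0 (mulr_ge0 (ltW ep0) (sqr_ge0 al)) (ltW hx0).
    apply: le_lt_trans ep_e; rewrite /a -mulrA ler_pM2l //.
    by have := hmax0 _ Ox; lra.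
  have := @F_increment R n Om F i0 x (v x) _ _ e (th x + m) a p' C1F Ox sM e0
    (bnd Nx) s'e p'e a_bnd.
  have -> : \row_i gv i x + p' = \row_i (gv i x + ep * (al * expR (al * x ord0 i0) *
      (i == i0)%:R + ta * p ord0 i) + cst 0 x).
    by apply/rowP => i; rewrite !mxE addr0.
  have -> : \matrix_(i, j) Hv i j x + a *: delta_mx i0 i0 = \matrix_(i, j) (Hv i j x +
      ep * al ^+ 2 * expR (al * x ord0 i0) * ((i == i0)%:R * (j == i0)%:R) + cst 0 x).
    by apply/matrixP => i j; rewrite !mxE addr0 -mulnb natrM.
  rewrite addrA -subr_lt0 => /le_lt_trans; apply.
  rewrite subr_lt0 gtr0_norm //.
  have sump' : \sum_i `|p' ord0 i| <= ep * (al * h x + ta * n%:R).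
    apply: le_trans (ler_sum _ (fun i _ => p'i i)) _.
    rewrite -mulr_sumr ler_pM2l // big_split /= sumr_const card_ord mulr_natr lerD2r.
    by rewrite -mulr_sumr (bigD1 i0) //= eqxx big1 ?addr0 ?mulr1 // => i /negbTE ->.
  have ei0 : 0 < e^-1 by rewrite invr_gt0.
  (* The lower order terms total at most [ep * ((2 + al) * h x)], one [h x] absorbing the two halves
     of [hmin]. Against them stands [e * a], quadratic in [al], and [al_big] decides. *)
  apply: (@le_lt_trans _ _ (e^-1 * (ep * ((2 + al) * h x)))).
    rewrite ler_pM2l //; apply: le_trans (lerD thx sump') _.
    have tan2 : ta * n%:R <= hmin / 2 by move: ta_small; rewrite mulrDr; lra.
    have hx1 : hmin <= h x by exact: h1.
    by rewrite -mulrDr ler_pM2l // mulrDl; lra.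
  rewrite /a (_ : e^-1 * _ = (ep * h x) * ((2 + al) * e^-1)); last by ring.
  rewrite (_ : e * _ = (ep * h x) * (e * al ^+ 2)); last by ring.
  by rewrite ltr_pM2l // mulr_gt0.
exists m, x => //; split=> [z Nz|s c s0 c_gt0].
  by rewrite addrA; exact: le_m.
have [z [Nz zx uz]] := clx s c s0 c_gt0.
by exists z; split=> //; [exact: ND|rewrite [v z + _]addrA].
Qed.

End Contact.

(** * Choice of constants and conclusion *)

Section Assembly.
Context {R : realType} {n : nat}.
Implicit Types (Om E : set 'rV[R]_n) (x y p : 'rV[R]_n).

Lemma bounded_set_norm Om : bounded_set Om ->
  exists2 M, 0 <= M & forall x, Om x -> `|x| <= M.
Proof.
move=> [M [_ hM]]; exists (`|M| + 1) => [|x Ox]; first by rewrite addr_ge0.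
by apply: hM => //; rewrite (le_lt_trans (ler_norm M)) // ltrDl.
Qed.

Lemma norm_dot_le p x (B : R) : (forall i, `|p ord0 i| <= 1) -> `|x| <= B ->
  `|dot p x| <= n%:R * B.
Proof.
move=> p1 xB; have -> : n%:R * B = \sum_(i < n) B.
  by rewrite sumr_const card_ord mulr_natl.
apply: le_trans (ler_norm_sum _ _ _) _; apply: ler_sum => i _.
rewrite normrM -[leRHS]mul1r ler_pM //.
exact: le_trans (ler_coord_norm x i) xB.
Qed.

Lemma small_gaps Om E (u : 'rV[R]_n -> \bar R) (v : 'rV[R]_n -> R) :
  (forall x, (Om `\` E) x -> ((v x)%:E < u x)%E) ->
  (limf_einf (fun x => u x - (v x)%:E)%E (near_set E (Om `\` E)) <= 0)%E ->
  forall d c, 0 < d -> 0 < c -> exists y x,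
    [/\ (Om `\` E) y, E x, enorm (y - x) < d & (u y < (v y + c)%:E)%E].
Proof.
move=> vu; rewrite limf_einfE => le0 d c d0 c0.
pose V := [set x | (Om `\` E) x /\ (dist_to E x < d%:E)%E].
have inf0 : (ereal_inf [set (u x - (v x)%:E)%E | x in V] < c%:E)%E.
  apply: (@le_lt_trans _ _ 0%E); last by rewrite lte_fin.
  apply: le_trans le0; apply: ereal_sup_ubound; exists V => //.
  by exists d.
have /ereal_inf_lt[_ [y [Dy dy] <-] uy] := inf0.
have /ereal_inf_lt[_ [x Ex <-] yx] := dy.
exists y, x; split=> //.
by move: uy; rewrite lteBlDr // -EFinD addrC.
Qed.

End Assembly.

Theorem theorem1p3 (R : realType) (n : nat) (hn : (2 <= n)%N)
  (Omega : set 'rV[R]_n) (hOmega : is_domain Omega)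
  (F : @jet_space R n -> R) (hF : C1_operator Omega F)
  (hell : forall z : @jet_space R n, sym_jets_over Omega z ->
            posdefmx (- dF_dM F z))
  (E : set 'rV[R]_n) (hEOmega : E `<=` Omega) (hEclosed : closed E)
  (hEcap : zero_capacity E)
  (u : 'rV[R]_n -> \bar R) (hu : LSC (Omega `\` E) u)
  (v : 'rV[R]_n -> R) (hv : C2_on Omega v)
  (C : R) (huC : visc_laplacian_le (Omega `\` E) u C)
  (huv : forall x, (Omega `\` E) x -> ((v x)%:E < u x)%E)
  (hFuv : visc_F_ge (Omega `\` E) F u v) :
  (0 < limf_einf (fun x => u x - (v x)%:E) (near_set E (Omega `\` E)))%E.
Proof.
have [oOm _ bOm] := hOmega.
have oD : open (Omega `\` E) by apply: openI => //; exact: closed_openC.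
have [M1 M10 hM1] := bounded_set_norm bOm.
have cE : compact E.
  apply: bounded_closed_compact => //; exists M1; split; first exact: num_real.
  by move=> B M1B x /hEOmega/hM1 /le_trans; apply; exact: ltW.
have jv := C2_on_jet_on oOm hv.
rewrite ltNge; apply/negP => le0.
have small := small_gaps huv le0.
(* For empty [E] every distance is infinite and the lower limit is [+oo], so the negated conclusion
   provides a point of [E]. *)
have E0 : E !=set0.
  by have [_ [x [_ Ex _ _]]] := small 1 1 ltr01 ltr01; exists x.
pose i0 : 'I_n := Ordinal (ltnW hn).
pose r0 := Num.sqrt n%:R * (M1 + M1) + 1.
have sn0 : 0 <= Num.sqrt n%:R :> R by exact: sqrtr_ge0.
have r00 : 0 < r0 by rewrite ltr_wpDl // mulr_ge0 // addr_ge0.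
have diamO x y : Omega x -> Omega y -> enorm (x - y) <= r0.
  move=> Ox Oy; apply: le_trans (enorm_le x y) _; rewrite /r0.
  apply: (@le_trans _ _ (Num.sqrt n%:R * (M1 + M1))); last by rewrite lerDl.
  rewrite ler_wpM2l //; apply: le_trans (ler_normB _ _) _.
  by rewrite lerD ?hM1.
have [b hb] := @kap_ge0 R n r0 r00.
have diamE x y : E x -> E y -> enorm (x - y) <= r0.
  by move=> Ex Ey; apply: diamO; exact: hEOmega.
have divE := zero_capacity_diverge hn cE hEcap r00 hb diamE.
have kap0 x y : E x -> (Omega `\` E) y -> 0 <= kap n b (enorm (y - x)).
  move=> Ex [Oy nEy]; apply: hb; last by apply: diamO => //; exact: hEOmega.
  by rewrite enormE sqrtr_gt0 sqdist_gt0 //; apply/eqP => yx; apply: nEy; rewrite yx.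
have [d d0 hd] := thickening_sub cE oOm hEOmega.
pose N := [set y | exists2 x, E x & `|y - x| <= d].
have cN : compact N := compact_thickening cE d0.
have NOm : N `<=` Omega by move=> y [x Ex]; exact: hd.
have EN x y : E x -> `|y - x| <= d -> N y by move=> Ex yx; exists x.
have [e e0 bnd] := F_derivative_bounds i0 oOm hF hell jv cN NOm.
have d20 : 0 < d / 2 by rewrite divr_gt0.
have [c0 c00 gap] := uniform_gap oD hu
  (fun x (Dx : (Omega `\` E) x) => jet_cont jv Dx.1) huv cN NOm d20.
have [La La0 hLa] := laplacian_bounded jv cN NOm.
(* Then [e ^+ 2 * al = e ^+ 2 + 3], so [e ^+ 2 * al ^+ 2] exceeds [3 * al], which is at least
   [2 + al]. *)
pose al := 1 + 3 / e ^+ 2.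
have e20 : 0 < e ^+ 2 by rewrite exprn_gt0.
have al1 : 1 <= al by rewrite /al lerDl divr_ge0 // ltW.
have al0 : 0 < al by exact: lt_le_trans al1.
have al_big : (2 + al) * e^-1 < e * al ^+ 2.
  rewrite ltr_pdivrMr // mulrAC -expr2 expr2 mulrA.
  have -> : e ^+ 2 * al = e ^+ 2 + 3 by rewrite /al; field; rewrite gt_eqF.
  apply: (@le_lt_trans _ _ (3 * al)); first lra.
  by rewrite ltr_pM2r // ltrDr.
pose hmin := expR (- (al * M1)); pose hmax := expR (al * M1).
have hmin0 : 0 < hmin by exact: expR_gt0.
have hmax0 : 0 < hmax by exact: expR_gt0.
have hexp z : Omega z -> hmin <= expR (al * z ord0 i0) <= hmax.
  move=> Oz; have := le_trans (ler_coord_norm z i0) (hM1 z Oz).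
  rewrite ler_norml => /andP[k1 k2]; rewrite !ler_expR -mulrN.
  by rewrite !ler_pM2l // k1 k2.
pose B := n%:R * M1.
have B0 : 0 <= B by rewrite mulr_ge0.
(* The linear part of the tilt, bounded by [B], and its gradient together use at most half of the
   lower bound [hmin] of the exponential. *)
pose ta := hmin / 2 / (B + n%:R + 1).
have Bn0 : 0 < B + n%:R + 1 by rewrite ltr_wpDl // addr_ge0.
have ta0 : 0 < ta by rewrite !divr_gt0.
have ta_small : ta * (B + n%:R) <= hmin / 2.
  by rewrite /ta mulrAC ler_pdivrMr // ler_pM2l ?divr_gt0 // lerDl.
(* Up to the factor [ep], this majorises the value, the partial derivatives and the Hessian entries
   of the tilt. *)
pose big := (1 + al + al ^+ 2) * hmax + hmin.
have big0 : 0 < big.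
  apply: addr_gt0 => //; apply: mulr_gt0 => //.
  by apply: addr_gt0; [exact: addr_gt0|exact: exprn_gt0].
pose ep := Num.min e c0 / 2 / big.
have ec0 : 0 < Num.min e c0 by rewrite lt_min e0.
have ep0 : 0 < ep by rewrite !divr_gt0.
have epbig : ep * big < Num.min e c0.
  by rewrite /ep mulfVK ?gt_eqF // ltr_pdivrMr // ltr_pMr // ltr1n.
have [ep_e ep_c0] : ep * big < e /\ ep * big < c0.
  by move: epbig; rewrite lt_min => /andP.
have small_gap c : 0 < c -> exists y x,
    [/\ (Omega `\` E) y, E x, `|y - x| <= d & (u y < (v y + c)%:E)%E].
  move=> cgt0; have [y [x [Dy Ex yx uy]]] := small d c d0 cgt0.
  exists y, x; split=> //; apply: le_trans (ltW yx); exact: ler_norm_enorm.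
have contact (p : 'rV[R]_n) (p1 : forall i, `|p ord0 i| <= 1) :=
  contact_exists oOm oD hu jv huv hF hFuv cN NOm d0 EN e0 bnd gap ep0 al0 ta0
    hmin0 B0 hexp ta_small ep_e ep_c0 al_big small_gap p1
    (fun z Oz => norm_dot_le p1 (hM1 z Oz)).
pose gam := n%:R + `|C| + `|La| + 1.
have gam1 : 1 <= gam by rewrite /gam lerDr !addr_ge0.
(* The largest [r] for which the region used by [contact_slope] fits within distance [d] of its
   centre. *)
pose r1 := d / (2 * (2 * gam + 3)).
have g30 : 0 < 2 * (2 * gam + 3) by lra.
have r10 : 0 < r1 by rewrite divr_gt0.
(* The first term serves contact points closer than [r1], through [contact_slope]. For the others
   the slopes differ by at most [ep * ta * Num.sqrt n%:R], while the distance is at least [r1]. *)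
pose K := 8 * (gam + 1) + ep * ta * Num.sqrt n%:R / r1.
have K10 : 0 < 8 * (gam + 1) by lra.
have epta0 : 0 < ep * ta by rewrite mulr_gt0.
have K2 : 0 <= ep * ta * Num.sqrt n%:R / r1.
  by rewrite divr_ge0 ?(ltW r10) // mulr_ge0 // ltW.
have K0 : 0 < K by rewrite ltr_wpDr.
apply: (@grid_energy_bounded R n E b r0 (ep * ta / K) hn divE) => //.
  by rewrite divr_gt0.
move=> m m0; have mR : 0 < m%:R :> R by rewrite ltr0n.
pose P (k : {ffun 'I_n -> 'I_m}) : 'rV[R]_n := \row_i ((k i)%:R / m%:R).
have P1 k i : `|P k ord0 i| <= 1.
  rewrite mxE ger0_norm ?divr_ge0 // ler_pdivrMr // mul1r ler_nat.
  exact/ltnW/ltn_ord.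
have /choice[mX hX] : forall k, exists mx : R * 'rV[R]_n, E mx.2 /\
    (forall z, (N `\` E) z -> ((v z + (tilt ep al ta i0 (P k) z + mx.1))%:E <= u z)%E) /\
    (forall s c, 0 < s -> 0 < c -> exists z, [/\ (Omega `\` E) z, `|z - mx.2| < s &
       (u z < (v z + (tilt ep al ta i0 (P k) z + mx.1) + c)%:E)%E]).
  by move=> k; have [c [x Ex [h1 h2]]] := contact (P k) (P1 k); exists (c, x).
exists (fun k => (mX k).2); split=> [k|k l i]; first by have [] := hX k.
set x := (mX k).2; set y := (mX l).2.
have [Ex [x_le x_ct]] := hX k; have [Ey [y_le y_ct]] := hX l.
pose a : 'rV[R]_n := (ep * ta) *: (P l - P k).
have tiltE z : tilt ep al ta i0 (P l) z + (mX l).1 =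
    tilt ep al ta i0 (P k) z + (mX k).1 + (dot a z + ((mX l).1 - (mX k).1)).
  have -> : dot a z = ep * ta * (dot (P l) z - dot (P k) z).
    rewrite dotZl; congr (_ * _); rewrite /dot -sumrB.
    by apply: eq_bigr => j _; rewrite !mxE mulrBl.
  by rewrite /tilt; ring.
have jth := jet_on_add (jet_on_tilt ep al ta i0 (P k)) (jet_on_cst setT (mX k).1).
have slope r : 0 < r -> enorm (y - x) <= r -> r <= r1 ->
    enorm a <= 8 * (gam + 1) * r.
  move=> rgt0 yxr rr1.
  apply: (@contact_slope R n Omega E u v _ _ b C hn bOm oD E0 divE kap0 hu jv
    huC huv _ _ _ x y a ((mX l).1 - (mX k).1) r d La jth) => //.
  - by move=> z; exact: hd.
  - by move=> z [Oz nEz] zx; apply: x_le; split=> //; exact: EN zx.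
  - move=> z [Oz nEz] zx; rewrite -addrA -tiltE.
    by apply: y_le; split=> //; exact: EN zx.
  (* The Hessian of the tilt has a nonnegative diagonal, so the bound [La] obtained for [v] serves
     all slopes alike. *)
  - move=> z [Oz nEz] zx; have := hLa z (EN _ _ Ex zx).
    rewrite ler_norml => /andP[h _]; apply: le_trans h _.
    apply: ler_sum => j _; rewrite lerDl /cst addr0.
    exact: (mulr_ge0 (mulr_ge0 (mulr_ge0 (ltW ep0) (sqr_ge0 al)) (expR_ge0 _))
      (mulr_ge0 (ler0n _ _) (ler0n _ _))).
  - move=> s c s0 cgt0; have [z [Dz zy uz]] := y_ct s c s0 cgt0.
    by exists z; split=> //; rewrite -[X in (X + c)%:E]addrA -tiltE.
  - move: rr1; rewrite /r1 ler_pdivlMr // => h.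
    by apply: le_trans h; rewrite le_eqVlt; apply/orP; left; apply/eqP; rewrite -/gam; ring.
have aK : enorm a <= K * enorm (x - y).
  rewrite enormC; have [far|close] := leP r1 (enorm (y - x)).
    apply: (@le_trans _ _ (ep * ta * Num.sqrt n%:R / r1 * enorm (y - x))).
      rewrite mulrAC ler_pdivlMr //; apply: ler_pM => //; first exact: enorm_ge0.
        exact: ltW.
      have := enorm_le a 0; rewrite !subr0 => /le_trans; apply.
      rewrite mulrC ler_wpM2r // normrZ (gtr0_norm epta0) ler_piMr //.
        exact: ltW.
      apply/rV_norm_le => // j; have := P1 k j; have := P1 l j.
      rewrite !mxE !ler_norml => /andP[_ h1] /andP[_ h2].
      have : 0 <= (k j)%:R / m%:R :> R by rewrite divr_ge0.
      have : 0 <= (l j)%:R / m%:R :> R by rewrite divr_ge0.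
      by move=> h3 h4; apply/andP; split; lra.
    by rewrite ler_wpM2r ?enorm_ge0 // lerDr ltW.
  apply: (@le_trans _ _ (8 * (gam + 1) * enorm (y - x))); last first.
    by rewrite ler_wpM2r ?enorm_ge0 // lerDl.
  (* [contact_slope] asks for a positive [r]. For coincident contact points it holds with every
     small [r], which forces [a] to vanish. *)
  have := enorm_ge0 (y - x); rewrite le_eqVlt => /orP[/eqP yx0|yx0]; last first.
    by apply: slope => //; exact: ltW.
  rewrite -yx0 mulr0 leNgt; apply/negP => a0.
  pose r := Num.min r1 (enorm a / (2 * (8 * (gam + 1)))).
  have rgt0 : 0 < r by rewrite lt_min r10 divr_gt0 // mulr_gt0.
  have := slope r rgt0; rewrite -yx0 (ltW rgt0) ge_min lexx => /(_ isT isT).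
  apply/negP; rewrite -ltNge.
  apply: (@le_lt_trans _ _ (8 * (gam + 1) * (enorm a / (2 * (8 * (gam + 1)))))).
    by rewrite ler_pM2l // /r ge_min lexx orbT.
  have -> : 8 * (gam + 1) * (enorm a / (2 * (8 * (gam + 1)))) = enorm a / 2.
    by field; rewrite gt_eqF //; lra.
  by rewrite ltr_pdivrMr // ltr_pMr // ltr1n.
rewrite mulrAC ler_pdivrMr // [leRHS]mulrC; apply: le_trans aK.
have ai : `|a ord0 i| <= enorm a.
  apply: le_trans (ler_coord_norm a i) _.
  by have := ler_norm_enorm a 0; rewrite !subr0.
(* A coordinate of [a] is [ep * ta / m%:R] times a difference of grid indices, so the Lipschitz
   bound becomes the separation that the grid estimate asks for. *)
apply: le_trans ai; rewrite !mxE normrM (gtr0_norm epta0) ler_pM2l //.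
rewrite -mulrBl normrM [in leRHS](gtr0_norm (_ : 0 < m%:R^-1)) ?invr_gt0 //.
rewrite ler_pM2r ?invr_gt0 // /natdist.
have [lk|kl] := leqP (l i) (k i).
  have /eqP -> : ((l i : nat) - k i == 0)%N by rewrite subn_eq0.
  by rewrite addn0 natrB // distrC; exact: ler_norm.
have /eqP -> : ((k i : nat) - l i == 0)%N by rewrite subn_eq0 ltnW.
by rewrite add0n (natrB _ (ltnW kl)); exact: ler_norm.
Qed.
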